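(* For every integer $k\ge 2$ and every $\beta>0$ there is an $\varepsilon>0$ such that for every $p$ with $0<p<1$ the following holds. Let $G$ be a graph on $n\ge 3$ vertices with minimum degree $\delta(G)\ge\beta pn$. (a) If $G$ is $(p,\varepsilon p^{5/2}n)$-jumbled, then $G$ contains a square (second power) of a Hamilton cycle. (b) If $G$ is $(p,\varepsilon p^{3k/2}n)$-jumbled, then $G$ contains a $k$th power of a Hamilton cycle.
   Context: Graphs are finite and simple. A graph $G$ is $(p,\gamma)$-jumbled if $\big|e(A,B)-p|A||B|\big|\le\gamma\sqrt{|A||B|}$ for all disjoint $A,B\subseteq V(G)$, where $e(A,B)$ is the number of edges with one endvertex in $A$ and the other in $B$. The $k$th power of a graph $H$ is the graph on $V(H)$ in which two distinct vertices are adjacent if and only if their distance in $H$ is at most $k$. $G$ contains a $k$th power of a Hamilton cycle if it contains, as a (not necessarily induced) spanning subgraph, the $k$th power of a cycle through all vertices of $G$. *)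

(* Defs.v *)
From HB Require Import structures.
From mathcomp Require Import all_boot all_order all_algebra.
From mathcomp Require Import reals exp.

Set Implicit Arguments.
Unset Strict Implicit.
Unset Printing Implicit Defensive.

Import Order.TTheory GRing.Theory Num.Theory.

Record sgraph (V : finType) := SGraph {
  adj :> rel V;
  adj_sym : symmetric adj;
  adj_irr : irreflexive adj }.

Section Graphs.
Variable V : finType.
Implicit Types (G H C : sgraph V) (A B : {set V}) (x y v : V).

Definition degree G v : nat := #|[set y | adj G v y]|.

(* Degrees are smaller than #|V|, so the default value of the minimum is
   immaterial as soon as V is nonempty. *)
Definition min_degree G : nat := \big[minn/#|V|]_(v : V) degree G v.

(* An edge is the unordered pair of its endvertices. *)
Definition edges_between G A B : {set {set V}} :=
  [set [set x; y] | x in A, y in B & adj G x y].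

Definition num_edges G A B : nat := #|edges_between G A B|.

Definition has_walk H x y (m : nat) : bool :=
  [exists w : m.-tuple V, path (adj H) x w && (last x w == y)].

(* The least length of a walk from x to y. A shortest walk is a path, hence
   has fewer than #|V| edges; the value is #|V| (junk) if x and y are not
   connected. *)
Definition dist H x y : nat := find (has_walk H x y) (iota 0 #|V|).

Definition power_adj H (k : nat) : rel V :=
  fun x y => [&& x != y, connect (adj H) x y & dist H x y <= k].

Lemma has_walk_sym H x y : has_walk H x y =1 has_walk H y x.
Proof.
suff imp a b m : has_walk H a b m -> has_walk H b a m.
  by move=> m; apply/idP/idP; apply: imp.
case/existsP=> w /andP[pw /eqP <-]; apply/existsP.
have sz : size (rev (belast a w)) == m by rewrite size_rev size_belast size_tuple.
exists (Tuple sz); apply/andP; split=> /=.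
  rewrite rev_path; apply: sub_path pw => u v /=; by rewrite adj_sym.
by case: (tval w) => //= c s; rewrite rev_cons last_rcons.
Qed.

Lemma power_adj_sym H k : symmetric (power_adj H k).
Proof.
move=> x y; rewrite /power_adj eq_sym (sym_connect_sym (@adj_sym _ H)).
by rewrite /dist (eq_find (has_walk_sym H x y)).
Qed.

Lemma power_adj_irr H k : irreflexive (power_adj H k).
Proof. by move=> x; rewrite /power_adj eqxx. Qed.

Definition graph_power H k : sgraph V :=
  SGraph (power_adj_sym H k) (power_adj_irr H k).

(* C is a cycle, of length at least 3, through all vertices of V. *)
Definition spanning_cycle C : Prop :=
  exists s : seq V,
    [/\ 3 <= size s, uniq s, forall x, x \in s &
        forall x y, adj C x y = (next s x == y) || (next s y == x)].

Definition has_hamilton_cycle_power G (k : nat) : Prop :=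
  exists C : sgraph V,
    spanning_cycle C /\ subrel (adj (graph_power C k)) (adj G).

End Graphs.

Local Open Scope ring_scope.

Definition jumbled (R : realType) (V : finType) (G : sgraph V) (p gamma : R)
    : Prop :=
  forall A B : {set V}, [disjoint A & B] ->
    `| (num_edges G A B)%:R - p * #|A|%:R * #|B|%:R |
      <= gamma * Num.sqrt (#|A|%:R * #|B|%:R).

(* Main.v *)
Require Import Defs.
From HB Require Import structures.
From mathcomp Require Import all_boot all_order all_algebra.
From mathcomp Require Import ring lra zify.
From mathcomp Require Import reals exp.

(** Jumbledness is used only through [pseudo]: for every set X few vertices have
   fewer than (p/4)|X| neighbours in X, and few have many more than p|T|
   neighbours in T. The error K in these counts is of order (gamma/p)^2.

   An end of a k-th power of a path is extendable in X ([good]) if the common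
   neighbourhoods in X of its last i vertices have the expected order p^i n
   for all i <= k; one can then add a vertex from X so that the new end is
   extendable in any few given large sets. Two extendable ends are connected
   through boundedly many vertices of X: for K << p^(3k-2) n^2, clique counting
   shows that most cliques across consecutive candidate sets are reached from
   either end; for k = 2 and K << p^3 n^2 the number of reached edges first has
   to grow. A vertex is absorbed by a path of 2k vertices in its neighbourhood
   if k >= 3, and by a zigzag structure if k = 2.

   Set aside two small disjoint sets R1 and R2. Cover the few vertices with low
   degree into R2, then absorb almost all vertices of R1 and R2 into a path
   that uses only vertices outside, and exhaust the outside up to a small set.
   The left-over vertices are covered with the help of vertices of R1, those few
   with low degree into the rest of R1 with the help of R2, and the path is
   closed inside R2. Vertices of R1 and R2 used in this way are dropped from the
   absorbed ones, so the cyclic order covers every vertex exactly once. *)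

(** Sets of orders p^i N and p^j N, with N the number of vertices, can be played against each other
    only if K is well below p^(i+j) N^2, so the exponent of p in K decides which neighbourhoods may
    be intersected. A connecting path starts in the common neighbourhood of k vertices, of order p^k
    N; comparing it with a set of linear size, both cut down to the common neighbours of k-1 further
    vertices, costs p^(k+2(k-1)) = p^(3k-2). For k = 2 the available exponent is 3 and not 4, which
    only admits first sets of order p N; hence the growth of reached edges. Absorbing a vertex
    inside its neighbourhood costs exponent 2k+1, at most 3k-2 only if k >= 3; hence the zigzags.
    Extendability is measured with p/8, while typical vertices keep a fraction p/4 of a set: each
    added vertex regains a factor 2, which pays for the vertices deleted before the next one. The
    minimum degree is used only for the few vertices of low degree into the second reservoir. That n
    is large compared with the powers of 1/p involved is not assumed; it follows from jumbledness
    with a small constant. *)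

Set Implicit Arguments.
Unset Strict Implicit.
Unset Printing Implicit Defensive.

Import Order.TTheory GRing.Theory Num.Theory.
Local Open Scope ring_scope.

(** * Powers of paths *)

Section KPath.
Variables (V : finType) (G : sgraph V) (k : nat).
Implicit Types (s l : seq V) (v x y : V) (X Y : {set V}).

Definition nbs v X : {set V} := [set y in X | adj G v y].

Fixpoint cn l X : {set V} := if l is v :: l' then nbs v (cn l' X) else X.

Fixpoint kpath s : bool :=
  if s is x :: s' then all (adj G x) (take k s') && kpath s' else true.

Lemma adjC x y : adj G x y = adj G y x. Proof. exact: adj_sym. Qed.

Lemma adj_neq x y : adj G x y -> x != y.
Proof. by apply: contraTneq => ->; rewrite adj_irr. Qed.

Lemma in_nbs v X y : (y \in nbs v X) = (y \in X) && adj G v y.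
Proof. by rewrite inE. Qed.

Lemma in_cn l X y : (y \in cn l X) = (y \in X) && all (adj G y) l.
Proof.
elim: l => [|v l IH] /=; first by rewrite andbT.
by rewrite in_nbs IH adjC -andbA [all _ _ && _]andbC.
Qed.

Lemma eq_cn l l' X : l =i l' -> cn l X = cn l' X.
Proof.
move=> e; apply/setP => y; rewrite !in_cn; congr andb; exact: eq_all_r.
Qed.

Lemma cn_sub l X : cn l X \subset X.
Proof. by apply/subsetP => y; rewrite in_cn => /andP[]. Qed.

Lemma nbsS v X Y : X \subset Y -> nbs v X \subset nbs v Y.
Proof.
by move/subsetP=> sXY; apply/subsetP => y; rewrite !in_nbs => /andP[/sXY-> ->].
Qed.

Lemma nbs_sub v X : nbs v X \subset X.
Proof. by apply/subsetP => y; rewrite in_nbs => /andP[]. Qed.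

Lemma cnS l X Y : X \subset Y -> cn l X \subset cn l Y.
Proof.
by move/subsetP=> sXY; apply/subsetP => y; rewrite !in_cn => /andP[/sXY-> ->].
Qed.

Lemma cn_rev l X : cn (rev l) X = cn l X.
Proof. by apply: eq_cn => y; rewrite mem_rev. Qed.

Lemma cn_nbs l v X : cn l (nbs v X) = nbs v (cn l X).
Proof. by apply/setP => y; rewrite !(in_cn, in_nbs) andbAC. Qed.

Lemma take_cat_mem s1 s2 y : y \in take k s1 -> y \in take k (s1 ++ s2).
Proof.
rewrite take_cat; case: ltnP => // h; rewrite mem_cat => /mem_take ->.
exact: orTb.
Qed.

Lemma kpath_cat_l s1 s2 : kpath (s1 ++ s2) -> kpath s1.
Proof.
elim: s1 => //= x s IH /andP[/allP h /IH->]; rewrite andbT.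
by apply/allP => y /(take_cat_mem s2)/h.
Qed.

(** An edge of the power spans at most k positions, so an edge that starts in [s1] cannot jump over
    [s2]. *)
Lemma kpath_glue s1 s2 s3 : (k <= size s2)%N ->
  kpath (s1 ++ s2) -> kpath (s2 ++ s3) -> kpath (s1 ++ s2 ++ s3).
Proof.
move=> hk; elim: s1 => //= x s IH /andP[h1 h2] h3; rewrite IH // andbT.
rewrite catA take_cat size_cat; case: ltnP => h.
  by move: h1.
have e : k = (size s + size s2)%N by lia.
by rewrite e subnn take0 cats0; move: h1; rewrite take_oversize // size_cat e.
Qed.

Lemma kpath_rcons s x :
  kpath (rcons s x) = kpath s && all (adj G x) (take k (rev s)).
Proof.
elim: s => [|y s IH] //=.
rewrite IH rev_cons -!cats1 !take_cat size_rev.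
case: ltnP => h; first by rewrite andbA.
have ts : take k (rev s) = rev s by rewrite take_oversize // size_rev.
rewrite ts (take_oversize h) !all_cat.
case: (k - size s)%N => [|d] /=; first by rewrite !andbT andbA.
rewrite !andbT (adjC x y).
by case: (all _ s); case: (adj _ _ _); case: (kpath s); rewrite ?andbF ?andbT.
Qed.

Lemma kpath_rev s : kpath (rev s) = kpath s.
Proof.
by elim: s => //= x s IH; rewrite rev_cons kpath_rcons IH revK andbC.
Qed.

(** An insertion only moves old vertices further apart, so no new adjacency among them is
    required. *)
Lemma kpath_insert l1 l2 r : kpath (l1 ++ l2) ->
  all (adj G r) (l1 ++ l2) -> kpath (l1 ++ r :: l2).
Proof.
elim: l1 => [|x l1 IH] /=.
  by move=> h1 h2; rewrite h1 andbT; apply/allP => y /mem_take; apply/allP.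
case/andP=> h1 h2 /andP[h3 h4]; rewrite IH // andbT.
apply/allP => y; rewrite take_cat; move/allP: h1 => h1.
case: ltnP => hs.
  by move=> hy; apply: h1; rewrite take_cat hs.
rewrite mem_cat; case/orP => [hy|].
  by apply: h1; rewrite take_cat ltnNge hs /= mem_cat hy.
case e : (k - size l1)%N => [|d] //=.
rewrite inE => /orP[/eqP->|hy]; first by rewrite adjC.
apply: h1; rewrite take_cat ltnNge hs /= mem_cat e; apply/orP; right.
by apply: (@mem_take d); rewrite take_takel.
Qed.

(** Both indices count from the junction: entry i of [g] and entry j of [s] are i + j + 1 positions
    apart, whence the condition i + j < k. *)
Lemma kpath_attach g s x0 : kpath g -> kpath s ->
  (forall i j, (i + j < k)%N -> (i < size g)%N -> (j < size s)%N ->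
     adj G (nth x0 g i) (nth x0 s j)) -> kpath (rev g ++ s).
Proof.
elim: g s => [|x g IH] s //= /andP[hx hg] hs hij.
rewrite rev_cons cat_rcons; apply: IH => //=.
  rewrite hs andbT; apply/(all_nthP x0) => j.
  rewrite size_take_min => hj; rewrite nth_take; last by lia.
  by apply: (hij 0%N j); lia.
move=> i [|j] /= h1 h2 h3.
  have /(all_nthP x0)/(_ i) := hx.
  rewrite size_take_min nth_take ?[adj _ x _]adjC; last by lia.
  by move=> -> //; lia.
by apply: (hij i.+1 j); lia.
Qed.

Lemma kpathP s x0 : reflect
  (forall i j, (i < j)%N -> (j <= i + k)%N -> (j < size s)%N ->
     adj G (nth x0 s i) (nth x0 s j)) (kpath s).
Proof.
elim: s => [|x s IH] /=; first by constructor.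
apply: (iffP andP) => [[/(all_nthP x0) h /IH hs] [|i] [|j] //= h1 h2 h3|h].
- have := h j; rewrite size_take_min nth_take; last by lia.
  by apply; lia.
- by apply: hs; lia.
split; last by apply/IH => i j h1 h2 h3; apply: (h i.+1 j.+1); lia.
apply/(all_nthP x0) => j; rewrite size_take_min => hj; rewrite nth_take; last by lia.
by apply: (h 0%N j.+1); lia.
Qed.

End KPath.

(** * Consequences of jumbledness *)

Section Pseudo.
Variables (R : realType) (V : finType) (G : sgraph V).
Implicit Types (p K g D : R) (A B T X Y Z : {set V}).

(** The threshold is p/4 and not p/2 because exceptional vertices may lie in [X]: jumbledness
    concerns disjoint sets, and making the sets disjoint may halve [X]. *)
Definition lowset p X : {set V} :=
  [set v | #|nbs G v X|%:R < p / 4 * #|X|%:R].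

Record pseudo p K : Prop := Pseudo {
  ps_gt0 : 0 < p;
  ps_le1 : p <= 1;
  ps_low : forall X, #|lowset p X|%:R * #|X|%:R <= K;
  ps_dense : forall A T D, [disjoint A & T] ->
    (forall v, v \in A -> D <= #|nbs G v T|%:R) -> 2 * p * #|T|%:R <= D ->
    #|A|%:R * D ^+ 2 <= K * p ^+ 2 * #|T|%:R }.

(** As [A] and [B] are disjoint, an unordered edge determines which endvertex lies in [A], so
    ordered pairs may be counted instead. *)
Lemma num_edgesE A B : [disjoint A & B] ->
  num_edges G A B = (\sum_(v in A) #|nbs G v B|)%N.
Proof.
move=> dAB; rewrite /num_edges /edges_between.
pose D := [set u : V * V | (u.1 \in A) && ((u.2 \in B) && adj G u.1 u.2)].
have -> : [set [set x; y] | x in A, y in B & adj G x y]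
        = (fun u : V * V => [set u.1; u.2]) @: D.
  apply/setP => e; apply/imset2P/imsetP => [[x y xA]|[[x y]]].
    rewrite inE => /= yB ->; exists (x, y) => //.
    by rewrite inE /= xA.
  rewrite inE /= => /and3P[xA yB xy] ->; exists x y => //; by rewrite inE yB.
rewrite card_in_imset => [|[x y] [x' y']].
  under eq_bigr => v _ do rewrite -sum1_card.
  rewrite pair_big_dep -sum1_card; apply: eq_bigl => -[x y] /=.
  by rewrite !inE.
rewrite !inE /= => /and3P[xA yB _] /and3P[xA' yB' _] e.
have nAB u : u \in A -> u \in B -> False.
  by move=> uA uB; have := disjointFr dAB uA; rewrite uB.
have : x \in [set x'; y'] by rewrite -e !inE eqxx.
rewrite !inE => /orP[/eqP ex|/eqP ex]; last by case: (nAB x); rewrite // ex.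
have : y \in [set x'; y'] by rewrite -e !inE eqxx orbT.
rewrite !inE => /orP[/eqP ey|/eqP ey]; first by case: (nAB y); rewrite // ey.
by rewrite ex ey.
Qed.

Lemma jumbled_sq p g A B : jumbled G p g -> [disjoint A & B] ->
  ((num_edges G A B)%:R - p * #|A|%:R * #|B|%:R) ^+ 2
    <= g ^+ 2 * (#|A|%:R * #|B|%:R).
Proof.
move=> jG dAB; have h := jG A B dAB.
have ab0 : 0 <= #|A|%:R * #|B|%:R :> R by rewrite mulr_ge0.
rewrite -real_normK ?num_real // -[X in _ <= _ * X](sqr_sqrtr ab0) -exprMn.
rewrite lerXn2r ?nnegrE //.
by apply: le_trans h; apply: normr_ge0.
Qed.

(** The number of edges exceeds its expectation by at least |A| D / 2; one factor |A| cancels after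
    squaring. *)
Lemma jumbled_dense p g A T D : 0 < p -> jumbled G p g -> [disjoint A & T] ->
    (forall v, v \in A -> D <= #|nbs G v T|%:R) -> 2 * p * #|T|%:R <= D ->
  #|A|%:R * D ^+ 2 <= 4 * g ^+ 2 * #|T|%:R.
Proof.
move=> p0 jG dAT hD hT.
have := jumbled_sq jG dAT; rewrite num_edgesE // natr_sum.
set e := \sum_(v in A) _.
have he : #|A|%:R * D <= e.
  by rewrite mulr_natl -sumr_const; apply: ler_sum.
move: he; set a : R := #|A|%:R; set t : R := #|T|%:R => he hsq.
have [a0|a0] := eqVneq a 0; first by rewrite a0 mul0r mulr_ge0 // mulr_ge0 // sqr_ge0.
have {}a0 : 0 < a by rewrite lt_neqAle eq_sym a0 ler0n.
have t0 : 0 <= t by [].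
have D0 : 0 <= D by apply: le_trans hT; rewrite !mulr_ge0 // ltW.
have h1 : a * D / 2 <= e - p * a * t.
  have : a * (2 * p * t) <= a * D by rewrite ler_pM2l.
  lra.
have h2 : (a * D / 2) ^+ 2 <= g ^+ 2 * (a * t).
  have h0 : 0 <= a * D / 2 by rewrite divr_ge0 ?mulr_ge0 ?(ltW a0).
  by apply: le_trans hsq; rewrite lerXn2r ?nnegrE // (le_trans h0).
rewrite -(ler_pM2l a0); lra.
Qed.

Lemma jumbled_sparse p g A X : 0 < p -> jumbled G p g -> [disjoint A & X] ->
    (forall v, v \in A -> #|nbs G v X|%:R <= p / 2 * #|X|%:R) ->
  #|A|%:R * #|X|%:R <= 4 * g ^+ 2 / p ^+ 2.
Proof.
move=> p0 jG dAX hD.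
have := jumbled_sq jG dAX; rewrite num_edgesE // natr_sum.
set e := \sum_(v in A) _.
have he : e <= #|A|%:R * (p / 2 * #|X|%:R).
  by rewrite mulr_natl -sumr_const; apply: ler_sum.
move: he; set a : R := #|A|%:R; set x : R := #|X|%:R => he hsq.
have a0 : 0 <= a by [].
have x0 : 0 <= x by [].
have h1 : p * a * x / 2 <= p * a * x - e by lra.
have h2 : (p * a * x / 2) ^+ 2 <= g ^+ 2 * (a * x).
  apply: le_trans hsq; rewrite -[X in _ <= X]sqrrN opprB.
  have h0 : 0 <= p * a * x / 2 by rewrite divr_ge0 ?mulr_ge0 ?(ltW p0).
  by rewrite lerXn2r ?nnegrE // (le_trans h0).
rewrite ler_pdivlMr ?exprn_gt0 //.
have [e0|e0] := eqVneq (a * x) 0; first by rewrite e0 mul0r mulr_ge0 ?sqr_ge0.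
have ax0 : 0 < a * x by rewrite lt_neqAle eq_sym e0 mulr_ge0.
rewrite -(ler_pM2l ax0); lra.
Qed.

Lemma subset_card X n : (n <= #|X|)%N -> exists2 Y : {set V}, Y \subset X & #|Y| = n.
Proof.
move=> hn; exists [set x in take n (enum X)].
  by apply/subsetP => x; rewrite inE => /mem_take; rewrite mem_enum.
rewrite cardsE; have /card_uniqP -> : uniq (take n (enum X)).
  by rewrite take_uniq ?enum_uniq.
by rewrite size_takel // -cardE.
Qed.

Lemma half_bounds (b x : nat) : (b <= x)%N -> (1 < x)%N -> (0 < b)%N ->
  [/\ maxn 1 b./2 <= b, x <= 2 * (x - maxn 1 b./2) & b <= 3 * maxn 1 b./2]%N.
Proof. by move=> h1 h2 h3; split; lia. Qed.

(** The hypothesis [p <= g] gives g^2/p^2 >= 1, which settles sets [X] with at most one element. *)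
Lemma jumbled_pseudo p g : 0 < p -> p <= 1 -> p <= g -> jumbled G p g ->
  pseudo p (64 * g ^+ 2 / p ^+ 2).
Proof.
move=> p0 p1 pg jG; split=> //; last first.
  move=> A T D dAT hD hT; apply: le_trans (jumbled_dense p0 jG dAT hD hT) _.
  rewrite ler_wpM2r // -[X in _ <= X]mulrA mulVf ?mulr1; last by rewrite expf_neq0 ?gt_eqF.
  rewrite ler_wpM2r ?sqr_ge0 //; lra.
move=> X; set B := lowset p X; pose Q := g ^+ 2 / p ^+ 2.
have Q1 : 1 <= Q.
  by rewrite ler_pdivlMr ?exprn_gt0 // mul1r lerXn2r // nnegrE ?(ltW p0) // (le_trans (ltW p0)).
have hB v : v \in B -> #|nbs G v X|%:R < p / 4 * #|X|%:R by rewrite inE.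
have px0 : 0 <= p * #|X|%:R by rewrite mulr_ge0 // ltW.
have h1 : #|B :\: X|%:R * #|X|%:R <= 4 * Q.
  rewrite mulrA; apply: (jumbled_sparse p0 jG).
    by rewrite disjoint_subset; apply/subsetP => v; rewrite !inE => /andP[].
  by move=> v /setDP[/hB h _]; lra.
have h2 : #|B :&: X|%:R * #|X|%:R <= 24 * Q.
  have [x2|x2] := leqP #|X| 1.
    have b1 : (#|B :&: X| <= 1)%N by apply: leq_trans x2; rewrite subset_leq_card ?subsetIr.
    have : (#|B :&: X| * #|X| <= 1)%N by rewrite -[1%N]/(1 * 1)%N leq_mul.
    rewrite -(ler_nat R) natrM => h; lra.
  have hb : (#|B :&: X| <= #|X|)%N by rewrite subset_leq_card ?subsetIr.
  have [b0|b0] := posnP #|B :&: X|; first by rewrite b0 mul0r; lra.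
  (* Half of the low vertices inside [X], but at least one, are split off. The rest of [X] has at
     least half of its size, so degrees below (p/4)|X| are below p/2 times the size of the rest. *)
  have [a1 a2 a3] := half_bounds hb x2 b0; set a := maxn 1 _ in a1 a2 a3.
  have [A sA cA] : exists2 Y : {set V}, Y \subset B :&: X & #|Y| = a.
    exact: subset_card.
  have dA : [disjoint A & X :\: A].
    by rewrite disjoint_subset; apply/subsetP => v; rewrite !inE => ->.
  have sAX : A \subset X by apply: subset_trans sA (subsetIr _ _).
  have cXA : (#|X :\: A| = #|X| - a)%N by rewrite cardsD (setIidPr sAX) cA.
  have x2' : (#|X| <= 2 * #|X :\: A|)%N by rewrite cXA.
  have b3 : (#|B :&: X| <= 3 * #|A|)%N by rewrite cA.
  have h3 := jumbled_sparse p0 jG dA.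
  have {}h3 : #|A|%:R * #|X :\: A|%:R <= 4 * Q.
    rewrite mulrA; apply: h3 => v /(subsetP sA); rewrite inE => /andP[/hB h _].
    apply: (@le_trans _ _ #|nbs G v X|%:R).
      by rewrite ler_nat subset_leq_card // nbsS // subsetDl.
    move: x2'; rewrite -(ler_nat R) natrM => x2'.
    have : p * #|X|%:R <= p * (2 * #|X :\: A|%:R) by rewrite ler_pM2l.
    lra.
  have : (#|B :&: X| * #|X| <= 6 * (#|A| * #|X :\: A|))%N.
    by rewrite (_ : 6 * _ = (3 * #|A|) * (2 * #|X :\: A|))%N ?leq_mul //; ring.
  rewrite -(ler_nat R) !natrM => h4; lra.
have : #|B|%:R = #|B :&: X|%:R + #|B :\: X|%:R :> R.
  by rewrite -natrD cardsID.
move=> ->; rewrite mulrDl -mulrA -/Q; lra.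
Qed.

Lemma pseudo_K_ge0 p K : pseudo p K -> 0 <= K.
Proof. by move=> /ps_low/(_ set0); rewrite cards0 mulr0. Qed.

Lemma nlow p X v : v \notin lowset p X -> p / 4 * #|X|%:R <= #|nbs G v X|%:R.
Proof. by rewrite inE -leNgt. Qed.

(* The union of the low sets of the [Zs] is too small to cover [Y]. *)
Lemma pick p K Y (Zs : seq {set V}) : pseudo p K -> (0 < #|Y|)%N ->
  (forall Z, Z \in Zs -> (size Zs)%:R * K < #|Y|%:R * #|Z|%:R) ->
  exists2 x, x \in Y & forall Z, Z \in Zs -> x \notin lowset p Z.
Proof.
move=> pG Y0 hZ; pose bad := \bigcup_(Z <- Zs) lowset p Z.
have hbad Z x : Z \in Zs -> x \in lowset p Z -> x \in bad.
  by move=> ZZs xZ; rewrite /bad (big_rem Z) //= inE xZ.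
suff : ~~ (Y \subset bad).
  by case/subsetPn => x xY xb; exists x => // Z ZZs; apply: contra xb; apply: hbad.
apply/negP => /subset_leq_card sYb.
have [Zs0|Zs0] := posnP (size Zs).
  have e : bad = set0 by rewrite /bad (size0nil Zs0) big_nil.
  by rewrite e cards0 leqNgt Y0 in sYb.
have hb : (#|bad| <= \sum_(Z <- Zs) #|lowset p Z|)%N.
  rewrite /bad; elim: (Zs) => [|Z l IH]; first by rewrite !big_nil cards0.
  rewrite !big_cons; apply: leq_trans (leq_add (leqnn _) IH).
  by rewrite -cardsUI leq_addr.
have y0 : 0 < #|Y|%:R :> R by rewrite ltr0n.
have m0 : 0 < (size Zs)%:R :> R by rewrite ltr0n.
have hlt : \sum_(Z <- Zs) (#|lowset p Z|%:R : R) < \sum_(Z <- Zs) (#|Y|%:R / (size Zs)%:R).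
  rewrite !big_seq; apply: ltr_sum; last first.
    move=> Z /hZ h; rewrite ltr_pdivlMr //.
    have z0 : 0 < #|Z|%:R :> R.
      rewrite ltNge; apply/negP => z0; move: h; rewrite ltNge (le_trans (_ : _ <= 0)) //.
        by rewrite mulr_ge0_le0.
      by rewrite mulr_ge0 // (pseudo_K_ge0 pG).
    rewrite -(ltr_pM2r z0); apply: le_lt_trans h.
    by rewrite mulrAC mulrC ler_wpM2l // (ps_low pG).
  by case: (Zs) Zs0 => //= Z l _; rewrite inE eqxx.
move: hlt; rewrite big_const_seq count_predT iter_addr_0 -(mulr_natl (_ / _)) mulrCA divff ?gt_eqF // mulr1 -natr_sum ltr_nat.
by move=> h; have := leq_trans sYb hb; rewrite leqNgt h.
Qed.

End Pseudo.

(** * Counting cliques along a sequence of sets *)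

Section CliqueSums.
Variables (R : realType) (V : finType) (G : sgraph V).
Implicit Types (f g : seq V -> R) (t : seq V) (Y Z : nat -> {set V}) (n : nat).
Local Notation nbs := (nbs G).
Local Notation cn := (cn G).

(* [csum n Y f] sums [f] over the cliques [v_0, ..., v_(n-1)] with [v_i] in
   [Y i]. *)
Fixpoint csum n Y f : R :=
  if n is n'.+1 then
    \sum_(v in Y 0%N) csum n' (fun i => nbs v (Y i.+1)) (fun t => f (v :: t))
  else f [::].

(** The membership test for the tuples over which [csum] sums; with it summands can be compared on
    cliques only. *)
Fixpoint cliq n Y t : bool :=
  if n is n'.+1 then
    if t is v :: t' then (v \in Y 0%N) && cliq n' (fun i => nbs v (Y i.+1)) t'
    else false
  else t == [::].

Lemma cliqP n Y t x0 : cliq n Y t ->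
  [/\ size t = n, forall i, (i < n)%N -> nth x0 t i \in Y i
    & forall i j, (i < j < n)%N -> adj G (nth x0 t i) (nth x0 t j)].
Proof.
elim: n Y t => [|n IH] Y [|v t] //=; first by split=> // i j; rewrite ltn0 andbF.
case/andP=> vY /IH[st h1 h2]; split; first by rewrite st.
  case=> //= i /h1; by rewrite inE => /andP[].
case=> [|i] [|j] //= h; last by apply: h2.
by have := h1 j h; rewrite inE => /andP[].
Qed.

Lemma cliq_size n Y t : cliq n Y t -> size t = n.
Proof. by elim: n Y t => [|n IH] Y [|v t] //= /andP[_ /IH->]. Qed.

Lemma csum_le n Y f g : (forall t, cliq n Y t -> f t <= g t) ->
  csum n Y f <= csum n Y g.
Proof.
elim: n Y f g => [|n IH] Y f g h /=; first exact: h.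
by apply: ler_sum => v vY; apply: IH => t ht; apply: h; rewrite /= vY.
Qed.

Lemma csum_eq n Y Z f g : (forall i, (i < n)%N -> Y i = Z i) ->
  (forall t, f t = g t) -> csum n Y f = csum n Z g.
Proof.
elim: n Y Z f g => [|n IH] Y Z f g h e /=; first exact: e.
rewrite h //; apply: eq_bigr => v _; apply: IH => [i hi|t]; last exact: e.
by rewrite h.
Qed.

Lemma csum_ge0 n Y f : (forall t, 0 <= f t) -> 0 <= csum n Y f.
Proof.
elim: n Y f => [|n IH] Y f h /=; first exact: h.
by apply: sumr_ge0 => v _; apply: IH.
Qed.

Lemma csum_add n Y f g :
  csum n Y (fun t => f t + g t) = csum n Y f + csum n Y g.
Proof.
elim: n Y f g => [|n IH] Y f g //=.
by rewrite -big_split; apply: eq_bigr => v _; apply: IH.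
Qed.

Lemma csum_scale n Y f (c : R) : csum n Y (fun t => c * f t) = c * csum n Y f.
Proof.
elim: n Y f => [|n IH] Y f //=.
by rewrite mulr_sumr; apply: eq_bigr => v _; apply: IH.
Qed.

Lemma csum_sub n Y Z f : (forall t, 0 <= f t) ->
  (forall i, (i < n)%N -> Y i \subset Z i) -> csum n Y f <= csum n Z f.
Proof.
elim: n Y Z f => [|n IH] Y Z f f0 h //=.
apply: (@le_trans _ _ (\sum_(v in Y 0%N) csum n (fun i => nbs v (Z i.+1)) (fun t => f (v :: t)))).
  by apply: ler_sum => v _; apply: IH => // i hi; apply: nbsS; apply: h.
rewrite [X in _ <= X](bigID (mem (Y 0%N))) /=.
rewrite -[X in X <= _]addr0; apply: lerD; last first.
  by apply: sumr_ge0 => v _; apply: csum_ge0.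
rewrite le_eqVlt; apply/orP; left; apply/eqP; apply: eq_bigl => v.
by rewrite /= andb_idl // => /(subsetP (h 0%N isT)).
Qed.

(** Together with [csum_cons] this keeps a clique fixed while its last or its first vertex varies,
    which is how [blowup_step] slides a clique along the sets. *)
Lemma csum_rcons n Y f : csum n.+1 Y f =
  csum n Y (fun t => \sum_(w in cn t (Y n)) f (rcons t w)).
Proof.
elim: n Y f => [|n IH] Y f //.
rewrite [LHS]/= [RHS]/=; apply: eq_bigr => v _.
have := IH (fun i => nbs v (Y i.+1)) (fun t => f (v :: t)).
rewrite /= => ->; apply: csum_eq => // t.
by rewrite cn_nbs.
Qed.

Lemma csum_cons n Y f : csum n.+1 Y f =
  csum n (fun i => Y i.+1) (fun t => \sum_(u in cn t (Y 0%N)) f (u :: t)).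
Proof.
elim: n Y f => [|n IH] Y f //.
(* The sums over [Y 0] and [Y 1] are exchanged; [Zv] and [gv] describe the inner sum once the vertex
   [v] of [Y 1] comes first. *)
pose Zv v i := if i is i'.+1 then nbs v (Y i'.+2) else nbs v (Y 0%N).
pose gv v t := if t is u :: t' then f (u :: v :: t') else 0.
transitivity (\sum_(v in Y 1%N) csum n.+1 (Zv v) (gv v)).
  rewrite [LHS]/= [RHS]/=.
  under eq_bigr => u _ do under eq_bigl => v do rewrite in_nbs.
  rewrite (exchange_big_dep (mem (Y 1%N))) /=; last by move=> u v _ /andP[].
  apply: eq_bigr => v vY; apply: eq_big => [u|u _].
    by rewrite in_nbs vY adjC.
  by apply: csum_eq => // i _; apply/setP => x; rewrite !in_nbs andbAC.
rewrite [RHS]/=; apply: eq_bigr => v _; rewrite IH.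
by apply: csum_eq => // t; apply: eq_bigl => u; rewrite cn_nbs.
Qed.

Lemma csum_rev n Y f :
  csum n Y f = csum n (fun i => Y (n.-1 - i)%N) (fun t => f (rev t)).
Proof.
elim: n Y f => [|n IH] Y f //.
rewrite csum_cons IH csum_rcons; apply: csum_eq => [i hi|t].
  by congr Y; case: n hi {IH} => // n hi; rewrite /=; lia.
rewrite /= subnn cn_rev.
by apply: eq_bigr => w _; rewrite rev_rcons.
Qed.

End CliqueSums.

Section CliqueCounts.
Variables (R : realType) (V : finType) (G : sgraph V) (p K : R).
Hypothesis pG : pseudo G p K.
Implicit Types (f : seq V -> R) (t : seq V) (Y : nat -> {set V}) (n : nat).
Implicit Types (X Z W A B : {set V}) (y : nat -> R) (d : R).
Local Notation nbs := (nbs G).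
Local Notation cn := (cn G).
Local Notation csum := (csum G).

Let p0 : 0 < p. Proof. exact: ps_gt0 pG. Qed.
Let p1 : p <= 1. Proof. exact: ps_le1 pG. Qed.
Let K0 : 0 <= K. Proof. exact: pseudo_K_ge0 pG. Qed.

(** The bound [z] replaces |X| because the inductions below only control the sizes of the shrinking
    sets from above. *)
Lemma high_count X A (z : R) : [disjoint A & X] -> 0 < z -> #|X|%:R <= z ->
  (forall v, v \in A -> 4 * p * z < #|nbs v X|%:R) -> #|A|%:R * z <= K.
Proof.
move=> dAX z0 hX hA.
have := ps_dense pG dAX (fun v vA => ltW (hA v vA)).
have h : 2 * p * #|X|%:R <= 4 * p * z.
  have : p * #|X|%:R <= p * z by rewrite ler_pM2l.
  have : 0 < p * z by rewrite mulr_gt0.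
  lra.
move=> /(_ h) {}h.
have h2 : K * p ^+ 2 * #|X|%:R <= K * p ^+ 2 * z.
  by rewrite ler_wpM2l // mulr_ge0 // sqr_ge0.
have := le_trans h h2.
have -> : #|A|%:R * (4 * p * z) ^+ 2 = 16 * (#|A|%:R * z) * (p ^+ 2 * z) by ring.
rewrite -[X in _ <= X]mulrA ler_pM2r; last by rewrite mulr_gt0 ?exprn_gt0.
have : 0 <= #|A|%:R * z by rewrite mulr_ge0 // ltW.
lra.
Qed.

(** The expected number of cliques with one vertex in each of n sets of sizes [y i], in a random
    graph of density p. *)
Definition vol n y : R := (\prod_(i < n) y i) * p ^+ 'C(n, 2).

Lemma volS n y : vol n.+1 y = y 0%N * p ^+ n * vol n (fun i => y i.+1).
Proof.
rewrite /vol big_ord_recl binS bin1 exprD.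
under eq_bigr => i _ do rewrite lift0.
rewrite /=; ring.
Qed.

Lemma vol_scale n y (a : R) : vol n (fun i => a * y i) = a ^+ n * vol n y.
Proof. by rewrite /vol big_split prodr_const card_ord mulrA. Qed.

Lemma vol_ge0 n y : (forall i, (i < n)%N -> 0 <= y i) -> 0 <= vol n y.
Proof.
move=> h; rewrite mulr_ge0 ?exprn_ge0 ?(ltW p0) //.
by apply: prodr_ge0 => i _; apply: h.
Qed.

Definition highset n Y y : {set V} :=
  [set v in Y 0%N | [exists i : 'I_n, 4 * p * y i.+1 < #|nbs v (Y i.+1)|%:R]].

Definition pdisj n Y := forall i j, (i < j < n)%N -> [disjoint Y i & Y j].

Lemma pdisjS n Y : pdisj n.+1 Y -> pdisj n (fun i => Y i.+1).
Proof. by move=> h i j hij; apply: h; rewrite ltnS. Qed.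

Lemma pdisj_sub n Y Y' : pdisj n Y -> (forall i, Y' i \subset Y i) -> pdisj n Y'.
Proof.
move=> h s i j /h; rewrite !disjoint_subset => h2.
apply: subset_trans (s i) _; apply: subset_trans h2 _.
by apply/subsetP => x; rewrite !inE; apply: contra; apply/subsetP.
Qed.

Lemma card_exists_le n A (P : 'I_n -> pred V) (c : R) :
  (forall i, #|[set v in A | P i v]|%:R <= c) ->
  #|[set v in A | [exists i, P i v]]|%:R <= n%:R * c.
Proof.
move=> h.
apply: (@le_trans _ _ (\sum_(i < n) #|[set v in A | P i v]|)%:R).
  rewrite ler_nat.
  have : [set v in A | [exists i, P i v]] \subset \bigcup_(i < n) [set v in A | P i v].
    apply/subsetP => v; rewrite inE => /andP[vA /existsP[i Pi]].
    by apply/bigcupP; exists i => //; rewrite inE vA.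
  move/subset_leq_card/leq_trans; apply.
  elim/big_rec2: _ => [|i m S _ IH]; first by rewrite cards0.
  by apply: leq_trans (leq_add (leqnn _) IH); rewrite -cardsUI leq_addr.
rewrite natr_sum; apply: le_trans (ler_sum _ (fun i _ => h i)) _.
by rewrite sumr_const card_ord mulr_natl.
Qed.

Lemma high_bound n Y y d : pdisj n.+1 Y ->
  (forall i, (i <= n)%N -> 0 < y i /\ #|Y i|%:R <= y i) ->
  (forall i, (i < n)%N -> K <= d * (y 0%N * y i.+1 * p ^+ n)) ->
  #|highset n Y y|%:R <= n%:R * (d * y 0%N * p ^+ n).
Proof.
move=> dY hY hK; apply: card_exists_le => i.
have [yi0 hi] := hY i.+1 (ltn_ord i).
rewrite -(ler_pM2r yi0); apply: le_trans (_ : K <= _); last first.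
  by apply: le_trans (hK i (ltn_ord i)) _; rewrite le_eqVlt; apply/orP; left; apply/eqP; ring.
apply: (@high_count (Y i.+1)) => //.
  have := dY 0%N i.+1; rewrite /= ltnS ltn_ord => /(_ isT).
  rewrite !disjoint_subset => h; apply: subset_trans h.
  by apply/subsetP => v; rewrite inE => /andP[].
by move=> v; rewrite inE => /andP[].
Qed.

Lemma csum_split n Y f B (a b : R) : 0 <= a -> 0 <= b ->
  (forall v, v \in Y 0%N -> v \notin B ->
     csum n (fun i => nbs v (Y i.+1)) (fun t => f (v :: t)) <= a) ->
  (forall v, v \in Y 0%N -> v \in B ->
     csum n (fun i => nbs v (Y i.+1)) (fun t => f (v :: t)) <= b) ->
  csum n.+1 Y f <= #|Y 0%N|%:R * a + #|B|%:R * b.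
Proof.
move=> a0 b0 ha hb /=; rewrite (bigID (mem B)) /= addrC; apply: lerD.
  rewrite [X in _ <= X]mulr_natl -sumr_const [X in _ <= X](bigID (mem B)) /=.
  rewrite -[X in X <= _]add0r; apply: lerD; first by apply: sumr_ge0.
  by apply: ler_sum => v /andP[]; apply: ha.
rewrite [X in _ <= X]mulr_natl -sumr_const [X in _ <= X](bigID (mem (Y 0%N))) /=.
rewrite -[X in X <= _]addr0; apply: lerD; last by apply: sumr_ge0.
rewrite [X in _ <= X](eq_bigl (fun v => (v \in Y 0%N) && (v \in B))); last first.
  by move=> v /=; rewrite andbC.
by apply: ler_sum => v /andP[]; apply: hb.
Qed.

(** A typical first vertex costs a factor 4 for each of the n' later sets. The others, at most n'
    y_0 p^n' in number, are charged with all cliques of the later sets. *)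
Fixpoint cU n : nat := if n is n'.+1 then ((4 ^ n' + n') * cU n')%N else 1.

(** The exponent n-1+m: when vertex m is chosen, both sets have shrunk by p^m, and the exceptional
    vertices may only be a fraction p^(n-1-m), since all later cliques are counted for each of
    them. *)
Lemma csum_upper n Y y : pdisj n Y ->
  (forall i, (i < n)%N -> 0 < y i /\ #|Y i|%:R <= y i) ->
  (forall m i, (m < i < n)%N -> K <= y m * y i * p ^+ (n.-1 + m)) ->
  csum n Y (fun=> 1) <= (cU n)%:R * vol n y.
Proof.
elim: n Y y => [|n IH] Y y dY hY hK.
  by rewrite /= /vol big_ord0 expr0 !mulr1.
have y0 i : (i <= n)%N -> 0 <= y i by move=> /hY[/ltW].
set w := vol n (fun i => y i.+1).
have w0 : 0 <= w by apply: vol_ge0 => i /y0.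
have hB := @high_bound n Y y 1 dY hY.
have {}hB : #|highset n Y y|%:R <= n%:R * (y 0%N * p ^+ n).
  rewrite -[y 0%N]mul1r; apply: hB => i hi; rewrite mul1r.
  have := hK 0%N i.+1; rewrite /= addn0; apply; lia.
have hp2 : p ^+ 2 <= 1 by rewrite exprn_ile1 // ltW.
have key m i : (m < i < n)%N -> K <= y m.+1 * y i.+1 * p ^+ (n.-1 + m) * p ^+ 2.
  move=> hmi; rewrite -[X in _ <= X]mulrA -exprD.
  have -> : (n.-1 + m + 2 = n.+1.-1 + m.+1)%N by lia.
  by apply: hK; lia.
have yy m i : (m < i < n)%N -> 0 <= y m.+1 * y i.+1 * p ^+ (n.-1 + m).
  by move=> h; rewrite !mulr_ge0 ?exprn_ge0 ?(ltW p0) ?y0 //; lia.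
have h1 v : v \in Y 0%N -> v \notin highset n Y y ->
    csum n (fun i => nbs v (Y i.+1)) (fun=> 1) <= (cU n)%:R * (4 ^+ n * p ^+ n * w).
  move=> vY; rewrite inE vY /= => /existsPn hv.
  have -> : 4 ^+ n * p ^+ n * w = vol n (fun i => 4 * p * y i.+1).
    by rewrite vol_scale -exprMn.
  apply: IH => [|i hi|m i hmi].
  - by apply: pdisj_sub (pdisjS dY) _ => i; apply: nbs_sub.
  - split; first by rewrite !mulr_gt0 // (hY i.+1 hi).1.
    by have := hv (Ordinal hi); rewrite -leNgt.
  - apply: le_trans (key m i hmi) _.
    have -> : 4 * p * y m.+1 * (4 * p * y i.+1) * p ^+ (n.-1 + m)
      = 16 * (y m.+1 * y i.+1 * p ^+ (n.-1 + m) * p ^+ 2) by ring.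
    rewrite ler_peMl //; last by lra.
    by apply: mulr_ge0; [exact: yy|exact: sqr_ge0].
have h2 v : v \in Y 0%N -> v \in highset n Y y ->
    csum n (fun i => nbs v (Y i.+1)) (fun=> 1) <= (cU n)%:R * w.
  move=> _ _; apply: (@le_trans _ _ (csum n (fun i => Y i.+1) (fun=> 1))).
    by apply: csum_sub => // i _; apply: nbs_sub.
  apply: IH => [|i hi|m i hmi]; [exact: pdisjS|exact: (hY i.+1 hi)|].
  apply: le_trans (key m i hmi) _.
  by rewrite ler_piMr ?yy.
have q0 : 0 <= 4 ^+ n * p ^+ n :> R by rewrite mulr_ge0 ?exprn_ge0 ?(ltW p0).
have a0 : 0 <= (cU n)%:R * (4 ^+ n * p ^+ n * w) :> R.
  by apply: mulr_ge0 => //; apply: mulr_ge0.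
have b0 : 0 <= (cU n)%:R * w :> R by apply: mulr_ge0.
apply: le_trans (csum_split a0 b0 h1 h2) _.
rewrite volS -/w /= natrM natrD natrX.
have h3 := ler_wpM2r a0 (hY 0%N isT).2.
have h4 : #|highset n Y y|%:R * ((cU n)%:R * w) <= n%:R * (y 0%N * p ^+ n) * ((cU n)%:R * w).
  by rewrite ler_wpM2r.
lra.
Qed.

(** [Z] is the set behind the clique and [W] the set ahead of it: regularity means enough candidates
    to come from and not too many to go to. *)
Definition irr n Z (z : R) W (w : R) t : bool :=
  ~~ (((p / 4) ^+ n * z <= #|cn t Z|%:R) && (#|cn t W|%:R <= (4 * p) ^+ n * w)).

Lemma irr_cons n Z (z : R) W (w : R) v t : irr n.+1 Z z W w (v :: t) =
  irr n (nbs v Z) (p / 4 * z) (nbs v W) (4 * p * w) t.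
Proof.
rewrite /irr /= !cn_nbs; congr (~~ (_ && _)).
  by congr (_ <= _); rewrite exprSr -[LHS]mulrA.
by congr (_ <= _); rewrite exprSr -[LHS]mulrA.
Qed.

Fixpoint cI n : nat :=
  if n is n'.+1 then (4 ^ n * cI n' + (n + 1) * cU n)%N else 0.

(** The sum includes one more vertex, in [Y n], so that an irregular clique counts with the number
    of its extensions, which may be far too large. A first vertex is exceptional if it is high into
    one of the n later sets or low into [Z]; hence the n + 1 in [cI]. *)
Lemma csum_irr n Y y Z (z d : R) : 0 <= d -> d <= 1 -> pdisj n.+1 Y ->
  (forall i, (i <= n)%N -> 0 < y i /\ #|Y i|%:R <= y i) ->
  0 < z <= #|Z|%:R ->
  (forall m i, (m < i <= n)%N -> K <= d * (y m * y i * p ^+ (n + m))) ->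
  (forall m, (m < n)%N -> K <= d * (y m * z * p ^+ (n + m))) ->
  csum n.+1 Y (fun t => (irr n Z z (Y n) (y n) (take n t))%:R)
    <= d * (cI n)%:R * vol n.+1 y.
Proof.
move=> d0 d1; elim: n Y y Z z => [|n IH] Y y Z z dY hY hz hK hKz.
  rewrite /= mulr0 mul0r; apply: sumr_le0 => v _.
  by rewrite /irr /= !expr0 !mul1r (hY 0%N isT).2; case/andP: hz => _ ->.
have y0 i : (i <= n.+1)%N -> 0 <= y i by move=> /hY[/ltW].
set w := vol n.+1 (fun i => y i.+1).
have w0 : 0 <= w by apply: vol_ge0 => i hi; exact: (y0 i.+1 hi).
pose B := highset n.+1 Y y :|: lowset G p Z.
have hB1 : #|highset n.+1 Y y|%:R <= n.+1%:R * (d * y 0%N * p ^+ n.+1).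
  apply: high_bound => // i hi.
  have := hK 0%N i.+1; rewrite addn0; apply; lia.
have hB2 : #|lowset G p Z|%:R <= d * y 0%N * p ^+ n.+1.
  case/andP: hz => z0 hz; rewrite -(ler_pM2r z0).
  apply: (@le_trans _ _ (#|lowset G p Z|%:R * #|Z|%:R)); first by rewrite ler_wpM2l.
  apply: le_trans (ps_low pG Z) _; have := hKz 0%N isT; rewrite addn0.
  by move=> /le_trans; apply; rewrite le_eqVlt; apply/orP; left; apply/eqP; ring.
have hB : #|B|%:R <= (n.+1 + 1)%:R * (d * y 0%N * p ^+ n.+1).
  rewrite natrD mulrDl mul1r; apply: le_trans (lerD hB1 hB2).
  by rewrite -natrD ler_nat -cardsUI leq_addr.
have h1 v : v \in Y 0%N -> v \notin B ->
    csum n.+1 (fun i => nbs v (Y i.+1))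
      (fun t => (irr n.+1 Z z (Y n.+1) (y n.+1) (take n.+1 (v :: t)))%:R)
     <= d * (cI n)%:R * (4 ^+ n.+1 * p ^+ n.+1 * w).
  move=> vY; rewrite inE negb_or [v \in highset _ _ _]inE vY andTb => /andP[/existsPn hv hvZ].
  have -> : 4 ^+ n.+1 * p ^+ n.+1 * w = vol n.+1 (fun i => 4 * p * y i.+1).
    by rewrite vol_scale -exprMn.
  have hz' : 0 < p / 4 * z <= #|nbs v Z|%:R.
    case/andP: hz => z0 hz; rewrite mulr_gt0 ?divr_gt0 //=.
    by apply: le_trans (nlow hvZ); rewrite ler_pM2l // divr_gt0.
  have := IH (fun i => nbs v (Y i.+1)) (fun i => 4 * p * y i.+1) (nbs v Z) (p / 4 * z).
  have a1 : pdisj n.+1 (fun i => nbs v (Y i.+1)).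
    by apply: pdisj_sub (pdisjS dY) _ => i; apply: nbs_sub.
  have a2 i : (i <= n)%N ->
      0 < 4 * p * y i.+1 /\ #|nbs v (Y i.+1)|%:R <= 4 * p * y i.+1.
    move=> hi; split; first by rewrite !mulr_gt0 // (hY i.+1 hi).1.
    by have := hv (@Ordinal n.+1 i hi); rewrite -leNgt.
  have a3 m i : (m < i <= n)%N ->
      K <= d * (4 * p * y m.+1 * (4 * p * y i.+1) * p ^+ (n + m)).
    move=> hmi; have := hK m.+1 i.+1 hmi.
    have -> : (n.+1 + m.+1 = 2 + (n + m))%N by rewrite addSn addnS.
    rewrite exprD => /le_trans; apply.
    rewrite ler_wpM2l //.
    have [hm hi] : (m.+1 <= n.+1)%N /\ (i.+1 <= n.+1)%N.
      by case/andP: hmi => h1 h2; split; rewrite ltnS // ltnW // (leq_trans h1).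
    have -> : 4 * p * y m.+1 * (4 * p * y i.+1) * p ^+ (n + m)
      = 16 * (y m.+1 * y i.+1 * (p ^+ 2 * p ^+ (n + m))) by ring.
    rewrite ler_peMl ?mulr_ge0 ?exprn_ge0 ?y0 ?(ltW p0) //; lra.
  have a4 m : (m < n)%N -> K <= d * (4 * p * y m.+1 * (p / 4 * z) * p ^+ (n + m)).
    move=> hm; have := hKz m.+1 hm.
    have -> : (n.+1 + m.+1 = 2 + (n + m))%N by rewrite addSn addnS.
    rewrite exprD => /le_trans; apply.
    by rewrite le_eqVlt; apply/orP; left; apply/eqP; field.
  move=> /(_ a1 a2 hz' a3 a4); apply: le_trans.
  by apply: csum_le => t _ /=; rewrite irr_cons.
have h2 v : v \in Y 0%N -> v \in B ->
    csum n.+1 (fun i => nbs v (Y i.+1))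
      (fun t => (irr n.+1 Z z (Y n.+1) (y n.+1) (take n.+1 (v :: t)))%:R)
     <= (cU n.+1)%:R * w.
  move=> _ _; apply: (@le_trans _ _ (csum n.+1 (fun i => Y i.+1) (fun=> 1))).
    apply: le_trans (_ : csum n.+1 (fun i => nbs v (Y i.+1)) (fun=> 1) <= _).
      by apply: csum_le => t _; rewrite lern1 leq_b1.
    by apply: csum_sub => // i _; apply: nbs_sub.
  apply: csum_upper => [|i hi|m i hmi]; [exact: pdisjS|exact: (hY i.+1 hi)|].
  have [h1m h2m] : (m.+1 <= n.+1)%N /\ (i.+1 <= n.+1)%N.
    by case/andP: hmi => h3 h4; split=> //; exact: leq_trans h3 (ltnW h4).
  have := hK m.+1 i.+1 hmi => /le_trans; apply.
  have yy : 0 <= y m.+1 * y i.+1 by rewrite mulr_ge0 ?y0.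
  apply: (@le_trans _ _ (y m.+1 * y i.+1 * p ^+ (n.+1 + m.+1))).
    by rewrite ler_piMl // mulr_ge0 ?exprn_ge0 ?(ltW p0).
  by rewrite ler_wpM2l // ler_wiXn2l ?(ltW p0) // leq_add.
have q0 : 0 <= 4 ^+ n.+1 * p ^+ n.+1 :> R.
  by rewrite mulr_ge0 ?exprn_ge0 ?(ltW p0).
have a0 : 0 <= d * (cI n)%:R * (4 ^+ n.+1 * p ^+ n.+1 * w).
  by apply: mulr_ge0; apply: mulr_ge0.
have b0 : 0 <= (cU n.+1)%:R * w :> R by apply: mulr_ge0.
apply: le_trans (csum_split a0 b0 h1 h2) _.
rewrite volS -/w.
have -> : cI n.+1 = (4 ^ n.+1 * cI n + (n.+1 + 1) * cU n.+1)%N by [].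
rewrite [(_ + _ * _)%:R]natrD [(4 ^ _ * _)%:R]natrM [((n.+1 + 1) * _)%:R]natrM natrX.
have h3 := ler_wpM2r a0 (hY 0%N isT).2.
have h4 : #|B|%:R * ((cU n.+1)%:R * w)
    <= (n.+1 + 1)%:R * (d * y 0%N * p ^+ n.+1) * ((cU n.+1)%:R * w).
  by rewrite ler_wpM2r.
lra.
Qed.

End CliqueCounts.

(** * Lower clique counts and reachability along a sequence of sets *)

Section Blowup.
Variables (R : realType) (V : finType) (G : sgraph V) (p K : R).
Hypothesis pG : pseudo G p K.
Implicit Types (f : seq V -> R) (t : seq V) (Y X : nat -> {set V}) (n : nat).
Implicit Types (y : nat -> R) (d : R).
Local Notation nbs := (nbs G).
Local Notation cn := (cn G).
Local Notation csum := (csum G).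
Local Notation vol := (vol p).

Let p0 : 0 < p. Proof. exact: ps_gt0 pG. Qed.
Let p1 : p <= 1. Proof. exact: ps_le1 pG. Qed.
Let K0 : 0 <= K. Proof. exact: pseudo_K_ge0 pG. Qed.

Fixpoint cL n : R := if n is n'.+1 then cL n' / (2 * 4 ^+ n') else 1.

Lemma cL_gt0 n : 0 < cL n.
Proof. by elim: n => //= n IH; rewrite divr_gt0 ?mulr_gt0 ?exprn_gt0. Qed.

(** At least half of [Y 0] is low into none of the later sets, and such a vertex keeps a fraction
    p/4 of each. Two sets shrink by p/4 and not by p, so the hypothesis carries 16^m. *)
Lemma csum_lower n Y y : (forall i, (i < n)%N -> 0 < y i <= #|Y i|%:R) ->
  (forall m i, (m < i < n)%N ->
     16 ^+ m * (2 * n%:R) * K <= y m * y i * p ^+ (n.-1 + m)) ->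
  cL n * vol n y <= csum n Y (fun=> 1).
Proof.
elim: n Y y => [|n IH] Y y hY hK.
  by rewrite /vol /= big_ord0 expr0 !mulr1.
have y0 i : (i <= n)%N -> 0 < y i by move=> /hY/andP[].
set w := vol n (fun i => y i.+1).
have w0 : 0 <= w by apply: (vol_ge0 pG) => i hi; apply/ltW/(y0 i.+1 hi).
pose B := [set v in Y 0%N | [exists i : 'I_n, v \in lowset G p (Y i.+1)]].
have hB : 2 * #|B|%:R <= y 0%N * p ^+ n.
  have [n0|n0] := posnP n.
    have -> : B = set0.
      by apply/setP => v; rewrite !inE; apply/negP => /andP[_ /existsP[[i]]]; rewrite n0.
    by rewrite cards0 mulr0 mulr_ge0 ?exprn_ge0 ?(ltW p0) ?(ltW (y0 0%N _)).
  have n0' : 0 < n%:R :> R by rewrite ltr0n.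
  suff : #|B|%:R <= n%:R * (y 0%N * p ^+ n / (2 * n%:R)).
    have -> : n%:R * (y 0%N * p ^+ n / (2 * n%:R)) = y 0%N * p ^+ n / 2.
      by field; rewrite gt_eqF.
    lra.
  apply: card_exists_le => i.
  have /andP[yi0 yiY] := hY i.+1 (ltn_ord i).
  rewrite ler_pdivlMr ?mulr_gt0 // -(ler_pM2r yi0).
  have h1 : #|[set v in Y 0%N | v \in lowset G p (Y i.+1)]|%:R * y i.+1 <= K.
    apply: le_trans (ps_low pG (Y i.+1)); apply: ler_pM => //; first exact: ltW.
    by rewrite ler_nat subset_leq_card //; apply/subsetP => v; rewrite inE => /andP[].
  have h2 := hK 0%N i.+1 (ltn_ord i).
  rewrite expr0 mul1r addn0 /= in h2.
  have h3 : 2 * n%:R * K <= 2 * n.+1%:R * K.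
    by rewrite ler_wpM2r // ler_wpM2l // ler_nat.
  have h4 : #|[set v in Y 0%N | v \in lowset G p (Y i.+1)]|%:R * y i.+1 * (2 * n%:R)
     <= K * (2 * n%:R) by rewrite ler_wpM2r // mulr_ge0.
  lra.
have hp1 : p ^+ n <= 1 by rewrite exprn_ile1 // ltW.
have hB2 : 2 * #|B|%:R <= #|Y 0%N|%:R :> R.
  apply: (le_trans hB); have /andP[h1 h2] := hY 0%N isT.
  by apply: le_trans h2; rewrite ler_piMr // ltW.
have hv v : v \in Y 0%N -> v \notin B ->
    cL n * ((p / 4) ^+ n * w) <= csum n (fun i => nbs v (Y i.+1)) (fun=> 1).
  move=> vY; rewrite inE vY andTb => /existsPn hv.
  have -> : (p / 4) ^+ n * w = vol n (fun i => p / 4 * y i.+1).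
    by rewrite (vol_scale).
  apply: IH => [i hi|m i hmi].
    have /andP[yi0 yiY] := hY i.+1 hi.
    rewrite mulr_gt0 ?divr_gt0 //=.
    apply: le_trans (nlow (hv (Ordinal hi))).
    by rewrite ler_pM2l // divr_gt0.
  have := hK m.+1 i.+1 hmi.
  have e : (n.+1.-1 + m.+1 = 2 + (n.-1 + m))%N.
    by case/andP: hmi; case: (n) => // n' _ _; rewrite /= addnS.
  rewrite e exprD exprS => h.
  have h3 : 2 * n%:R * (16 ^+ m * K) <= 2 * n.+1%:R * (16 ^+ m * K).
    by rewrite ler_wpM2r ?mulr_ge0 ?exprn_ge0 // ler_wpM2l // ler_nat.
  have -> : p / 4 * y m.+1 * (p / 4 * y i.+1) * p ^+ (n.-1 + m)
    = (y m.+1 * y i.+1 * (p ^+ 2 * p ^+ (n.-1 + m))) / 16 by field.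
  rewrite ler_pdivlMr //; lra.
rewrite volS -/w.
set a := cL n * ((p / 4) ^+ n * w) in hv.
have a0 : 0 <= a.
  apply: mulr_ge0; first exact/ltW/cL_gt0.
  by apply: mulr_ge0 => //; rewrite exprn_ge0 // divr_ge0 // ltW.
have hsum : (#|Y 0%N|%:R - #|B|%:R) * a <= csum n.+1 Y (fun=> 1).
  rewrite [X in _ <= X]/= (bigID (mem B)) /=.
  apply: (@le_trans _ _ (\sum_(v in Y 0%N | v \notin B) a)); last first.
    rewrite -[X in X <= _]add0r; apply: lerD.
      by apply: sumr_ge0 => v _; apply: csum_ge0.
    by apply: ler_sum => v /andP[]; apply: hv.
  rewrite (eq_bigl (mem (Y 0%N :\: B))); last first.
    by move=> v /=; rewrite !inE andbC.
  rewrite sumr_const -[X in _ <= X]mulr_natl ler_wpM2r // lerBlDr -natrD ler_nat.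
  rewrite -(cardsID B (Y 0%N)) addnC leq_add2l subset_leq_card // subsetIr //.
apply: le_trans hsum.
have -> : cL n.+1 * (y 0%N * p ^+ n * w) = y 0%N / 2 * a.
  rewrite /a /= exprMn exprVn; field.
  by rewrite gt_eqF // exprn_gt0.
rewrite ler_wpM2r //.
have /andP[_ h2] := hY 0%N isT; lra.
Qed.

Lemma volSr n y : vol n.+1 y = vol n y * (y n * p ^+ n).
Proof. by rewrite /vol big_ord_recr binS bin1 exprD /=; ring. Qed.

(** A clique [u :: t] slides to [rcons t w] along an edge from [u] to [w]. For regular [t], either
    at least half of the guaranteed number of [u] are bad, and all [w] are charged to them, or the
    good [u] form a large set that misses few [w]. The ratio of the two bounds on candidates gives
    16^n. *)
Lemma blowup_step n X (P P' : pred (seq V)) d :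
  0 <= d -> d <= 1 -> pdisj n.+2 X ->
  (forall i, (i <= n.+1)%N -> 0 < #|X i|%:R :> R) ->
  (forall m i, (m < i <= n)%N ->
     K <= d * (#|X m.+1|%:R * #|X i.+1|%:R * p ^+ (n + m))) ->
  (forall m, (m < n)%N ->
     K <= d * (#|X m.+1|%:R * #|X 0%N|%:R * p ^+ (n + m))) ->
  K <= d * (#|X 0%N|%:R * #|X n.+1|%:R * p ^+ (n + n)) ->
  (forall t u w, u \in cn t (X 0%N) -> adj G u w -> P (u :: t) ->
     size t = n -> P' (rcons t w)) ->
  csum n.+1 (fun i => X i.+1) (fun t => (~~ P' t)%:R) <=
    2 * 16 ^+ n * #|X n.+1|%:R / #|X 0%N|%:R * csum n.+1 X (fun t => (~~ P t)%:R)
    + d * ((cI n)%:R + 2 * 4 ^+ n * (cU n)%:R) * vol n.+1 (fun i => #|X i.+1|%:R).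
Proof.
move=> d0 d1 dX X0 hK1 hK2 hK3 hP.
pose x i : R := #|X i|%:R.
have x0 : 0 < x 0%N by apply: X0.
have xn : 0 < x n.+1 by apply: X0.
have [D DE] : exists D, D = (4 * p) ^+ n * x n.+1 by eexists.
have [e eE] : exists e, e = (p / 4) ^+ n * x 0%N by eexists.
have e0 : 0 < e by rewrite eE mulr_gt0 ?exprn_gt0 ?divr_gt0.
have D0 : 0 < D by rewrite DE mulr_gt0 ?exprn_gt0 ?mulr_gt0.
pose ir t := irr G p n (X 0%N) (x 0%N) (X n.+1) (x n.+1) t.
pose badu t : R := \sum_(u in cn t (X 0%N)) (~~ P (u :: t))%:R.
have sum1 (A : {set V}) (Q : pred V) : \sum_(w in A) (Q w)%:R = #|[set w in A | Q w]|%:R :> R.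
  rewrite -sum1_card natr_sum [RHS](eq_bigl (fun w => (w \in A) && Q w)); last first.
    by move=> w; rewrite inE.
  by rewrite big_mkcondr; apply: eq_bigr => w _; case: (Q w).
have key t : size t = n ->
    \sum_(w in cn t (X n.+1)) (~~ P' (rcons t w))%:R <=
    #|cn t (X n.+1)|%:R * (ir t)%:R + 2 * D / e * badu t + 2 * K / e.
  move=> st; have badu0 : 0 <= badu t by apply: sumr_ge0.
  have t1 : 0 <= 2 * D / e * badu t by rewrite mulr_ge0 // divr_ge0 ?mulr_ge0 ?ltW.
  have t2 : 0 <= 2 * K / e by rewrite divr_ge0 ?(ltW e0) // mulr_ge0.
  have le1 : \sum_(w in cn t (X n.+1)) (~~ P' (rcons t w))%:R <= #|cn t (X n.+1)|%:R :> R.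
    by rewrite sum1 ler_nat subset_leq_card //; apply/subsetP => w; rewrite inE => /andP[].
  case irt : (ir t); first by rewrite mulr1; lra.
  rewrite mulr0 add0r; move/negbFE/andP: irt => [a1 a2].
  pose I := [set u in cn t (X 0%N) | P (u :: t)].
  have hI : #|I|%:R + badu t = #|cn t (X 0%N)|%:R :> R.
    rewrite /badu sum1 -natrD; congr (_%:R).
    rewrite -(cardsID [set u | P (u :: t)] (cn t (X 0%N))); congr (_ + _)%N.
      by apply: eq_card => u; rewrite !inE.
    by apply: eq_card => u; rewrite !inE andbC.
  have [hb|hb] := leP (e / 2) (badu t).
    have : D <= 2 * D / e * badu t.
      have -> : 2 * D / e * badu t = D * (badu t * 2 / e) by field; rewrite gt_eqF.
      by rewrite ler_peMr ?(ltW D0) // ler_pdivlMr // mul1r; lra.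
    rewrite -DE in a2; lra.
  have hI2 : e / 2 <= #|I|%:R by rewrite -eE in a1; lra.
  (* A bad [w] has no neighbour at all among the good vertices [I], so it is low into [I]. *)
  have hl : \sum_(w in cn t (X n.+1)) (~~ P' (rcons t w))%:R <= #|lowset G p I|%:R :> R.
    rewrite sum1 ler_nat subset_leq_card //; apply/subsetP => w; rewrite inE => /andP[_ nP].
    have e0' : nbs w I = set0.
      apply/setP => u; rewrite in_nbs in_set0; apply/negP => /andP[uI wu].
      move: uI; rewrite inE => /andP[u1 u2]; case/negP: nP.
      by apply: (hP t u w) => //; rewrite adjC.
    rewrite inE e0' cards0 mulr_gt0 ?divr_gt0 //.
    by apply: lt_le_trans hI2; rewrite divr_gt0.
  have hl2 : #|lowset G p I|%:R * (e / 2) <= K.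
    by apply: le_trans (ps_low pG I); rewrite ler_wpM2l.
  have : #|lowset G p I|%:R <= 2 * K / e.
    rewrite ler_pdivlMr //; lra.
  lra.
rewrite csum_rcons.
apply: (@le_trans _ _ (csum n (fun i => X i.+1) (fun t =>
   #|cn t (X n.+1)|%:R * (ir t)%:R + 2 * D / e * badu t + 2 * K / e * 1))).
  by apply: csum_le => t /cliq_size st; rewrite mulr1; apply: key.
have ec : csum n (fun i => X i.+1) badu = csum n.+1 X (fun t => (~~ P t)%:R).
  by rewrite csum_cons.
rewrite !csum_add !csum_scale ec.
have dX' : pdisj n.+1 (fun i => X i.+1) by apply: pdisjS.
have h1 : csum n (fun i => X i.+1) (fun t => #|cn t (X n.+1)|%:R * (ir t)%:R)
    <= d * (cI n)%:R * vol n.+1 (fun i => x i.+1).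
  have := @csum_irr R V G p K pG n (fun i => X i.+1) (fun i => x i.+1) (X 0%N) (x 0%N) d d0 d1 dX'.
  rewrite csum_rcons => h; apply: le_trans (h _ _ hK1 hK2).
  - apply: csum_le => t /cliq_size st.
    rewrite (eq_bigr (fun=> (ir t)%:R)) => [|w _].
      by rewrite sumr_const -[X in _ <= X]mulr_natl.
    by rewrite -cats1 take_cat st ltnn subnn take0 cats0.
  - by move=> i hi; split; [exact: (X0 i.+1 hi)|].
  - by rewrite x0 /=.
have h3 : csum n (fun i => X i.+1) (fun=> 1) <= (cU n)%:R * vol n (fun i => x i.+1).
  apply: (csum_upper pG).
  - by move=> i j /andP[h2 h4]; apply: dX'; rewrite h2 (leq_trans h4).
  - by move=> i hi; split; [exact: (X0 i.+1 (ltnW hi))|].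
  - move=> m i /andP[h2 h4].
    have := hK1 m i; rewrite h2 ltnW // => /(_ isT)/le_trans; apply.
    have yy : 0 <= x m.+1 * x i.+1 by rewrite mulr_ge0.
    apply: (@le_trans _ _ (x m.+1 * x i.+1 * p ^+ (n + m))).
      by rewrite ler_piMl // mulr_ge0 ?exprn_ge0 ?(ltW p0).
    by rewrite ler_wpM2l // ler_wiXn2l ?(ltW p0) // leq_add2r leq_pred.
set S := csum n.+1 X _.
have e1 : 2 * D / e = 2 * 16 ^+ n * x n.+1 / x 0%N.
  rewrite DE eE !exprMn exprVn -[16%:R]/((4 * 4)%N%:R) natrM exprMn; field.
  by rewrite !gt_eqF ?exprn_gt0.
rewrite -lerBrDr; apply: le_trans (lerD h1 (lexx _)) _.
rewrite e1 mulrDr mulrDl addrC -!addrA lerD2l.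
have h4 : 2 * K / e * csum n (fun i => X i.+1) (fun=> 1)
    <= d * (2 * 4 ^+ n * (cU n)%:R) * vol n.+1 (fun i => x i.+1).
  have ke : 2 * K / e <= d * (2 * 4 ^+ n) * (x n.+1 * p ^+ n).
    rewrite ler_pdivrMr //.
    have -> : d * (2 * 4 ^+ n) * (x n.+1 * p ^+ n) * e
      = 2 * (d * (x 0%N * x n.+1 * p ^+ (n + n))).
      rewrite eE exprMn exprVn exprD; field.
      by rewrite gt_eqF ?exprn_gt0.
    by rewrite ler_pM2l.
  apply: le_trans (ler_wpM2l _ h3) _; first by rewrite divr_ge0 ?(ltW e0) // mulr_ge0.
  have v0 : 0 <= (cU n)%:R * vol n (fun i => x i.+1).
    by apply: mulr_ge0 => //; apply: (vol_ge0 pG).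
  apply: le_trans (ler_wpM2r v0 ke) _.
  rewrite volSr; lra.
rewrite -/x; lra.
Qed.

(** Only the last n + 1 vertices of the path matter for its continuation: going back by one set
    gains [u] in front and forgets the last vertex of the window [t]. *)
Fixpoint reach n X j t : bool :=
  if j is j'.+1 then [exists u, (u \in cn t (X j')) && reach n X j' (u :: take n t)]
  else true.

Lemma reach_path n X j t x0 : size t = n.+1 -> kpath G n.+1 t -> reach n X j t ->
  exists s, [/\ size s = j, kpath G n.+1 (s ++ t)
               & forall i, (i < j)%N -> nth x0 s i \in X i].
Proof.
elim: j t => [|j IH] t st kt /=; first by exists [::].
case/existsP => u /andP[]; rewrite in_cn => /andP[uX ut] r.
have st' : size (take n t) = n by rewrite size_takel // st.
have kt' : kpath G n.+1 (u :: take n t).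
  rewrite /= (take_oversize (s := take n t)) ?st' //.
  apply/andP; split; first by apply/allP => y /mem_take; apply/allP.
  by move: kt; rewrite -{1}(cat_take_drop n t) => /kpath_cat_l.
have [|s [ss ks hs]] := IH (u :: take n t) _ kt' r; first by rewrite /= st'.
exists (rcons s u); split; first by rewrite size_rcons ss.
  have -> : rcons s u ++ t = s ++ (u :: take n t) ++ drop n t.
    by rewrite cat_rcons /= cat_take_drop.
  apply: kpath_glue => //=; first by rewrite st'.
  rewrite cat_take_drop kt andbT.
  by apply/allP => y /mem_take; apply/allP.
move=> i; rewrite ltnS leq_eqVlt nth_rcons ss => /orP[/eqP->|hi].
  by rewrite ltnn eqxx.
by rewrite hi; apply: hs.
Qed.

(** The recursion of [blowup_step]; the ratios of set sizes do not appear because they are taken up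
    by [vol] of the shifted window. *)
Fixpoint cM n j : R :=
  if j is j'.+1 then 2 * 16 ^+ n * cM n j' + ((cI n)%:R + 2 * 4 ^+ n * (cU n)%:R)
  else 0.

Lemma cM_ge0 n j : 0 <= cM n j.
Proof.
elim: j => //= j IH; rewrite addr_ge0 ?mulr_ge0 ?exprn_ge0 // addr_ge0 //.
by rewrite !mulr_ge0 ?exprn_ge0.
Qed.

(** The first factor of the denominator keeps the unreached cliques below half of the lower bound
    given by [cL]; the second meets the hypothesis of [csum_lower]. *)
Definition dB n : R := cL n.+1 / ((2 * cM n n.+1 + 1) * (16 ^+ n * (2 * n.+1%:R))).

Lemma dB_prop n : [/\ 0 < dB n, dB n <= 1, dB n * (2 * cM n n.+1) < cL n.+1
  & dB n * (16 ^+ n * (2 * n.+1%:R)) <= 1].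
Proof.
have c1 m : cL m <= 1.
  elim: m => //= m IH; rewrite ler_pdivrMr ?mulr_gt0 ?exprn_gt0 // mul1r.
  apply: (le_trans IH); have : 1 <= 4 ^+ m :> R by rewrite exprn_ege1 //; lra.
  lra.
have c0 := cL_gt0 n.+1; have m0 := cM_ge0 n n.+1.
set A := 2 * cM n n.+1 + 1; set B : R := 16 ^+ n * (2 * n.+1%:R).
have A1 : 1 <= A by rewrite /A; lra.
have B1 : 1 <= B.
  have : 1 <= 16 ^+ n :> R by rewrite exprn_ege1 //; lra.
  have : 1 <= n.+1%:R :> R by rewrite ler1n.
  rewrite /B => h1 h2.
  apply: (@le_trans _ _ (1 * 1)); first by rewrite mul1r.
  by apply: ler_pM => //; lra.
have AB1 : 1 <= A * B.
  by apply: (@le_trans _ _ (1 * 1)); [rewrite mul1r|apply: ler_pM].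
have dE : dB n = cL n.+1 / (A * B) by [].
have d0 : 0 < dB n by rewrite dE divr_gt0 //; lra.
have dA : dB n * A <= cL n.+1.
  have -> : dB n * A = cL n.+1 / B by rewrite dE; field; apply/andP; split; lra.
  by rewrite ler_pdivrMr ?ler_peMr ?(ltW c0) //; lra.
split=> //.
- rewrite dE ler_pdivrMr ?mul1r; last lra.
  exact: le_trans (c1 _) AB1.
- move: dA; rewrite /A mulrDr mulr1; lra.
- have -> : dB n * B = cL n.+1 / A by rewrite dE; field; apply/andP; split; lra.
  rewrite ler_pdivrMr ?mul1r; last lra.
  exact: le_trans (c1 _) A1.
Qed.

(** The hypotheses of [blowup_step] for the n + 1 successive windows that start at [X j]. *)
Definition chain_cond n d X : Prop := forall j, (j <= n)%N ->
  [/\ forall m i, (m < i <= n)%N ->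
       K <= d * (#|X (j + m.+1)%N|%:R * #|X (j + i.+1)%N|%:R * p ^+ (n + m)),
     forall m, (m < n)%N ->
       K <= d * (#|X (j + m.+1)%N|%:R * #|X j|%:R * p ^+ (n + m))
   & K <= d * (#|X j|%:R * #|X (j + n.+1)%N|%:R * p ^+ (n + n))].

Lemma reach_frac n X d : 0 <= d -> d <= 1 -> pdisj (3 * n.+1) X ->
  (forall i, (i < 3 * n.+1)%N -> 0 < #|X i|%:R :> R) -> chain_cond n d X ->
  forall j, (j <= n.+1)%N ->
  csum n.+1 (fun i => X (j + i)%N) (fun t => (~~ reach n X j t)%:R)
    <= d * cM n j * vol n.+1 (fun i => #|X (j + i)%N|%:R).
Proof.
move=> d0 d1 dX X0 hX; elim=> [|j IH] hj.
  rewrite mulr0 mul0r.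
  have -> : csum n.+1 (fun i => X (0 + i)%N) (fun t => (~~ reach n X 0 t)%:R)
    = csum n.+1 (fun i => X (0 + i)%N) (fun t => 0 * 1) :> R.
    by apply: csum_eq => // t; rewrite mul0r.
  by rewrite csum_scale mul0r.
have [h1 h2 h3] := hX j hj.
have := @blowup_step n (fun i => X (j + i)%N) (reach n X j) (reach n X j.+1) d d0 d1.
have a1 : pdisj n.+2 (fun i => X (j + i)%N).
  by move=> i i' hii; apply: dX; clear -hii hj; lia.
have a2 i : (i <= n.+1)%N -> 0 < #|X (j + i)%N|%:R :> R by move=> hi; apply: X0; clear -hi hj; lia.
rewrite !addn0 => /(_ a1 a2 h1 h2 h3).
have a3 t u w : u \in cn t (X j) -> adj G u w -> reach n X j (u :: t) ->
     size t = n -> reach n X j.+1 (rcons t w).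
  move=> ut uw r st; apply/existsP; exists u.
  rewrite -cats1 take_cat st ltnn subnn take0 cats0.
  apply/andP; split; last exact: r.
  by move: ut; rewrite !in_cn all_cat /= uw !andbT.
move=> /(_ a3) h.
have -> : csum n.+1 (fun i => X (j.+1 + i)%N) (fun t => (~~ reach n X j.+1 t)%:R)
  = csum n.+1 (fun i => X (j + i.+1)%N) (fun t => (~~ reach n X j.+1 t)%:R) :> R.
  by apply: csum_eq => // i _; rewrite addSnnS.
apply: (le_trans h).
set x := fun i => #|X (j + i)%N|%:R : R.
have xj : 0 < x 0%N by rewrite /x addn0; apply: X0; clear -hj; lia.
have xn : 0 < x n.+1 by apply: a2.
have -> : vol n.+1 (fun i => #|X (j.+1 + i)%N|%:R) = vol n.+1 (fun i => x i.+1).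
  by congr (_ * _); apply: eq_bigr => i _; rewrite /x addSnnS.
have hv : vol n.+1 x * (x n.+1 / x 0%N) = vol n.+1 (fun i => x i.+1).
  rewrite volS volSr; field; by rewrite gt_eqF.
have := IH (ltnW hj); rewrite -/x => h4.
have c0 : 0 <= 2 * 16 ^+ n * x n.+1 / x 0%N.
  by rewrite divr_ge0 ?(ltW xj) // !mulr_ge0 ?exprn_ge0.
have := ler_wpM2l c0 h4.
rewrite [_ / x 0%N * (_ * _)](_ : _ = d * (2 * 16 ^+ n * cM n j) * vol n.+1 (fun i => x i.+1)).
  rewrite /=; rewrite /x addn0; lra.
by rewrite -hv; ring.
Qed.

(* Reachability by a path from the left end, and from the right end, each fails
   for less than half of the cliques in the middle third of the sets, so some
   clique is reachable from both. *)
Lemma blowup n X x0 : pdisj (3 * n.+1) X ->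
  (forall i, (i < 3 * n.+1)%N -> 0 < #|X i|%:R :> R) ->
  chain_cond n (dB n) X -> chain_cond n (dB n) (fun i => X (3 * n.+1 - i.+1)%N) ->
  exists s, [/\ size s = (3 * n.+1)%N, kpath G n.+1 s
               & forall i, (i < 3 * n.+1)%N -> nth x0 s i \in X i].
Proof.
move=> dX X0 hL hR; have [d0 d1 dM dl] := dB_prop n; set d := dB n in d0 d1 dM dl hL hR.
pose X' i := X (3 * n.+1 - i.+1)%N.
have dX' : pdisj (3 * n.+1) X'.
  by move=> i j hij; rewrite disjoint_sym; apply: dX; clear -hij; lia.
have X'0 i : (i < 3 * n.+1)%N -> 0 < #|X' i|%:R :> R.
  by move=> hi; apply: X0; clear -hi; lia.
have bL := reach_frac (ltW d0) d1 dX X0 hL (leqnn _).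
have bR := reach_frac (ltW d0) d1 dX' X'0 hR (leqnn _).
pose M i := X (n.+1 + i)%N.
have MX' i : (i < n.+1)%N -> X' (n.+1 + i)%N = M (n - i)%N.
  by move=> hi; rewrite /X' /M; congr X; clear -hi; lia.
have {bR} bR : csum n.+1 M (fun t => (~~ reach n X' n.+1 (rev t))%:R)
    <= d * cM n n.+1 * vol n.+1 (fun i => #|M i|%:R).
  apply: le_trans (le_trans bR _).
    rewrite csum_rev le_eqVlt; apply/orP; left; apply/eqP.
    apply: csum_eq => [i hi|t]; first by rewrite MX'.
    by rewrite revK.
  rewrite le_eqVlt; apply/orP; left; apply/eqP; congr (_ * _).
  rewrite /vol (reindex_inj rev_ord_inj) /=; congr (_ * _); apply: eq_bigr => i _.
  by rewrite MX' ?subSS ?ltnS ?leq_subr // subKn // -ltnS.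
have vol0 : 0 < vol n.+1 (fun i => #|M i|%:R).
  rewrite mulr_gt0 ?exprn_gt0 //; apply: prodr_gt0 => i _.
  by apply: X0; have hi := ltn_ord i; clear -hi; lia.
have lo : cL n.+1 * vol n.+1 (fun i => #|M i|%:R) <= csum n.+1 M (fun=> 1).
  apply: csum_lower => [i hi|m i hmi].
    by rewrite lexx andbT; apply: X0; clear -hi; lia.
  have [h1 _ _] := hL n (leqnn _).
  have := h1 m i; rewrite !addnS -!addSn => h2.
  have hmi' : (m < i <= n)%N by move: hmi; rewrite ltnS.
  have {}h2 := h2 hmi'.
  set z := #|M m|%:R * #|M i|%:R * p ^+ (n.+1.-1 + m).
  have z0 : 0 <= z by rewrite /z !mulr_ge0 // exprn_ge0 // ltW.
  have h3 : 16 ^+ m * (2 * n.+1%:R) * K <= 16 ^+ m * (2 * n.+1%:R) * (d * z).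
    apply: ler_wpM2l; last exact: h2.
    by rewrite !mulr_ge0 ?exprn_ge0.
  apply: (le_trans h3); rewrite mulrA ler_piMl // mulrC.
  apply: le_trans dl; apply: ler_wpM2l; first exact: ltW.
  apply: ler_wpM2r; first by rewrite mulr_ge0.
  apply: ler_weXn2l; first by rewrite ler1n.
  by case/andP: hmi' => h4 h5; exact: leq_trans (ltnW h4) h5.
have [t tM [rL rR]] : exists2 t, cliq G n.+1 M t & reach n X n.+1 t /\ reach n X' n.+1 (rev t).
  case: (boolP [exists t : n.+1.-tuple V,
      [&& cliq G n.+1 M t, reach n X n.+1 t & reach n X' n.+1 (rev t)]]).
    by case/existsP=> t /and3P[h1 h2 h3]; exists t.
  move/existsPn => no; exfalso.
  have : csum n.+1 M (fun=> 1) <= csum n.+1 M (fun t => (~~ reach n X n.+1 t)%:R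
      + (~~ reach n X' n.+1 (rev t))%:R) :> R.
    apply: csum_le => t ht; have st := cliq_size ht.
    have := no (Tuple (introT eqP st)); rewrite [cliq _ _ _ _]ht andTb negb_and.
    by case/orP=> ->; rewrite ?lerDl ?lerDr.
  rewrite csum_add => h1; have h2 := le_trans lo (le_trans h1 (lerD bL bR)).
  have : d * (2 * cM n n.+1) * vol n.+1 (fun i => #|M i|%:R)
      < cL n.+1 * vol n.+1 (fun i => #|M i|%:R) by rewrite ltr_pM2r.
  rewrite -/M in h2; lra.
have [st tM1 tadj] := cliqP x0 tM.
have kt : kpath G n.+1 t.
  apply/(kpathP _ _ _ x0) => i j ij _ jt; apply: tadj; rewrite ij -st //.
have [s [ss ks sX]] := reach_path x0 st kt rL.
have [|||s' [ss' ks' sX']] := @reach_path n X' n.+1 (rev t) x0; rewrite ?size_rev ?kpath_rev //.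
exists (s ++ t ++ rev s'); split.
- by rewrite !size_cat size_rev ss ss' st; clear; lia.
- apply: kpath_glue => //; first by rewrite st.
  by rewrite -kpath_rev rev_cat revK.
move=> i hi; rewrite nth_cat ss; case: ltnP => h1; first exact: sX.
rewrite nth_cat st; case: ltnP => h2.
  by have := tM1 _ h2; rewrite /M subnKC.
have h3 : (i - n.+1 - n.+1 < n.+1)%N by clear -hi h1 h2; lia.
rewrite nth_rev ss' //.
have := sX' (n.+1 - (i - n.+1 - n.+1).+1)%N; rewrite /X'.
have -> : (3 * n.+1 - (n.+1 - (i - n.+1 - n.+1).+1).+1 = i)%N by clear -hi h1 h2; lia.
by apply; clear; lia.
Qed.

End Blowup.

(** * Connecting two ends of a path *)

Section DisjointSubsets.
Variables (V : finType).

(** The index with the largest demand is served last: the others then occupy at most m - 1 times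
    that demand. *)
Lemma disjoint_family (I : finType) (Y : I -> {set V}) (m : nat) (t : I -> nat) :
  (#|I| <= m)%N -> (forall i, m * t i <= #|Y i|)%N ->
  exists X : I -> {set V}, (forall i, X i \subset Y i /\ #|X i| = t i) /\
    forall i j, i != j -> [disjoint X i & X j].
Proof.
move=> Im hY.
suff H n (J : {set I}) : #|J| = n -> exists X : I -> {set V},
    (forall i, i \in J -> X i \subset Y i /\ #|X i| = t i) /\
    forall i j, i \in J -> j \in J -> i != j -> [disjoint X i & X j].
  have [X [h1 h2]] := H _ [set: I] erefl.
  by exists X; split=> [i|i j]; [apply: h1|apply: h2]; rewrite inE.
elim: n J => [|n IH] J cJ.
  by exists (fun=> set0); split=> [i|i j]; rewrite (cards0_eq cJ) inE.
have [i1 i1J] : exists i, i \in J by apply/card_gt0P; rewrite cJ.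
case: (@arg_maxnP _ i1 (mem J) t i1J) => i0 i0J' max.
have i0J : i0 \in J := i0J'.
have [|X [h1 h2]] := IH (J :\ i0).
  by move: cJ; rewrite (cardsD1 i0) i0J; case.
pose U := \bigcup_(j in J :\ i0) X j.
have cU : (#|U| <= n * t i0)%N.
  have cn : #|J :\ i0| = n by move: cJ; rewrite (cardsD1 i0) i0J; case.
  rewrite -{}cn -sum_nat_const /U.
  have : (\sum_(j in J :\ i0) #|X j| <= \sum_(j in J :\ i0) t i0)%N.
    apply: leq_sum => j jJ; rewrite (h1 j jJ).2; apply: max.
    by move: jJ; rewrite !inE => /andP[].
  apply: leq_trans.
  elim/big_rec2: _ => [|j k S _ IHS]; first by rewrite cards0.
  by apply: leq_trans (leq_add (leqnn _) IHS); rewrite -cardsUI leq_addr.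
have [Z sZ cZ] : exists2 Z : {set V}, Z \subset Y i0 :\: U & #|Z| = t i0.
  apply: subset_card; rewrite cardsD.
  have h3 : (#|Y i0 :&: U| <= n * t i0)%N.
    by apply: leq_trans cU; rewrite subset_leq_card // subsetIr.
  have h4 : (n.+1 <= m)%N by rewrite -cJ; apply: leq_trans Im; apply: max_card.
  have h5 := hY i0.
  have : (n.+1 * t i0 <= m * t i0)%N by rewrite leq_mul2r h4 orbT.
  by clear -h3 h5; lia.
have dZ j : j \in J -> j != i0 -> [disjoint Z & X j].
  move=> jJ ji; rewrite disjoint_subset; apply/subsetP => v /(subsetP sZ).
  rewrite !inE => /andP[vU _]; apply: contra vU => vX.
  by apply/bigcupP; exists j => //; rewrite !inE ji.
exists (fun i => if i == i0 then Z else X i); split.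
  move=> i iJ; case: eqVneq => [->|ii]; last by apply: h1; rewrite !inE ii.
  by split=> //; apply: subset_trans sZ _; apply: subsetDl.
move=> i j iJ jJ ij; case: (eqVneq i i0) => [ii|ii].
  by rewrite ii eq_sym in ij; rewrite (negbTE ij); apply: dZ.
case: (eqVneq j i0) => [jj|jj]; first by rewrite disjoint_sym; apply: dZ.
by apply: h2; rewrite // !inE ?ii ?jj.
Qed.

(** In the fraction 1/(2m), the m pays for disjointness and the 2 for rounding |Y i|/m down. *)
Lemma disjoint_subsets (m : nat) (Y : nat -> {set V}) :
  (forall i, (i < m)%N -> (m <= #|Y i|)%N) ->
  exists X : nat -> {set V}, [/\ pdisj m X,
    forall i, (i < m)%N -> X i \subset Y i &
    forall i, (i < m)%N -> (#|Y i| <= 2 * m * #|X i|)%N].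
Proof.
move=> hY; have [m0|m0] := posnP m.
  by exists (fun=> set0); split=> [i j|i|i]; rewrite m0 ?ltn0 ?andbF.
have [||X [h1 h2]] := @disjoint_family 'I_m (fun i => Y i) m (fun i => #|Y i| %/ m)%N.
- by rewrite card_ord.
- by move=> i; rewrite mulnC leq_trunc_div.
pose X' i := if insub i is Some j then X j else set0.
have X'E i (hi : (i < m)%N) : X' i = X (Ordinal hi) by rewrite /X' insubT.
exists X'; split=> [i j /andP[ij jm]|i hi|i hi].
- by rewrite !X'E ?(ltn_trans ij jm) // => im; apply: h2; rewrite -val_eqE /= ltn_eqF.
- by rewrite X'E; case: (h1 (Ordinal hi)).
rewrite X'E (h1 (Ordinal hi)).2 /=; have := hY i hi => h3.
have h4 : (0 < #|Y i| %/ m)%N by rewrite divn_gt0.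
have := ltn_pmod #|Y i| m0; have := divn_eq #|Y i| m.
by clear -h4; nia.
Qed.

End DisjointSubsets.

Section Sizes.
Variable R : realType.
Implicit Types (a b p q N y z : R).

Lemma size_mul a b p N y z (h : R) e e' j S : 0 <= a -> 0 <= b -> 0 < p -> p <= 1 ->
  0 <= N -> a * p ^+ e * N <= y -> b * p ^+ e' * N <= z ->
  (e + e' + j <= S)%N -> h <= a * b -> 0 <= h ->
  h * p ^+ S * N ^+ 2 <= y * z * p ^+ j.
Proof.
move=> a0 b0 p0 p1 N0 hy hz hS hh h0.
have pe i : 0 <= p ^+ i by rewrite exprn_ge0 // ltW.
have h1 : (a * p ^+ e * N) * (b * p ^+ e' * N) <= y * z.
  by apply: ler_pM => //; rewrite !mulr_ge0.
apply: le_trans (ler_wpM2r (pe j) h1).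
have -> : a * p ^+ e * N * (b * p ^+ e' * N) * p ^+ j
  = (a * b) * p ^+ (e + e' + j) * N ^+ 2 by rewrite !exprD; ring.
apply: ler_wpM2r; first exact: sqr_ge0.
by apply: ler_pM => //; rewrite ler_wiXn2l // ltW.
Qed.

End Sizes.

Section Good.
Variables (R : realType) (V : finType) (G : sgraph V) (p th : R) (k : nat).
Implicit Types (c : R) (X : {set V}) (f : seq V).
Local Notation N := (#|V|%:R : R).
Local Notation cn := (cn G).

(* The sizes that common neighbourhoods of ends of a path must have for the
   path to be extendable; [th] is a fixed density. *)
Definition good c X f : Prop := forall i, (i <= k)%N ->
  c * th * (p / 8) ^+ i * N <= #|cn (take i f) X|%:R.

Hypotheses (p0 : 0 < p) (p1 : p <= 1) (th0 : 0 < th).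

Lemma good_size c X f i : 0 <= c -> good c X f -> (i <= k)%N ->
  c * th / 8 ^+ k * p ^+ i * N <= #|cn (take i f) X|%:R.
Proof.
move=> c0 gf ik; apply: le_trans (gf i ik).
have -> : c * th * (p / 8) ^+ i * N = (c * th * p ^+ i * N) / 8 ^+ i.
  by rewrite expr_div_n; ring.
have -> : c * th / 8 ^+ k * p ^+ i * N = (c * th * p ^+ i * N) / 8 ^+ k by ring.
apply: ler_wpM2l; first by rewrite !mulr_ge0 ?exprn_ge0 ?(ltW p0) ?(ltW th0).
by rewrite lef_pV2 ?posrE ?exprn_gt0 // ler_weXn2l // ler1n.
Qed.

Lemma good_dec (i j : nat) c : 0 <= c -> (i <= j)%N ->
  c * th * (p / 8) ^+ j * N <= c * th * (p / 8) ^+ i * N.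
Proof.
move=> c0 ij; apply: ler_wpM2r => //; apply: ler_wpM2l.
  by rewrite mulr_ge0 // ltW.
by apply: ler_wiXn2l => //; move: p0 p1; lra.
Qed.

(** The smallest set that [good] requires, with constant 1, has size th (p/8)^k N, so a loss of that
    many vertices lowers the constant from 2 to 1 at worst. *)
Lemma good_shrink X X' f : good 2 X f -> X' \subset X ->
  #|X :\: X'|%:R <= th * (p / 8) ^+ k * N -> good 1 X' f.
Proof.
move=> gf sX hX i ik; have := gf i ik.
have h1 : #|cn (take i f) X|%:R <= #|cn (take i f) X'|%:R + #|X :\: X'|%:R :> R.
  rewrite -natrD ler_nat -(cardsID X' (cn (take i f) X)); apply: leq_add.
    apply: subset_leq_card; apply/subsetP => v; rewrite !(inE, in_cn).
    by case/andP=> /andP[_ ->] ->.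
  by apply: subset_leq_card; apply: setSD; apply: cn_sub.
have := @good_dec i k 1 ler01 ik; lra.
Qed.

Lemma good_le c c' X X' f : 0 <= c <= c' -> X \subset X' -> good c' X f -> good c X' f.
Proof.
move=> /andP[c0 cc] sX gf i ik.
apply: (@le_trans _ _ (c' * th * (p / 8) ^+ i * N)).
  apply: ler_wpM2r => //; apply: ler_wpM2r; first by rewrite exprn_ge0 // divr_ge0 // ltW.
  by rewrite ler_wpM2r // ltW.
apply: (le_trans (gf i ik)); rewrite ler_nat.
by apply: subset_leq_card; apply: cnS.
Qed.

End Good.

Section Connect.
Variables (R : realType) (V : finType) (G : sgraph V) (p th eta : R) (n : nat).
Local Notation N := (#|V|%:R : R).
Local Notation k := n.+1.
Local Notation cn := (cn G).
Hypotheses (th0 : 0 < th) (eta0 : 0 <= eta).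

(** Both ends are listed from the tip inwards, so the connecting vertices stand between [rev g] and
    [f]. *)
Definition connects (T : nat) : Prop := forall (X : {set V}) f g,
  size f = k -> size g = k -> kpath G k f -> kpath G k g ->
  good G p th k 1 X f -> good G p th k 1 X g ->
  exists c, [/\ (size c <= T)%N, uniq c, {subset c <= X}
              & kpath G k (rev g ++ c ++ f)].

(** For sets of order p^(e i) N, [chain_cond] becomes arithmetic with the exponents [e]. *)
Lemma chain_condI S (X : nat -> {set V}) (e : nat -> nat) (b : R) :
  pseudo G p (eta * p ^+ S * N ^+ 2) -> 0 <= b ->
  (forall i, (i < 3 * k)%N -> b * p ^+ e i * N <= #|X i|%:R) ->
  eta <= dB R n * (b * b) ->
  (forall j, (j <= n)%N ->
    [/\ forall m i, (m < i <= n)%N -> (e (j + m.+1) + e (j + i.+1) + (n + m) <= S)%N,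
        forall m, (m < n)%N -> (e (j + m.+1) + e j + (n + m) <= S)%N
      & (e j + e (j + n.+1) + (n + n) <= S)%N]) ->
  chain_cond p (eta * p ^+ S * N ^+ 2) n (dB R n) X.
Proof.
move=> pG b0 hX he hS j jn; have [h1 h2 h3] := hS j jn.
have [d0 _ _ _] := dB_prop R n.
have p0 := ps_gt0 pG; have p1 := ps_le1 pG.
have key i i' l : (i < 3 * k)%N -> (i' < 3 * k)%N -> (e i + e i' + l <= S)%N ->
    eta * p ^+ S * N ^+ 2 <= dB R n * (#|X i|%:R * #|X i'|%:R * p ^+ l).
  move=> hi hi' hl; rewrite -ler_pdivrMl //.
  rewrite (_ : _^-1 * _ = (eta / dB R n) * p ^+ S * N ^+ 2); last by ring.
  apply: (size_mul b0 b0 p0 p1 _ (hX i hi) (hX i' hi') hl) => //.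
    by rewrite ler_pdivrMr // mulrC.
  by rewrite divr_ge0 // ltW.
split=> [m i hmi|m hm|]; apply: key; rewrite ?h1 ?h2 ?h3 //.
- by clear -jn hmi; lia.
- by clear -jn hmi; lia.
- by clear -jn hm; lia.
- by clear -jn; lia.
- by clear -jn; lia.
- by clear -jn; lia.
Qed.

Lemma sets_uniq m (X : nat -> {set V}) s x0 : pdisj m X -> size s = m ->
  (forall i, (i < m)%N -> nth x0 s i \in X i) -> uniq s.
Proof.
move=> dX ss sX; apply/(uniqP x0) => i j; rewrite !inE ss => im jm e.
have sym a b : (a < b)%N -> (b < m)%N -> nth x0 s a = nth x0 s b -> False.
  move=> ab bm eab; have dab := dX a b; rewrite ab bm in dab.
  have := disjointFr (dab isT) (sX a (ltn_trans ab bm)).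
  by rewrite eab sX.
by case: (ltngtP i j) => // ij; [case: (sym i j)|case: (sym j i)].
Qed.

Lemma sets_sub m (X : nat -> {set V}) (Y : {set V}) s x0 : size s = m ->
  (forall i, (i < m)%N -> X i \subset Y) ->
  (forall i, (i < m)%N -> nth x0 s i \in X i) -> {subset s <= Y}.
Proof.
move=> ss XY sX v /(nthP x0)[i hi <-]; rewrite ss in hi.
exact: (subsetP (XY i hi)) (sX i hi).
Qed.

Lemma kpath_between g s f x0 : (k <= size s)%N ->
  kpath G k g -> kpath G k s -> kpath G k f ->
  (forall i j, (i + j < k)%N -> (i < size g)%N -> (j < size s)%N ->
     adj G (nth x0 g i) (nth x0 s j)) ->
  (forall i j, (i + j < k)%N -> (i < size f)%N -> (j < size s)%N ->
     adj G (nth x0 f i) (nth x0 (rev s) j)) ->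
  kpath G k (rev g ++ s ++ f).
Proof.
move=> hs kg ks kf hg hf; apply: kpath_glue => //; first exact: kpath_attach hg.
rewrite -kpath_rev rev_cat; apply: (kpath_attach (x0 := x0)); rewrite ?kpath_rev //.
by move=> i j h1 h2; rewrite size_rev; apply: hf.
Qed.

Lemma nth_take_all (P : pred V) l m i x0 :
  all P (take m l) -> (i < m)%N -> (i < size l)%N -> P (nth x0 l i).
Proof.
move=> /(all_nthP x0) h im il; rewrite -(nth_take x0 im); apply: h.
by rewrite size_take_min leq_min im.
Qed.

Lemma connects_large : let b := th / 8 ^+ k / (6 * k)%:R in
  pseudo G p (eta * p ^+ (3 * n + 1) * N ^+ 2) ->
  eta <= dB R n * (b * b) ->
  (3 * k)%:R <= th / 8 ^+ k * p ^+ k * N -> connects (3 * k).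
Proof.
move=> b pG he hN X f g sf sg kf kg gf gg.
have p0 := ps_gt0 pG; have p1 := ps_le1 pG.
have [x0 _] : exists x0 : V, x0 \in f.
  by case: f sf {kf gf} => // x f _; exists x; rewrite inE eqxx.
(* The first k sets respect fewer and fewer vertices of [g], the last k more and more of [f], and
   the middle ones are free; [e j] counts the constraints. The exponent 3n + 1 is attained at j = 0,
   as e 0 + e (n + 1) + 2n. *)
pose Y j := if (j < k)%N then cn (take (k - j) g) X
  else if (j < 2 * k)%N then X else cn (take (j.+1 - 2 * k) f) X.
pose e j := ((k - j) + (j.+1 - 2 * k))%N.
have YX j : Y j \subset X by rewrite /Y; case: ifP => _; [|case: ifP => _]; rewrite ?cn_sub.
have hY j : (j < 3 * k)%N -> th / 8 ^+ k * p ^+ e j * N <= #|Y j|%:R.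
  have gs l i : good G p th k 1 X l -> (i <= k)%N ->
      th / 8 ^+ k * p ^+ i * N <= #|cn (take i l) X|%:R.
    by move=> gl ik; rewrite -[th]mul1r; apply: good_size.
  rewrite /Y /e => jk; case: ltnP => j1.
    have -> : (k - j + (j.+1 - 2 * k) = k - j)%N by clear -j1; lia.
    by apply: gs => //; clear; lia.
  case: ltnP => j2.
    have -> : (k - j + (j.+1 - 2 * k) = 0)%N by clear -j1 j2; lia.
    by have := gs f 0%N gf isT; rewrite take0.
  have -> : (k - j + (j.+1 - 2 * k) = j.+1 - 2 * k)%N by clear -j1; lia.
  by apply: gs => //; clear -jk; lia.
have hY2 j : (j < 3 * k)%N -> (3 * k <= #|Y j|)%N.
  move=> jk; rewrite -(ler_nat R); apply: le_trans (le_trans hN _) (hY j jk).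
  apply: ler_wpM2r => //; apply: ler_wpM2l; first by rewrite divr_ge0 ?exprn_ge0 // ltW.
  by apply: ler_wiXn2l; rewrite ?(ltW p0) // /e; clear -jk; lia.
have [Z [dZ ZY cZ]] := disjoint_subsets hY2.
have k0 : 0 < (6 * k)%:R :> R by rewrite ltr0n.
have hZ j : (j < 3 * k)%N -> b * p ^+ e j * N <= #|Z j|%:R.
  move=> jk; have -> : b * p ^+ e j * N = (th / 8 ^+ k * p ^+ e j * N) / (6 * k)%:R.
    by rewrite /b; ring.
  rewrite ler_pdivrMr //; apply: le_trans (hY j jk) _.
  by rewrite -natrM ler_nat mulnC; move: (cZ j jk); rewrite mulnA.
have b0 : 0 < b by rewrite !divr_gt0 ?exprn_gt0.
have Z0 j : (j < 3 * k)%N -> 0 < #|Z j|%:R :> R.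
  move=> jk; rewrite ltr0n; have := cZ j jk; have := hY2 j jk.
  by clear; case: #|Z j| => // h1; rewrite muln0 leqn0 => /eqP h2; rewrite h2 in h1.
have eR j : (j < 3 * k)%N -> e (3 * k - j.+1)%N = e j by move=> jk; rewrite /e; clear -jk; lia.
have hS j : (j <= n)%N ->
    [/\ forall m i, (m < i <= n)%N -> (e (j + m.+1) + e (j + i.+1) + (n + m) <= 3 * n + 1)%N,
        forall m, (m < n)%N -> (e (j + m.+1) + e j + (n + m) <= 3 * n + 1)%N
      & (e j + e (j + n.+1) + (n + n) <= 3 * n + 1)%N].
  by rewrite /e; clear; move=> jn; split=> [m i hmi|m hm|]; lia.
have c1 := chain_condI pG (ltW b0) hZ he hS.
have hZ' j : (j < 3 * k)%N -> b * p ^+ e j * N <= #|Z (3 * k - j.+1)%N|%:R.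
  by move=> jk; rewrite -(eR j jk); apply: hZ; clear -jk; lia.
have c2 := chain_condI pG (ltW b0) hZ' he hS.
have [s [ss ks sZ]] := blowup pG x0 dZ Z0 c1 c2.
have sY j : (j < 3 * k)%N -> nth x0 s j \in Y j.
  by move=> jk; apply: (subsetP (ZY j jk)); apply: sZ.
exists s; split; rewrite ?ss //.
- exact: sets_uniq sZ.
- by apply: (sets_sub ss) sY => i _.
apply: (kpath_between (x0 := x0)) => //; first by rewrite ss; clear; lia.
- move=> i j ij ig js; have := sY j; rewrite -ss => /(_ js).
  rewrite /Y (_ : (j < k)%N); last by clear -ij; lia.
  rewrite in_cn => /andP[_ h]; rewrite adjC; apply: (nth_take_all x0 h) => //.
  by clear -ij; lia.
move=> i j ij ig js; rewrite nth_rev //.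
have := sY (size s - j.+1)%N; rewrite ss => h.
have {h} := h ltac:(clear; lia).
rewrite ss in js; rewrite /Y ifF; last by apply/negP; clear -ij js; lia.
rewrite ifF; last by apply/negP; clear -ij js; lia.
rewrite in_cn => /andP[_ h]; rewrite adjC; apply: (nth_take_all x0 h) => //.
by clear -ij js; lia.
Qed.

End Connect.

(** * Connecting two ends of the square of a path *)

Section Expand.
Variables (R : realType) (V : finType) (G : sgraph V) (p K : R).
Hypothesis pG : pseudo G p K.
Local Notation nbs := (nbs G).
Implicit Types (A X T H : {set V}) (D : R).

Lemma sum_card_exchange A X (r : rel V) :
  (\sum_(y in X) #|[set x in A | r x y]| = \sum_(x in A) #|[set y in X | r x y]|)%N.
Proof.
transitivity (\sum_(y in X) \sum_(x in A) (r x y : nat))%N.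
  apply: eq_bigr => y _; rewrite -sum1_card big_mkcond [RHS]big_mkcond.
  by apply: eq_bigr => x _; rewrite inE; case: (x \in A); case: (r x y).
rewrite exchange_big; apply: eq_bigr => x _.
rewrite -sum1_card big_mkcond [RHS]big_mkcond.
by apply: eq_bigr => y _; rewrite inE; case: (y \in X); case: (r x y).
Qed.

Definition reached y X H : {set V} :=
  [set z in nbs y X | [exists x in H, adj G x z]].

Lemma in_reached y X H z : (z \in reached y X H) =
  ((z \in X) && adj G y z) && [exists x in H, adj G x z].
Proof. by rewrite in_set in_nbs. Qed.

Lemma expand_step y X H D : [disjoint H & X] ->
  (forall x, x \in H -> D <= #|nbs x (nbs y X)|%:R) ->
  D < 2 * p * #|reached y X H|%:R \/
  #|H|%:R * D ^+ 2 <= K * p ^+ 2 * #|reached y X H|%:R.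
Proof.
move=> dHX hD; set T := reached y X H.
have [h|h] := ltP D (2 * p * #|T|%:R); [by left|right].
apply: (ps_dense pG) => //.
  move: dHX; rewrite !disjoint_subset => /subset_trans; apply.
  by apply/subsetP => v; rewrite !inE; apply: contra => /andP[/andP[]].
move=> x xH; apply: (le_trans (hD x xH)); rewrite ler_nat subset_leq_card //.
apply/subsetP => z; rewrite in_nbs => /andP[zy xz].
rewrite in_nbs xz andbT in_reached; move: zy; rewrite in_nbs => ->.
by apply/existsP; exists x; rewrite xH.
Qed.

Lemma low_le X (z : R) : 0 < z -> z <= #|X|%:R -> #|lowset G p X|%:R <= K / z.
Proof.
move=> z0 hz; rewrite ler_pdivlMr //; apply: le_trans (ps_low pG X).
by rewrite ler_wpM2l.
Qed.

Lemma card_minus X (Y : {set V}) : #|X|%:R - #|Y|%:R <= #|X :\: Y|%:R :> R.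
Proof.
by rewrite lerBlDr -natrD ler_nat -(cardsID Y X) addnC leq_add2l subset_leq_card ?subsetIr.
Qed.

End Expand.

Section ExpandSquare.
Variables (R : realType) (V : finType) (G : sgraph V) (p eta c : R).
Let N : R := #|V|%:R.
Let K : R := eta * p ^+ 3 * N ^+ 2.
Hypothesis pG : pseudo G p K.
Hypotheses (eta0 : 0 < eta) (c0 : 0 < c) (c1 : c <= 1) (N0 : 0 < N).
Hypothesis he : eta <= c ^+ 3 / 256.
Local Notation nbs := (nbs G).
Local Notation low := (lowset G p).

(* The directed edges that end a square of a path starting with the edge [ab]:
   the number of reachable edges grows from x1 x2 to x4 x5 until some vertex
   [v] is the beginning of linearly many (in p N) of them. *)
Lemma expand_square (a b : V) (X1 X2 X3 X4 X5 : {set V}) :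
  adj G b a -> {in X1, forall x, adj G x b && adj G x a} ->
  {in X2, forall x, adj G x b} ->
  pairwise (fun A B : {set V} => [disjoint A & B]) [:: X1; X2; X3; X4; X5] ->
  c * p ^+ 2 * N <= #|X1|%:R -> c * p * N <= #|X2|%:R ->
  c * N <= #|X3|%:R -> c * N <= #|X4|%:R -> c * N <= #|X5|%:R ->
  {in X1, forall x, (x \notin low X2) && (x \notin low X3)} ->
  {in X2, forall x, x \notin low X4} -> {in X4, forall x, x \notin low X5} ->
  exists v (W : {set V}), [/\ v \in X2 :|: X3 :|: X4, W \subset X3 :|: X4 :|: X5,
    c / 32 * p * N <= #|W|%:R &
    forall w, w \in W -> exists l, [/\ kpath G 2 (w :: v :: l ++ [:: b; a]),
      uniq (w :: v :: l), (size l <= 3)%N & {subset l <= X1 :|: X2 :|: X3}]].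
Proof.
move=> ba hX1 hX2 dX s1 s2 s3 s4 s5 l1 l2 l4.
have p0 := ps_gt0 pG; have p1 := ps_le1 pG.
move: (eta0) (c0) (c1) (N0) (he) => eta0' c0' c1' N0' he'.
move: dX; rewrite /= !andbT -!andbA => /and5P[d12 d13 d14 d15 /and5P[d23 d24 d25 d34 /andP[d35 d45]]].
have K0 : 0 < K by rewrite !mulr_gt0 ?exprn_gt0.
have pN2 : 0 < p ^+ 2 * N by rewrite mulr_gt0 ?exprn_gt0.
have lowc (X : {set V}) : c * N <= #|X|%:R -> forall x, x \notin low X ->
    #|low (nbs x X)|%:R <= 4 * eta / c * (p ^+ 2 * N).
  move=> hX x /nlow hx.
  have -> : 4 * eta / c * (p ^+ 2 * N) = K / (p / 4 * (c * N)).
    by rewrite /K; field; rewrite !gt_eqF.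
  apply: (low_le pG); first by rewrite !mulr_gt0 ?invr_gt0.
  by apply: le_trans hx; rewrite ler_pM2l // divr_gt0.
have hc2 : 4 * eta / c <= c / 16.
  rewrite ler_pdivrMr //.
  have : c ^+ 3 <= c * c by rewrite exprS ler_pM2l // expr2 ler_piMr // ltW.
  lra.
(* Only edges with at least [D] common neighbours in the next set are continued. The sets [H]
   collect predecessors of a vertex and the sets [T] its reachable successors. *)
pose r1 x1 x2 := adj G x1 x2 && (x2 \notin low (nbs x1 X3)).
pose H1 x2 := [set x1 in X1 | r1 x1 x2].
pose T3 x2 := reached G x2 X3 (H1 x2).
pose r2 x2 x3 := (x3 \in T3 x2) && (x3 \notin low (nbs x2 X4)).
pose H2 x3 := [set x2 in X2 | r2 x2 x3].
pose T4 x3 := reached G x3 X4 (H2 x3).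
pose H3 x4 := [set x3 in X3 | x4 \in T4 x3].
pose T5 x4 := reached G x4 X5 (H3 x4).
pose D : R := c / 16 * p ^+ 2 * N.
have D0 : 0 < D by rewrite !mulr_gt0 ?exprn_gt0 ?invr_gt0.
have nbs2 (X : {set V}) x y : c * N <= #|X|%:R -> x \notin low X -> y \notin low (nbs x X) ->
    D <= #|nbs x (nbs y X)|%:R.
  move=> hX /nlow h1 /nlow h2.
  have -> : nbs x (nbs y X) = nbs y (nbs x X).
    by apply/setP => u; rewrite !in_nbs andbAC.
  apply: le_trans h2.
  have -> : D = p / 4 * (p / 4 * (c * N)) by rewrite /D; field.
  rewrite ler_pM2l ?divr_gt0 //; apply: le_trans h1.
  by rewrite ler_pM2l ?divr_gt0.
have WD (A : {set V}) : D < 2 * p * #|A|%:R -> c / 32 * p * N <= #|A|%:R.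
  move=> h; rewrite -(ler_pM2l p0); move: h; rewrite /D; lra.
have path3 x2 x3 : x2 \in X2 -> x3 \in T3 x2 -> exists2 x1, x1 \in X1 &
    [/\ adj G x3 x2, adj G x3 x1, adj G x2 x1 & x3 \in X3].
  move=> x2X; rewrite in_reached => /andP[/andP[x3X x23] /existsP[x1 /andP[h h13]]].
  move: h; rewrite inE /r1 => /andP[x1X /andP[h12 _]].
  by exists x1 => //; rewrite adjC x23 adjC h13 adjC h12.
have kp3 x1 x2 x3 : x1 \in X1 -> x2 \in X2 -> adj G x3 x2 -> adj G x3 x1 -> adj G x2 x1 ->
    kpath G 2 [:: x3; x2; x1; b; a].
  by move=> /hX1/andP[h1 h2] /hX2 h3 h4 h5 h6; rewrite /= h1 h2 h3 h4 h5 h6 ba.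
have nd (A B : {set V}) x y : [disjoint A & B] -> x \in A -> y \in B -> (y == x) = false.
  by move=> dAB xA yB; apply/negP => /eqP e; have := disjointFr dAB xA; rewrite -e yB.
(* If some [x2] already has more than D/(2p) successors, the search stops with v = x2; otherwise
   [expand_step] gives expansion for every [x2]. *)
have [/existsP[x2 /andP[x2X hQ]]|/existsPn nQ2] :=
    boolP [exists x2, (x2 \in X2) && (D < 2 * p * #|T3 x2|%:R)].
  exists x2, (T3 x2); split; first by rewrite !inE x2X.
  - by apply/subsetP => w /(path3 _ _ x2X)[x1 _ [_ _ _]]; rewrite !inE => ->.
  - exact: WD.
  move=> x3 /(path3 _ _ x2X)[x1 x1X [h1 h2 h3 x3X]]; exists [:: x1]; split.
  - exact: kp3.
  - by rewrite /= !inE (nd _ _ x2 x3 d23) // (nd _ _ x1 x3 d13) // (nd _ _ x1 x2 d12).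
  - by [].
  - by move=> v; rewrite !inE => /eqP->; rewrite x1X.
have hT3 x2 : x2 \in X2 -> #|H1 x2|%:R * D ^+ 2 <= K * p ^+ 2 * #|T3 x2|%:R.
  move=> x2X; case: (@expand_step R V G p K pG x2 X3 (H1 x2) D) => //.
  - move: d13; rewrite !disjoint_subset; apply: subset_trans.
    by apply/subsetP => v; rewrite inE => /andP[].
  - move=> x1; rewrite inE => /andP[x1X /andP[_ h12]].
    by apply: nbs2 => //; case/andP: (l1 _ x1X).
  - by move=> h; have := nQ2 x2; rewrite x2X /= h.
have sH1 : #|X1|%:R * (p / 8 * #|X2|%:R) <= \sum_(x2 in X2) #|H1 x2|%:R :> R.
  rewrite -natr_sum sum_card_exchange natr_sum mulr_natl -sumr_const.
  apply: ler_sum => x1 x1X; have /andP[/nlow n2 n3] := l1 _ x1X.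
  have := card_minus R (nbs x1 X2) (low (nbs x1 X3)).
  have -> : nbs x1 X2 :\: low (nbs x1 X3) = [set y in X2 | r1 x1 y].
    by apply/setP => u; rewrite in_setD in_nbs [RHS]in_set /r1 andbC andbA.
  have := lowc _ s3 _ n3.
  have : 4 * eta / c * (p ^+ 2 * N) <= c / 16 * (p ^+ 2 * N) by rewrite ler_pM2r.
  have : p * (c * p * N) <= p * #|X2|%:R by rewrite ler_pM2l.
  have : 0 <= p * #|X2|%:R by rewrite mulr_ge0 // ltW.
  lra.
pose B : R := #|X2|%:R; have B0 : 0 < B.
  by apply: lt_le_trans s2; rewrite !mulr_gt0.
(* The average of [H1 x2] is of order p^3 N, that of [T3 x2] of order p^2 N / eta. The low sets
   removed next have only order eta p^2 N. *)
have sT3 : c ^+ 3 / (2048 * eta) * (p ^+ 2 * N) * B <= \sum_(x2 in X2) #|T3 x2|%:R.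
  have h1 : (\sum_(x2 in X2) #|H1 x2|%:R) * D ^+ 2
      <= K * p ^+ 2 * \sum_(x2 in X2) #|T3 x2|%:R.
    by rewrite mulr_suml mulr_sumr; apply: ler_sum.
  have Kp : 0 < K * p ^+ 2 by rewrite mulr_gt0 ?exprn_gt0.
  rewrite -(ler_pM2l Kp); apply: le_trans h1.
  have h2 := ler_wpM2r (sqr_ge0 D) sH1; apply: le_trans h2.
  have h3 : (c * p ^+ 2 * N) * (p / 8 * B) <= #|X1|%:R * (p / 8 * B).
    by rewrite ler_wpM2r // mulr_ge0 ?(ltW B0) // divr_ge0 // ltW.
  apply: le_trans (ler_wpM2r (sqr_ge0 D) h3).
  rewrite le_eqVlt; apply/orP; left; apply/eqP; rewrite /K /D; field.
  by rewrite gt_eqF.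
have D3 : 8 * eta / c <= c ^+ 3 / (2048 * eta).
  rewrite ler_pdivrMr // mulrAC ler_pdivlMr ?mulr_gt0 //.
  have h1 : eta * eta <= (c ^+ 3 / 256) * (c ^+ 3 / 256) by apply: ler_pM => //; lra.
  have h2 : c ^+ 3 * c ^+ 3 <= c ^+ 3 * c.
    by rewrite ler_wpM2l ?exprn_ge0 ?(ltW c0) // exprS ler_piMr ?(ltW c0) // exprn_ile1 // ltW.
  have : 0 <= c ^+ 3 * c by rewrite mulr_ge0 ?exprn_ge0 ?ltW.
  lra.
set C3 := c ^+ 3 / (2048 * eta) in sT3 D3.
pose T3' x2 := [set x3 in X3 | r2 x2 x3].
have sT3' : C3 / 2 * (p ^+ 2 * N) * B <= \sum_(x2 in X2) #|T3' x2|%:R.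
  have h1 x2 : x2 \in X2 -> #|T3 x2|%:R - 4 * eta / c * (p ^+ 2 * N) <= #|T3' x2|%:R.
    move=> x2X; have := lowc _ s4 _ (l2 _ x2X).
    have := card_minus R (T3 x2) (low (nbs x2 X4)).
    have -> : T3 x2 :\: low (nbs x2 X4) = T3' x2.
      apply/setP => u; rewrite in_setD [RHS]in_set /r2 andbC.
      case u3 : (u \in T3 x2); rewrite ?andbF //=.
      by have [x1 _ [_ _ _ ->]] := path3 _ _ x2X u3.
    lra.
  apply: (@le_trans _ _ (\sum_(x2 in X2) (#|T3 x2|%:R - 4 * eta / c * (p ^+ 2 * N)))).
    rewrite sumrB sumr_const -[X in _ <= _ - X]mulr_natl -/B.
    have : 8 * eta / c * (p ^+ 2 * N * B) <= C3 * (p ^+ 2 * N * B).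
      by rewrite ler_wpM2r // mulr_ge0 // ltW.
    lra.
  by apply: ler_sum.
have path4 x3 x4 : x3 \in X3 -> x4 \in T4 x3 -> exists x1 x2,
    [/\ x1 \in X1, x2 \in X2, x4 \in X4 &
       [&& adj G x4 x3, adj G x4 x2, adj G x3 x2, adj G x3 x1 & adj G x2 x1]].
  move=> x3X; rewrite in_reached => /andP[/andP[x4X x34] /existsP[x2 /andP[h h24]]].
  move: h; rewrite inE /r2 => /andP[x2X /andP[h _]].
  have [x1 x1X [h1 h2 h3 _]] := path3 _ _ x2X h.
  by exists x1, x2; split=> //; rewrite adjC x34 adjC h24 h1 h2 h3.
have kp4 x1 x2 x3 x4 : x1 \in X1 -> x2 \in X2 ->
    [&& adj G x4 x3, adj G x4 x2, adj G x3 x2, adj G x3 x1 & adj G x2 x1] ->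
    kpath G 2 [:: x4; x3; x2; x1; b; a].
  move=> h1 h2 /and5P[h3 h4 h5 h6 h7].
  by have := kp3 _ _ _ h1 h2 h5 h6 h7; rewrite /= h3 h4 => ->.
have [/existsP[x3 /andP[x3X hQ]]|/existsPn nQ3] :=
    boolP [exists x3, (x3 \in X3) && (D < 2 * p * #|T4 x3|%:R)].
  exists x3, (T4 x3); split; first by rewrite !inE x3X orbT.
  - by apply/subsetP => w /(path4 _ _ x3X)[x1 [x2 [_ _ ]]]; rewrite !inE => ->; rewrite orbT.
  - exact: WD.
  move=> x4 /(path4 _ _ x3X)[x1 [x2 [x1X x2X x4X h]]]; exists [:: x2; x1]; split.
  - exact: kp4.
  - rewrite /= !inE (nd _ _ x3 x4 d34) // (nd _ _ x2 x4 d24) // (nd _ _ x1 x4 d14) //.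
    by rewrite (nd _ _ x2 x3 d23) // (nd _ _ x1 x3 d13) // (nd _ _ x1 x2 d12).
  - by [].
  - by move=> v; rewrite !inE => /orP[]/eqP->; rewrite ?x1X ?x2X ?orbT.
have hT4 x3 : x3 \in X3 -> #|H2 x3|%:R * D ^+ 2 <= K * p ^+ 2 * #|T4 x3|%:R.
  move=> x3X; case: (@expand_step R V G p K pG x3 X4 (H2 x3) D) => //.
  - move: d24; rewrite !disjoint_subset; apply: subset_trans.
    by apply/subsetP => v; rewrite inE => /andP[].
  - move=> x2; rewrite inE => /andP[x2X /andP[_ h23]].
    by apply: nbs2 => //; apply: l2.
  - by move=> h; have := nQ3 x3; rewrite x3X /= h.
pose C4 : R := c ^+ 6 / (2 ^+ 20 * eta ^+ 2).
have sT4 : C4 * (p ^+ 2 * N) * N <= \sum_(x3 in X3) #|T4 x3|%:R.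
  have h1 : (\sum_(x3 in X3) #|H2 x3|%:R) * D ^+ 2
      <= K * p ^+ 2 * \sum_(x3 in X3) #|T4 x3|%:R.
    by rewrite mulr_suml mulr_sumr; apply: ler_sum.
  have h2 : \sum_(x3 in X3) #|H2 x3|%:R = \sum_(x2 in X2) #|T3' x2|%:R :> R.
    by rewrite -!natr_sum /H2 /T3' sum_card_exchange.
  have Kp : 0 < K * p ^+ 2 by rewrite mulr_gt0 ?exprn_gt0.
  rewrite -(ler_pM2l Kp); apply: le_trans h1.
  rewrite h2; apply: le_trans (ler_wpM2r (sqr_ge0 D) sT3').
  have C30 : 0 <= C3 / 2 * (p ^+ 2 * N).
    by rewrite mulr_ge0 ?(ltW pN2) // !divr_ge0 ?exprn_ge0 ?mulr_ge0 ?ltW.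
  apply: le_trans (ler_wpM2r (sqr_ge0 D) (ler_wpM2l C30 s2)).
  rewrite le_eqVlt; apply/orP; left; apply/eqP; rewrite /K /D /C3 /C4; field.
  by rewrite gt_eqF.
have C40 : 0 < C4 by rewrite !mulr_gt0 ?invr_gt0 ?mulr_gt0 ?exprn_gt0.
have hsum : (\sum_(x4 in X4) #|H3 x4|%:R : R) = \sum_(x3 in X3) #|T4 x3|%:R.
  rewrite -!natr_sum /H3 sum_card_exchange; congr (_%:R); apply: eq_bigr => x3 x3X.
  apply: eq_card => u; rewrite [LHS]in_set andb_idl // => uT.
  by have [x1 [x2 [_ _ -> _]]] := path4 _ _ x3X uT.
(* By averaging, some [x4] has C4 p^2 N predecessors. At most (eta/C4) p N vertices are low into
   them, fewer than [x4] has neighbours in [X5], so most of these neighbours are reached. *)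
have [x4 x4X h4] : exists2 x4, x4 \in X4 & C4 * (p ^+ 2 * N) <= #|H3 x4|%:R.
  have [/existsP[x4 /andP[h1 h2]]|/existsPn no] :=
      boolP [exists x4, (x4 \in X4) && (C4 * (p ^+ 2 * N) <= #|H3 x4|%:R)].
    by exists x4.
  have X40 : 0 < #|X4|%:R :> R by apply: lt_le_trans s4; rewrite mulr_gt0.
  have : \sum_(x4 in X4) #|H3 x4|%:R < \sum_(x4 in X4) C4 * (p ^+ 2 * N) :> R.
    apply: ltr_sum => [|x4 x4X].
      by case: (pickP (mem X4)) X40 => [x4 x4X _|/eq_card0->]; [apply/hasP; exists x4; rewrite ?mem_index_enum|rewrite ltxx].
    by have := no x4; rewrite x4X /= -ltNge.
  rewrite hsum sumr_const -[X in _ < X]mulr_natl => h.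
  have : #|X4|%:R * (C4 * (p ^+ 2 * N)) <= N * (C4 * (p ^+ 2 * N)).
    by rewrite ler_wpM2r ?ler_nat ?max_card // mulr_ge0 ?(ltW C40) // ltW.
  lra.
exists x4, (T5 x4); split; first by rewrite !inE x4X orbT.
- by apply/subsetP => w; rewrite in_reached !inE => /andP[/andP[-> _] _]; rewrite orbT.
- have h1 : nbs x4 X5 :\: low (H3 x4) \subset T5 x4.
    apply/subsetP => x5; rewrite in_setD in_nbs => /andP[/nlow h /andP[x5X x45]].
    rewrite in_reached x5X x45 /=.
    have : (0 < #|nbs x5 (H3 x4)|)%N.
      rewrite -(ltr0n R); apply: lt_le_trans h; rewrite mulr_gt0 ?divr_gt0 //.
      by apply: lt_le_trans h4; rewrite mulr_gt0.
    case/card_gt0P => x3; rewrite in_nbs => /andP[x3H x53].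
    by apply/existsP; exists x3; rewrite x3H adjC.
  have h2 := card_minus R (nbs x4 X5) (low (H3 x4)).
  have h3 : #|low (H3 x4)|%:R <= eta / C4 * (p * N).
    have -> : eta / C4 * (p * N) = K / (C4 * (p ^+ 2 * N)).
      by rewrite /K; field; rewrite !gt_eqF.
    by apply: (low_le pG) => //; rewrite mulr_gt0.
  have h5 := nlow (l4 _ x4X).
  have h6 : p * (c * N) <= p * #|X5|%:R by rewrite ler_pM2l.
  have h7 : eta / C4 <= c / 8.
    rewrite ler_pdivrMr // /C4.
    have e3 : eta ^+ 3 <= (c ^+ 3 / 256) ^+ 3.
      by rewrite lerXn2r // nnegrE ?(ltW eta0) // divr_ge0 // exprn_ge0 // ltW.
    have c97 : c ^+ 9 <= c ^+ 7 by rewrite ler_wiXn2l // ltW.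
    have -> : c / 8 * (c ^+ 6 / (2 ^+ 20 * eta ^+ 2)) = c ^+ 7 / (2 ^+ 23 * eta ^+ 2).
      by field; rewrite gt_eqF.
    rewrite ler_pdivlMr ?mulr_gt0 ?exprn_gt0 //.
    have -> : eta * (2 ^+ 23 * eta ^+ 2) = 2 ^+ 23 * eta ^+ 3 by ring.
    have : 2 ^+ 23 * eta ^+ 3 <= 2 ^+ 23 * (c ^+ 3 / 256) ^+ 3.
      by rewrite ler_wpM2l // exprn_ge0.
    have -> : 2 ^+ 23 * (c ^+ 3 / 256) ^+ 3 = c ^+ 9 / 2 by field.
    have : 0 <= c ^+ 9 by rewrite exprn_ge0 // ltW.
    lra.
  have h8 : eta / C4 * (p * N) <= c / 8 * (p * N).
    by rewrite ler_wpM2r // mulr_ge0 // ltW.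
  have : #|nbs x4 X5 :\: low (H3 x4)|%:R <= #|T5 x4|%:R :> R.
    by rewrite ler_nat subset_leq_card.
  have : 0 <= p * (c * N) by rewrite !mulr_ge0 // ltW.
  lra.
move=> x5; rewrite in_reached => /andP[/andP[x5X x45] /existsP[x3 /andP[]]].
rewrite inE => /andP[x3X h] x35.
have [x1 [x2 [x1X x2X _ h1]]] := path4 _ _ x3X h.
exists [:: x3; x2; x1]; split.
- have := kp4 _ _ _ _ x1X x2X h1.
  by rewrite /= (adjC G x5 x4) x45 (adjC G x5 x3) x35 => ->.
- rewrite /= !inE (nd _ _ x4 x5 d45) // (nd _ _ x3 x5 d35) // (nd _ _ x2 x5 d25) //.
  rewrite (nd _ _ x1 x5 d15) // (nd _ _ x3 x4 d34) // (nd _ _ x2 x4 d24) //.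
  rewrite (nd _ _ x1 x4 d14) // (nd _ _ x2 x3 d23) // (nd _ _ x1 x3 d13) //.
  by rewrite (nd _ _ x1 x2 d12).
- by [].
- by move=> v; rewrite !inE => /or3P[]/eqP->; rewrite ?x1X ?x2X ?x3X ?orbT.
Qed.

End ExpandSquare.

Section Labels.
Variables (V : finType) (m : nat) (Z : nat -> {set V}).
Hypothesis dZ : pdisj m Z.
Implicit Types (l : seq nat) (P Q : {pred V}).

(** Bookkeeping of disjointness: two parts of a path are disjoint as soon as their lists of indices
    are. *)
Definition labelled l (P : {pred V}) : Prop :=
  all (fun i => (i < m)%N) l /\ forall v, v \in P -> exists2 i, i \in l & v \in Z i.

Lemma labelled_disj l l' P Q v : labelled l P -> labelled l' Q ->
  ~~ has (mem l) l' -> v \in P -> v \in Q -> False.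
Proof.
move=> [/allP lm hP] [/allP l'm hQ] /hasPn ll vP vQ.
have [i il vi] := hP v vP; have [j jl vj] := hQ v vQ.
have dis a b : (a < b)%N -> (b < m)%N -> v \in Z a -> v \in Z b -> False.
  move=> ab bm va vb; have := dZ (i := a) (j := b); rewrite ab bm => /(_ isT) d.
  by have := disjointFr d va; rewrite vb.
case: (ltngtP i j) => ij.
- exact: (dis i j ij (l'm _ jl)).
- exact: (dis j i ij (lm _ il)).
by have := ll _ jl; rewrite -ij /= il.
Qed.

Lemma labelled_disjoint l l' (A B : {set V}) : labelled l (mem A) -> labelled l' (mem B) ->
  ~~ has (mem l) l' -> [disjoint A & B].
Proof.
move=> lA lB ll; rewrite disjoint_subset; apply/subsetP => v vA.
by rewrite inE; apply/negP => vB; apply: (labelled_disj lA lB ll vA vB).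
Qed.

End Labels.

Section ConnectSquare.
Variables (R : realType) (V : finType) (G : sgraph V) (p eta c : R).
Let N : R := #|V|%:R.
Let K : R := eta * p ^+ 3 * N ^+ 2.
Hypothesis pG : pseudo G p K.
Hypotheses (eta0 : 0 < eta) (c0 : 0 < c) (c1 : c <= 1) (N0 : 0 < N).
Hypothesis he : eta <= c ^+ 3 / 256.
Local Notation nbs := (nbs G).
Local Notation low := (lowset G p).

Lemma expand_side (b a : V) (Z : nat -> {set V}) (s : nat) :
  adj G b a -> {in Z s, forall x, adj G x b && adj G x a} ->
  {in Z s.+1, forall x, adj G x b} ->
  (forall i j, (i < j < 6)%N -> [disjoint Z (s + i)%N & Z (s + j)%N]) ->
  2 * c * p ^+ 2 * N <= #|Z s|%:R -> 2 * c * p * N <= #|Z s.+1|%:R ->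
  (forall i, (2 <= i < 6)%N -> 2 * c * N <= #|Z (s + i)%N|%:R) ->
  exists v (W : {set V}), [/\ c / 32 * p * N <= #|W|%:R,
     c / 32 * p * N <= #|nbs v (Z (s + 5)%N)|%:R,
     forall w, w \in W -> exists2 i, i \in iota s 5 & w \in Z i &
    forall w, w \in W -> exists l, [/\ kpath G 2 (w :: v :: l ++ [:: b; a]),
      uniq (w :: v :: l), (size l <= 3)%N &
      forall x, x \in v :: l -> exists2 i, i \in iota s 5 & x \in Z i]].
Proof.
move=> ba h0 h1 dZ s0 s1 sZ.
have p0 := ps_gt0 pG; have p1 := ps_le1 pG.
move: (eta0) (c0) (c1) (N0) (he) => eta0' c0' c1' N0' he'.
have c2p : 0 < c * p by rewrite mulr_gt0.
have pp : p ^+ 2 <= p by rewrite expr2 ler_piMr // ltW.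
have ec : eta / c * 2 <= c.
  rewrite mulrAC ler_pdivrMr //.
  have : c ^+ 3 <= c * c by rewrite exprS ler_pM2l // expr2 ler_piMr // ltW.
  have : 0 <= c * c by rewrite mulr_ge0 // ltW.
  lra.
have low0 (X : {set V}) : c * N <= #|X|%:R -> #|low X|%:R <= eta / c * (p ^+ 2 * N).
  move=> hX; apply: (@le_trans _ _ (K / (c * N))).
    by apply: (low_le pG) => //; rewrite mulr_gt0.
  have -> : K / (c * N) = eta / c * (p ^+ 2 * N) * p.
    by rewrite /K; field; rewrite !gt_eqF.
  by rewrite ler_piMr // !mulr_ge0 ?invr_ge0 ?exprn_ge0 // ltW.
have low1 (X : {set V}) : c * p * N <= #|X|%:R -> #|low X|%:R <= eta / c * (p ^+ 2 * N).
  move=> hX; have -> : eta / c * (p ^+ 2 * N) = K / (c * p * N).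
    by rewrite /K; field; rewrite !gt_eqF.
  by apply: (low_le pG) => //; rewrite !mulr_gt0.
have pN : 0 < p ^+ 2 * N by rewrite mulr_gt0 ?exprn_gt0.
have minus (X A B : {set V}) (y : R) : p ^+ 2 * N <= y -> 2 * c * y <= #|X|%:R ->
    #|A|%:R <= eta / c * (p ^+ 2 * N) -> #|B|%:R <= eta / c * (p ^+ 2 * N) ->
    c * y <= #|X :\: (A :|: B)|%:R.
  move=> hy hX hA hB; have := card_minus R X (A :|: B).
  have : #|A :|: B|%:R <= #|A|%:R + #|B|%:R :> R by rewrite -natrD ler_nat cardsU leq_subr.
  have : eta / c * 2 * (p ^+ 2 * N) <= c * (p ^+ 2 * N) by rewrite ler_pM2r.
  have : c * (p ^+ 2 * N) <= c * y by rewrite ler_pM2l.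
  lra.
have y0 : p ^+ 2 * N <= N by rewrite ler_piMl ?(ltW N0) // exprn_ile1 // ltW.
have y1 : p ^+ 2 * N <= p * N by rewrite ler_pM2r.
pose X5 := Z (s + 4)%N; pose X6 := Z (s + 5)%N.
have zz i : (2 <= i < 6)%N -> c * N <= #|Z (s + i)%N|%:R.
  by move=> hi; have := sZ i hi; have : 0 <= c * N by [rewrite mulr_ge0 // ltW]; lra.
have s5 : c * N <= #|X5|%:R by apply: zz.
have l6 := low0 X6 (zz 5%N isT); have l5 := low0 X5 s5.
pose X4 := Z (s + 3)%N :\: (low X5 :|: low X6).
have s4 : c * N <= #|X4|%:R by apply: minus (sZ 3%N isT) _ _.
(* The auxiliary fact [minus] removes two sets; one is enough here, so it is repeated. *)
pose X3 := Z (s + 2)%N :\: (low X6 :|: low X6).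
have s3 : c * N <= #|X3|%:R by apply: minus (sZ 2%N isT) _ _.
pose X2 := Z s.+1 :\: (low X4 :|: low X6).
have s2 : c * p * N <= #|X2|%:R.
  by rewrite -mulrA; apply: minus => //; [rewrite mulrA|apply: low0].
pose X1 := Z s :\: (low X2 :|: low X3).
have s1' : c * p ^+ 2 * N <= #|X1|%:R.
  by rewrite -mulrA; apply: minus => //; [rewrite mulrA|apply: low1|apply: low0].
have sub1 : X1 \subset Z (s + 0)%N by rewrite addn0 subsetDl.
have sub2 : X2 \subset Z (s + 1)%N by rewrite addn1 subsetDl.
have sub3 : X3 \subset Z (s + 2)%N by rewrite subsetDl.
have sub4 : X4 \subset Z (s + 3)%N by rewrite subsetDl.
have sub5 : X5 \subset Z (s + 4)%N by [].
have dd (A B : {set V}) i j : (i < j < 6)%N -> A \subset Z (s + i)%N -> B \subset Z (s + j)%N ->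
    [disjoint A & B].
  move=> ij sA sB; have := dZ i j ij; rewrite disjoint_sym => d; rewrite disjoint_sym.
  by apply: disjointWl sB _; rewrite disjoint_sym; apply: disjointWl sA _; rewrite disjoint_sym.
have [||||||v [W [vX WX cW hW]]] := @expand_square R V G p eta c pG eta0 c0 c1 N0 he a b X1 X2 X3 X4 X5 ba _ _ _ s1' s2 s3 s4 s5.
- by move=> x /setDP[xZ _]; apply: h0.
- by move=> x /setDP[xZ _]; apply: h1.
- by rewrite /= !andbT; do ![apply/andP; split]; [exact: (dd _ _ 0%N 1%N)|exact: (dd _ _ 0%N 2)
    |exact: (dd _ _ 0%N 3)|exact: (dd _ _ 0%N 4)|exact: (dd _ _ 1%N 2)|exact: (dd _ _ 1%N 3)
    |exact: (dd _ _ 1%N 4)|exact: (dd _ _ 2 3)|exact: (dd _ _ 2 4)|exact: (dd _ _ 3 4)].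
- by move=> x /setDP[_]; rewrite in_setU negb_or.
- by move=> x /setDP[_]; rewrite in_setU negb_or => /andP[].
- by move=> x /setDP[_]; rewrite in_setU negb_or => /andP[].
have lab x : x \in X1 :|: X2 :|: X3 :|: X4 :|: X5 -> exists2 i, i \in iota s 5 & x \in Z i.
  rewrite !in_setU -!orbA => /or4P[/(subsetP sub1)|/(subsetP sub2)|/(subsetP sub3)|/orP[/(subsetP sub4)|/(subsetP sub5)]] h;
    [exists (s + 0)%N|exists (s + 1)%N|exists (s + 2)%N|exists (s + 3)%N|exists (s + 4)%N] => //;
    rewrite mem_iota leq_addr ltn_add2l //.
exists v, W; split=> //.
- have : v \notin low X6.
    by move: vX; rewrite !in_setU => /orP[/orP[]|] /setDP[_]; rewrite in_setU negb_or => /andP[].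
  move=> /nlow h; apply: le_trans h.
  have h2 := sZ 5%N isT.
  have : p * (2 * c * N) <= p * #|X6|%:R by rewrite ler_pM2l.
  have : 0 <= c * p * N by rewrite !mulr_ge0 // ltW.
  lra.
- move=> w /(subsetP WX) h; apply: lab; move: h; rewrite !in_setU.
  by case/orP=> [/orP[]|] ->; rewrite ?orbT.
move=> w /hW[l [kl ul szl sl]]; exists l; split=> //.
move=> x; rewrite inE => /orP[/eqP->|/sl h]; apply: lab.
  by move: vX; rewrite !in_setU => /orP[/orP[]|] ->; rewrite ?orbT.
by move: h; rewrite !in_setU => ->.
Qed.

Lemma kpath2_mid (s : seq V) (x y x0 : V) : size s = 6 -> kpath G 2 s ->
  adj G x (nth x0 s 0) -> adj G x (nth x0 s 1) ->
  adj G y (nth x0 s 5) -> adj G y (nth x0 s 4) ->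
  kpath G 2 (y :: rev s ++ [:: x]).
Proof.
case: s => [|s0 [|s1 [|s2 [|s3 [|s4 [|s5 [|]]]]]]] // _; rewrite -kpath_rev.
rewrite -[rev _]/([:: s5; s4; s3; s2; s1; s0]) /= !andbT.
move=> h h0 h1 h5 h4; rewrite h5 h4 (adjC G s1 x) h1 (adjC G s0 x) h0.
by move: h; rewrite !andbT.
Qed.

End ConnectSquare.

(** Of the fourteen sets, six serve each side and two the middle. The grown sets of order p N at
    both ends give the exponents 1 1 0 0 1 1, which fit into p^3; the common neighbourhoods of order
    p^2 N would require p^4. The 56 in [c] is 28 from [disjoint_subsets] times 2 for the cleaning in
    [expand_side]. *)
Lemma connects_square (R : realType) (V : finType) (G : sgraph V) (p th eta : R) :
  let c := th / 8 ^+ 2 / 56 in let b := c / 32 in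
  0 < th -> th <= 1 -> 0 < eta ->
  pseudo G p (eta * p ^+ 3 * #|V|%:R ^+ 2) ->
  eta <= c ^+ 3 / 256 -> eta <= dB R 1 * (b * b) ->
  14 <= th / 8 ^+ 2 * p ^+ 2 * #|V|%:R -> connects G p th 1 14.
Proof.
move=> c b th0 th1 eta0 pG he he2 hN X f g sf sg kf kg gf gg.
have p0 := ps_gt0 pG; have p1 := ps_le1 pG.
set N : R := #|V|%:R in hN.
have N0 : 0 < N.
  rewrite lt_neqAle ler0n andbT eq_sym; apply/eqP => e; move: hN; rewrite e mulr0; lra.
have c0 : 0 < c by rewrite !divr_gt0 ?exprn_gt0.
have c1 : c <= 1 by rewrite /c; lra.
case: f sf kf gf => [|b1 [|a1 [|]]] // _ kf gf.
case: g sg kg gg => [|b2 [|a2 [|]]] // _ kg gg.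
have ba1 : adj G b1 a1 by move: kf; rewrite /= !andbT.
have ba2 : adj G b2 a2 by move: kg; rewrite /= !andbT.
pose Y i := if i == 0%N then cn G [:: b1; a1] X else if i == 1%N then cn G [:: b1] X
  else if i == 6 then cn G [:: b2; a2] X else if i == 7 then cn G [:: b2] X else X.
pose e i := if i == 0%N then 2 else if i == 1%N then 1%N
  else if i == 6 then 2 else if i == 7 then 1%N else 0%N.
have YX i : Y i \subset X by rewrite /Y; do ![case: ifP => _]; rewrite ?cn_sub.
have hY i : th / 8 ^+ 2 * p ^+ e i * N <= #|Y i|%:R.
  have gs l j : good G p th 2 1 X l -> (j <= 2)%N ->
      th / 8 ^+ 2 * p ^+ j * N <= #|cn G (take j l) X|%:R.
    by move=> gl jk; rewrite -[th]mul1r; apply: good_size.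
  rewrite /Y /e; do ![case: ifP => _].
  - exact: (gs _ 2 gf).
  - exact: (gs _ 1%N gf).
  - exact: (gs _ 2 gg).
  - exact: (gs _ 1%N gg).
  - by have := gs _ 0%N gf isT; rewrite take0.
have hY2 i : (i < 14)%N -> (14 <= #|Y i|)%N.
  move=> _; rewrite -(ler_nat R); apply: le_trans (le_trans hN _) (hY i).
  apply: ler_wpM2r => //; apply: ler_wpM2l; first by rewrite divr_ge0 ?exprn_ge0 // ltW.
  by apply: ler_wiXn2l; rewrite ?(ltW p0) // /e; do ![case: ifP => _].
have [Z [dZ ZY cZ]] := disjoint_subsets hY2.
have hZ i : (i < 14)%N -> 2 * c * p ^+ e i * N <= #|Z i|%:R.
  move=> i14; have -> : 2 * c * p ^+ e i * N = (th / 8 ^+ 2 * p ^+ e i * N) / 28%:R.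
    by rewrite /c; field.
  rewrite ler_pdivrMr //; apply: le_trans (hY i) _.
  by rewrite -natrM ler_nat mulnC; apply: cZ.
have dis s i j : (s + 6 <= 14)%N -> (i < j < 6)%N -> [disjoint Z (s + i)%N & Z (s + j)%N].
  by clear -dZ => h1 h2; apply: dZ; lia.
have sub i x : (i < 14)%N -> x \in Z i -> x \in Y i by move=> hi; apply: (subsetP (ZY i hi)).
have [||||||v1 [W1 [cW1 cA1 lW1 hW1]]] :=
  @expand_side R V G p eta c pG eta0 c0 c1 N0 he b1 a1 Z 0 ba1.
- by move=> x /(sub 0%N)-/(_ isT); rewrite in_cn /= andbT => /andP[].
- by move=> x /(sub 1%N)-/(_ isT); rewrite in_cn /= andbT => /andP[].
- by move=> i j; apply: dis.
- exact: (hZ 0%N).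
- by have := hZ 1%N isT; rewrite /e expr1.
- by move=> [|[|[|[|[|[|]]]]]] //= _; [have := hZ 2 isT|have := hZ 3 isT|have := hZ 4 isT|have := hZ 5 isT]; rewrite mulr1.
have [||||||v2 [W2 [cW2 cA2 lW2 hW2]]] :=
  @expand_side R V G p eta c pG eta0 c0 c1 N0 he b2 a2 Z 6 ba2.
- by move=> x /(sub 6)-/(_ isT); rewrite in_cn /= andbT => /andP[].
- by move=> x /(sub 7)-/(_ isT); rewrite in_cn /= andbT => /andP[].
- by move=> i j; apply: dis.
- exact: (hZ 6).
- by have := hZ 7 isT; rewrite /e expr1.
- by move=> [|[|[|[|[|[|]]]]]] //= _; [have := hZ 8 isT|have := hZ 9 isT|have := hZ 10 isT|have := hZ 11 isT]; rewrite mulr1.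
pose B i := nth set0 [:: W1; nbs G v1 (Z 5); Z 12; Z 13; nbs G v2 (Z 11); W2] i.
pose lb i : seq nat := nth [::] [:: iota 0 5; [:: 5]; [:: 12]; [:: 13]; [:: 11]; iota 6 5] i.
have labB i : (i < 6)%N -> labelled 14 Z (lb i) (mem (B i)).
  have one j (S : {set V}) : (j < 14)%N -> {subset S <= Z j} -> labelled 14 Z [:: j] (mem S).
    by move=> j14 SZ; split=> [|v /SZ h]; [rewrite /= j14|exists j; rewrite ?inE].
  case: i => [|[|[|[|[|[|]]]]]] // _.
  - by apply: one => // v; rewrite in_nbs => /andP[].
  - exact: one.
  - exact: one.
  - by apply: one => // v; rewrite in_nbs => /andP[].
have dB6 : pdisj (3 * 2) B.
  move=> i j /andP[ij j6].
  apply: (labelled_disjoint dZ (labB i (ltn_trans ij j6)) (labB j j6)).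
  by case: i ij => [|[|[|[|[|[|]]]]]]; case: j j6 => [|[|[|[|[|[|]]]]]].
pose e6 i := nth 0%N [:: 1; 1; 0; 0; 1; 1]%N i.
have b0 : 0 < b by rewrite divr_gt0.
have hB i : (i < 3 * 2)%N -> b * p ^+ e6 i * N <= #|B i|%:R.
  have cb y z : 2 * c * p ^+ 0 * N <= y -> y = z -> b * p ^+ 0 * N <= z.
    move=> h <-; apply: le_trans h; rewrite /b expr0.
    by have : 0 <= c * N; [rewrite mulr_ge0 // ltW|lra].
  case: i => [|[|[|[|[|[|]]]]]] // _; rewrite /B /e6 /= ?expr1 //.
  - exact: (cb _ _ (hZ 12 isT)).
  - exact: (cb _ _ (hZ 13 isT)).
have B0 i : (i < 3 * 2)%N -> 0 < #|B i|%:R :> R.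
  by move=> hi; apply: lt_le_trans (hB i hi); do ![apply: mulr_gt0 => //]; apply: exprn_gt0.
have e6r i : (i < 3 * 2)%N -> e6 (3 * 2 - i.+1)%N = e6 i.
  by case: i => [|[|[|[|[|[|]]]]]].
have hS j : (j <= 1)%N ->
    [/\ forall m i, (m < i <= 1)%N -> (e6 (j + m.+1) + e6 (j + i.+1) + (1 + m) <= 3)%N,
        forall m, (m < 1)%N -> (e6 (j + m.+1) + e6 j + (1 + m) <= 3)%N
      & (e6 j + e6 (j + 2) + (1 + 1) <= 3)%N].
  by case: j => [|[|]] // _; (split; [by case=> [|m] [|[|i]]; rewrite ?andbF|by case|by []]).
have ch1 := chain_condI (ltW eta0) pG (ltW b0) hB he2 hS.
have hB' i : (i < 3 * 2)%N -> b * p ^+ e6 i * N <= #|B (3 * 2 - i.+1)%N|%:R.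
  by move=> hi; rewrite -(e6r i hi); apply: hB; clear -hi; lia.
have ch2 := chain_condI (ltW eta0) pG (ltW b0) hB' he2 hS.
have [s [ss ks sB]] := blowup pG b1 dB6 B0 ch1 ch2.
have us := sets_uniq dB6 ss sB.
have sB5 i (hi : (i < 6)%N) := sB i hi.
have [l1 [kl1 ul1 sl1 ll1]] := hW1 _ (sB5 0%N isT).
have [l2 [kl2 ul2 sl2 ll2]] := hW2 _ (sB5 5 isT).
have : nth b1 s 1 \in nbs G v1 (Z 5) := sB5 1%N isT.
rewrite in_nbs => /andP[_ a11].
have : nth b1 s 4 \in nbs G v2 (Z 11) := sB5 4 isT.
rewrite in_nbs => /andP[_ a24].
have a10 : adj G v1 (nth b1 s 0) by case/andP: kl1; rewrite adjC => /andP[].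
have a25 : adj G v2 (nth b1 s 5) by case/andP: kl2; rewrite adjC => /andP[].
have kmid := kpath2_mid ss ks a10 a11 a25 a24.
case: s ss ks sB us sB5 kl1 ul1 kl2 ul2 a11 a24 a10 a25 kmid =>
  [|s0 [|s1 [|s2 [|s3 [|s4 [|s5 [|]]]]]]] // _ ks sB us sB5 kl1 ul1 kl2 ul2 _ _ _ _ kmid.
pose L := s0 :: v1 :: l1; pose Q := s5 :: v2 :: l2.
(* At most 3 + 1 + 6 + 1 + 3 = 14 vertices: the chain found by [blowup] between the two grown
   sides. *)
exists (rev l2 ++ v2 :: [:: s5; s4; s3; s2; s1; s0] ++ v1 :: l1).
have labL : labelled 14 Z (iota 0 5) (mem L).
  split=> // v; rewrite [_ \in _]inE => /orP[/eqP->|]; last exact: ll1.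
  exact: lW1 (sB5 0%N isT).
have labQ : labelled 14 Z (iota 6 5) (mem Q).
  split=> // v; rewrite [_ \in _]inE => /orP[/eqP->|]; last exact: ll2.
  exact: lW2 (sB5 5 isT).
have labM : labelled 14 Z [:: 5; 12; 13; 11] (mem [:: s1; s2; s3; s4]).
  split=> // v; rewrite [_ \in _]inE => /orP[/eqP->|].
    by exists 5 => //; have : s1 \in nbs G v1 (Z 5) := sB5 1%N isT; rewrite in_nbs => /andP[].
  rewrite inE => /orP[/eqP->|]; first by exists 12 => //; exact: (sB5 2 isT).
  rewrite inE => /orP[/eqP->|]; first by exists 13 => //; exact: (sB5 3 isT).
  rewrite inE => /eqP->; exists 11 => //.
  by have : s4 \in nbs G v2 (Z 11) := sB5 4 isT; rewrite in_nbs => /andP[].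
have nh (l l' : seq V) m m' : labelled 14 Z m (mem l) -> labelled 14 Z m' (mem l') ->
    ~~ has (mem m) m' -> ~~ has (mem l) l'.
  move=> h1 h2 h3; apply/hasPn => v vl'; apply/negP => vl.
  exact: (labelled_disj dZ h1 h2 h3 vl vl').
have inX m (l : seq V) : labelled 14 Z m (mem l) -> {subset l <= X}.
  move=> [/allP hm h] v vl; have [i im vi] := h v vl.
  by apply: (subsetP (YX i)); apply: sub vi; apply: hm.
have pc : perm_eq (rev l2 ++ v2 :: [:: s5; s4; s3; s2; s1; s0] ++ v1 :: l1)
    (Q ++ L ++ [:: s1; s2; s3; s4]).
  by apply/permP => P; rewrite /Q /L !(count_cat, count_rev) /=; clear; lia.
split.
- by rewrite size_cat size_rev /=; clear -sl1 sl2; lia.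
- rewrite (perm_uniq pc) !cat_uniq ul1 ul2 has_cat negb_or.
  rewrite (nh _ _ _ _ labQ labL) // (nh _ _ _ _ labQ labM) // (nh _ _ _ _ labL labM) //.
  move: us; rewrite -[[:: s0; _; _; _; _; _]]/([:: s0] ++ [:: s1; s2; s3; s4] ++ [:: s5]).
  by rewrite !cat_uniq => /and3P[_ _ /andP[]].
- move=> v; rewrite (perm_mem pc) !mem_cat.
  by case/or3P; [apply: inX labQ v|apply: inX labL v|apply: inX labM v].
have -> : rev [:: b2; a2] ++ (rev l2 ++ v2 :: [:: s5; s4; s3; s2; s1; s0] ++ v1 :: l1) ++ [:: b1; a1]
  = (rev [:: b2; a2] ++ rev l2) ++ [:: v2; s5] ++ ([:: s4; s3; s2; s1; s0; v1] ++ l1 ++ [:: b1; a1]).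
  by rewrite -!catA.
apply: kpath_glue => //.
  have : kpath G 2 (rev [:: s5, v2 & l2 ++ [:: b2; a2]]) by rewrite kpath_rev.
  by rewrite !rev_cons rev_cat -!cats1 -!catA.
have -> : [:: v2; s5] ++ ([:: s4; s3; s2; s1; s0; v1] ++ l1 ++ [:: b1; a1])
  = [:: v2; s5; s4; s3; s2; s1] ++ [:: s0; v1] ++ (l1 ++ [:: b1; a1]) by [].
exact: kpath_glue.
Qed.

(** * Pieces that contain or absorb a given vertex *)

Section Grow.
Variables (R : realType) (V : finType) (G : sgraph V) (p th K : R) (k : nat).
Hypothesis pG : pseudo G p K.
Local Notation N := (#|V|%:R : R).
Local Notation nbs := (nbs G).
Local Notation cn := (cn G).
Implicit Types (X Y D A : {set V}) (f b l s : seq V) (t : R).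
Hypotheses (k0 : (0 < k)%N) (th0 : 0 < th).

Let p0 : 0 < p. Proof. exact: ps_gt0 pG. Qed.
Let p1 : p <= 1. Proof. exact: ps_le1 pG. Qed.

(** A vertex outside all low sets keeps a fraction p/4 of each common neighbourhood, while [good]
    asks for p/8. This raises the constant from 1 to 2, and [good_shrink] spends the surplus. *)
Lemma extend Y (F : seq (R * {set V} * seq V)) : (0 < #|Y|)%N ->
  (forall t X f, (t, X, f) \in F -> [/\ 0 < t, good G p t k 1 X f,
     2 * t * N <= #|X|%:R &
     (size F * k)%:R * K < #|Y|%:R * (t * (p / 8) ^+ k.-1 * N)]) ->
  exists2 x, x \in Y & forall t X f, (t, X, f) \in F -> good G p t k 2 X (x :: f).
Proof.
move=> Y0 hF.
pose Zs := [seq cn (take i u.2) u.1.2 | u <- F, i <- iota 0 k].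
have sZs : size Zs = (size F * k)%N by rewrite size_allpairs size_iota.
have [Z|x xY hx] := pick pG Y0 (Zs := Zs).
  case/allpairsP => -[[[t X] f] i] /= [uF]; rewrite mem_iota add0n => /andP[_ ik] ->.
  have [t0 gf _ h] := hF _ _ _ uF; rewrite sZs; apply: (lt_le_trans h).
  rewrite ler_pM2l ?ltr0n //.
  have := gf i (ltnW ik); rewrite mul1r; apply: le_trans.
  apply: ler_wpM2r => //; apply: ler_wpM2l; first exact: ltW.
  apply: ler_wiXn2l.
  - by rewrite divr_ge0 // ltW.
  - by move: p0 p1; lra.
  - by rewrite -ltnS prednK.
exists x => // t X f uF; have [t0 gf hX _] := hF _ _ _ uF.
case=> [_|i ik]; first by rewrite take0 expr0 mulr1.
rewrite /=; have iZ : cn (take i f) X \in Zs.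
  by apply/allpairsP; exists ((t, X, f), i) => /=; rewrite mem_iota add0n.
apply: le_trans (nlow (hx _ iZ)).
have := gf i (ltnW ik); rewrite mul1r => h.
have -> : 2 * t * (p / 8) ^+ i.+1 * N = p / 4 * (t * (p / 8) ^+ i * N).
  by rewrite exprS; field.
by rewrite ler_pM2l // divr_gt0.
Qed.

Lemma good_nil t c X : 0 < t -> 0 <= c -> c * t * N <= #|X|%:R -> good G p t k c X [::].
Proof.
move=> t0 c0 hX i _; apply: le_trans hX; rewrite -mulrA [X in _ <= X]mulrC [N * _]mulrC.
rewrite mulrA ler_wpM2r // ler_piMr //; first by rewrite mulr_ge0 // ltW.
by apply: exprn_ile1; move: p0 p1; lra.
Qed.

Lemma good_take t c X f : good G p t k c X f -> good G p t k c X (take k f).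
Proof. by move=> gf i ik; rewrite take_takel //; apply: gf. Qed.

(** [X0] supplies the new vertices, at a density [t] that may be smaller than [th]; [Xs] are the
    sets in which the result must be extendable. Recording [drop (m - j) l], the j vertices added
    first, also makes the reversed end available, since [cn] ignores the order. *)
Lemma grow X0 D t base (Xs : seq {set V}) m : 0 < t ->
  kpath G k base -> good G p t k 1 X0 base -> 2 * t * N <= #|X0|%:R ->
  {in Xs, forall X, 2 * th * N <= #|X|%:R} ->
  2 * (#|D| + m)%:R < t * (p / 8) ^+ k * N ->
  2 * ((size Xs).+1 * k)%:R * K <= t * (p / 8) ^+ k * N * (t * (p / 8) ^+ k.-1 * N) ->
  2 * ((size Xs).+1 * k)%:R * K <= t * (p / 8) ^+ k * N * (th * (p / 8) ^+ k.-1 * N) ->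
  exists l, [/\ size l = m, uniq l, {subset l <= X0 :\: D}, kpath G k (l ++ base) &
    [/\ forall j, (j <= m)%N -> good G p t k 1 X0 (drop (m - j) l ++ base) &
     {in Xs, forall X j, (j <= m)%N -> good G p th k 2 X (drop (m - j) l)}]].
Proof.
move=> t0 kb gb hX0 hXs hD hK1 hK2.
have p80 : 0 < p / 8 by rewrite divr_gt0.
elim: m hD => [|m IH] hD.
  exists [::]; split=> //; split=> [j|X XXs j]; rewrite leqn0 => /eqP-> //.
  by apply: good_nil => //; apply: hXs.
have [|l [sl ul lX kl [gl1 gl2]]] := IH.
  by apply: le_lt_trans hD; rewrite ler_wpM2l // ler_nat addnS leqnSn.
pose Y := cn (take k (l ++ base)) X0 :\: (D :|: [set x in l]).
have gX0 : good G p t k 1 X0 (l ++ base).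
  by have := gl1 m (leqnn _); rewrite subnn drop0.
have cY : t * (p / 8) ^+ k * N / 2 < #|Y|%:R.
  have h := card_minus R (cn (take k (l ++ base)) X0) (D :|: [set x in l]).
  have h1 : #|D :|: [set x in l]|%:R <= (#|D| + m.+1)%:R :> R.
    rewrite ler_nat; apply: leq_trans (_ : #|D| + #|[set x in l]| <= _)%N.
      by rewrite cardsU leq_subr.
    by rewrite leq_add2l cardsE -sl (leq_trans (card_size _)) // leqnSn.
  have := gX0 k (leqnn _); rewrite mul1r.
  rewrite -/Y in h; move: hD h h1; lra.
have Y0 : (0 < #|Y|)%N.
  rewrite -(ltr0n R); apply: le_lt_trans cY.
  by rewrite divr_ge0 // !mulr_ge0 ?exprn_ge0 // ltW.
have y2 : t * (p / 8) ^+ k * N < 2 * #|Y|%:R by move: cY; lra.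
have tail0 u : 0 < u -> 0 < N -> 0 < u * (p / 8) ^+ k.-1 * N.
  by move=> u0 N0; rewrite !mulr_gt0 ?exprn_gt0.
have N0 : 0 < N.
  by rewrite ltr0n; apply: leq_trans Y0 (max_card _).
have kY u : 0 < u -> 2 * ((size Xs).+1 * k)%:R * K
     <= t * (p / 8) ^+ k * N * (u * (p / 8) ^+ k.-1 * N) ->
    ((size Xs).+1 * k)%:R * K < #|Y|%:R * (u * (p / 8) ^+ k.-1 * N).
  move=> u0 h; have : t * (p / 8) ^+ k * N * (u * (p / 8) ^+ k.-1 * N)
      < 2 * #|Y|%:R * (u * (p / 8) ^+ k.-1 * N) by rewrite ltr_pM2r // tail0.
  move: h; lra.
pose F := (t, X0, l ++ base) :: [seq (th, X, l) | X <- Xs].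
have [|x xY hx] := @extend Y F Y0.
  move=> u X f; rewrite /= size_map inE => /orP[/eqP[-> -> ->]|/mapP[Z ZXs [-> -> ->]]].
    by split=> //; apply: kY.
  split=> //; [|exact: hXs|exact: kY].
  apply: (good_le p0 th0 (c' := 2)) (subxx _) _; first by rewrite ler01 /=; lra.
  by have := gl2 Z ZXs m (leqnn _); rewrite subnn drop0.
move: xY; rewrite in_setD in_setU inE negb_or in_cn => /andP[/andP[xD xl] /andP[xX xa]].
exists (x :: l); split=> /=.
- by rewrite sl.
- by rewrite xl.
- by move=> y; rewrite inE => /orP[/eqP->|/lX//]; rewrite in_setD xD.
- by rewrite xa.
split=> [j|X XXs j].
  rewrite leq_eqVlt => /orP[/eqP->|]; last first.
    by rewrite ltnS => jm; rewrite subSn //=; apply: gl1.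
  rewrite subnn /=; apply: (good_le p0 t0 (c' := 2)) (subxx _) _; first by rewrite ler01 /=; lra.
  by apply: hx; rewrite inE eqxx.
rewrite leq_eqVlt => /orP[/eqP->|]; last first.
  by rewrite ltnS => jm; rewrite subSn //=; apply: gl2.
by rewrite subnn /=; apply: hx; rewrite inE; apply/orP; right; apply/mapP; exists X.
Qed.

(** The ends do not depend on [W], so flexible paths can be joined before it is known which vertices
    of [F] are needed elsewhere. *)
Definition flex f b A (F : {set V}) : Prop :=
  [/\ size f = k, size b = k, [disjoint A & F] &
   forall W : {set V}, W \subset F -> exists s, [/\ uniq s, s =i A :|: W,
     kpath G k s, take k s = f & take k (rev s) = b]].

(** With [absorb] the vertex [v] is optional and the piece itself avoids it; otherwise the piece
    contains [v]. No stage of the assembly tracks more than four sets. *)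
Definition piece_maker (T : nat) (absorb : bool) : Prop :=
  forall X0 (Xs : seq {set V}) v, X0 \in Xs -> (size Xs <= 4)%N ->
  {in Xs, forall X, 2 * th * N <= #|X|%:R} -> v \notin X0 ->
  2 * th * (p / 8) * N <= #|nbs v X0|%:R ->
  exists f b A, [/\ flex f b A (if absorb then [set v] else set0),
    A \subset (if absorb then X0 else v |: X0),
    absorb || (v \in A), (#|A| <= T)%N &
    {in Xs, forall X, good G p th k 2 X f /\ good G p th k 2 X b}].

(** The path grows from [v] on one side and then, with [v :: rev l] as base, on the other. *)
Lemma plain_pieces : 2 * (3 * k)%:R < th * (p / 8) ^+ k * N ->
  2 * (5 * k)%:R * K <= th * (p / 8) ^+ k * N * (th * (p / 8) ^+ k.-1 * N) ->
  piece_maker (2 * k + 1) false.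
Proof.
move=> hT hK X0 Xs v X0Xs sXs hXs vX0 hv.
have p80 : 0 < p / 8 by rewrite divr_gt0.
have p81 : p / 8 <= 1 by move: p1; lra.
have N0 : 0 <= N by [].
have hK' : 2 * ((size Xs).+1 * k)%:R * K <= th * (p / 8) ^+ k * N * (th * (p / 8) ^+ k.-1 * N).
  apply: le_trans hK; apply: ler_wpM2r; first exact: pseudo_K_ge0 pG.
  by rewrite ler_wpM2l // ler_nat leq_mul2r ltnS sXs orbT.
have k3 j : (j <= 2 * k)%N -> (j + k <= 3 * k)%N.
  by move=> h; rewrite (leq_trans (leq_add h (leqnn k))) // -mulSnr.
(* For every i >= 1 the only constraint comes from [v], so its degree into [X0] suffices. *)
have g1 : good G p th k 1 X0 [:: v].
  move=> [|i] ik; first by rewrite take0 /= expr0; move: (hXs _ X0Xs); have := mulr_ge0 (ltW th0) N0; lra.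
  rewrite /= /=; apply: le_trans (_ : th * (p / 8) * N <= _); last first.
    by move: hv; have := mulr_ge0 (mulr_ge0 (ltW th0) (ltW p80)) N0; lra.
  rewrite mul1r ler_wpM2r // ler_wpM2l ?(ltW th0) // exprS ler_piMr ?(ltW p80) //.
  by rewrite exprn_ile1 // ltW.
have [||l [sl ul lX kl [gl1 gl2]]] := @grow X0 set0 th [:: v] Xs k th0 _ g1 (hXs _ X0Xs) hXs _ hK' hK'.
- by [].
- by apply: le_lt_trans hT; rewrite ler_wpM2l // ler_nat cards0 k3.
have kvl : kpath G k (v :: rev l) by rewrite -kpath_rev rev_cons revK -cats1.
have g2 : good G p th k 1 X0 (v :: rev l).
  move=> [|i] ik; first by have := g1 0%N ik; rewrite !take0.
  have := gl1 i (ltnW ik) i.+1 ik; rewrite take_oversize; last first.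
    by rewrite size_cat size_drop sl /= subKn ?addn1 // ltnW.
  rewrite (@eq_cn _ _ _ (take i.+1 (v :: rev l))) // => y.
  by rewrite /= mem_cat inE orbC in_cons take_rev sl mem_rev.
have [|l' [sl' ul' lX' kl' [gl1' gl2']]] := @grow X0 [set x in l] th (v :: rev l) Xs k th0 kvl g2 (hXs _ X0Xs) hXs _ hK' hK'.
- apply: le_lt_trans hT; rewrite ler_wpM2l // ler_nat cardsE k3 //.
  by rewrite (leq_trans (card_size _)) // sl leq_pmull.
have lX0 x : x \in l -> x \in X0 by move/lX; rewrite in_setD => /andP[].
have lX0' x : x \in l' -> (x \in X0) && (x \notin l).
  by move/lX'; rewrite in_setD inE andbC.
have uM : uniq (l' ++ v :: rev l).
  rewrite cat_uniq ul' /= mem_rev rev_uniq ul negb_or -!andbA /=.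
  apply/and3P; split; first by apply/negP => /lX0'; rewrite (negbTE vX0).
    by apply/hasPn => x; rewrite mem_rev => xl; apply/negP => /lX0'; rewrite xl andbF.
  by rewrite andbT; apply/negP => /lX0; rewrite (negbTE vX0).
exists l', l, [set x in l' ++ v :: rev l]; split.
- split=> //; first by rewrite disjoint_sym -setI_eq0 set0I.
  move=> W; rewrite subset0 => /eqP->; exists (l' ++ v :: rev l); split=> //.
  + by move=> y; rewrite setU0 inE.
  + by rewrite take_cat sl' ltnn subnn take0 cats0.
  + by rewrite rev_cat rev_cons revK cat_rcons take_cat sl ltnn subnn take0 cats0.
- apply/subsetP => x; rewrite !inE mem_cat inE mem_rev.
  by case/or3P=> [/lX0'/andP[->]|->|/lX0->]; rewrite ?orbT.
- by rewrite inE mem_cat inE eqxx orbT.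
- by rewrite cardsE (card_uniqP uM) size_cat /= size_rev sl sl' addnS addn1 mul2n addnn.
move=> X XXs; split.
  by have := gl2' X XXs k (leqnn _); rewrite subnn drop0.
by have := gl2 X XXs k (leqnn _); rewrite subnn drop0.
Qed.

(** A path of 2k vertices inside the neighbourhood of [v] can take [v] into its middle. Working
    there replaces [th] by [t], smaller by a factor p/8, which raises both exponents by one. *)
Lemma absorbing_pieces : 4 * k%:R < th * (p / 8) ^+ k.+1 * N ->
  2 * (5 * k)%:R * K <= th * (p / 8) ^+ k.+1 * N * (th * (p / 8) ^+ k * N) ->
  piece_maker (2 * k) true.
Proof.
move=> hT hK X0 Xs v X0Xs sXs hXs vX0 hv.
have p80 : 0 < p / 8 by rewrite divr_gt0.
have p81 : p / 8 <= 1 by move: p1; lra.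
have N0 : 0 <= N by [].
pose t := th * (p / 8); have t0 : 0 < t by rewrite mulr_gt0.
have tth : t <= th by rewrite /t ler_piMr // ltW.
have tk : t * (p / 8) ^+ k * N = th * (p / 8) ^+ k.+1 * N by rewrite /t exprS; ring.
have tk1 : t * (p / 8) ^+ k.-1 * N = th * (p / 8) ^+ k * N.
  have -> : (p / 8) ^+ k = p / 8 * (p / 8) ^+ k.-1 by rewrite -{1}(prednK k0) exprS.
  by rewrite /t; ring.
have Kk : 2 * ((size Xs).+1 * k)%:R * K <= t * (p / 8) ^+ k * N * (t * (p / 8) ^+ k.-1 * N).
  rewrite tk tk1; apply: le_trans hK; apply: ler_wpM2r; first exact: pseudo_K_ge0 pG.
  by rewrite ler_wpM2l // ler_nat leq_mul2r ltnS sXs orbT.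
have Kk2 : 2 * ((size Xs).+1 * k)%:R * K <= t * (p / 8) ^+ k * N * (th * (p / 8) ^+ k.-1 * N).
  apply: (le_trans Kk); apply: ler_wpM2l.
    by apply: mulr_ge0 => //; apply: mulr_ge0; [exact: ltW|rewrite exprn_ge0 // ltW].
  by apply: ler_wpM2r => //; apply: ler_wpM2r => //; rewrite exprn_ge0 // ltW.
have hv' : 2 * t * N <= #|nbs v X0|%:R by apply: le_trans hv; rewrite /t; lra.
have [|||l [sl ul lX kl [gl1 gl2]]] := @grow (nbs v X0) set0 t [::] Xs (2 * k) t0 _ _ hv' hXs _ Kk Kk2.
- by [].
- by apply: good_nil => //; have := mulr_ge0 (ltW t0) N0; move: hv'; lra.
- by rewrite tk; apply: le_lt_trans hT; rewrite cards0 add0n natrM mulrA -natrM.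
have lX0 x : x \in l -> (x \in X0) && adj G v x.
  by move/lX; rewrite in_setD in_nbs => /andP[_].
rewrite cats0 in kl.
have vl : v \notin l by apply/negP => /lX0; rewrite (negbTE vX0).
have st : size (take k l) = k by rewrite size_takel // sl leq_pmull.
have sd : size (drop k l) = k by rewrite size_drop sl mulSn mul1n addnK.
have tl : take k (rev l) = rev (drop k l).
  by rewrite take_rev sl mulSn mul1n addnK.
exists (take k l), (rev (drop k l)), [set x in l]; split.
- split=> //; first by rewrite size_rev.
    by rewrite disjoint_sym disjoints1 inE.
  move=> W; rewrite subset1 => /orP[]/eqP->; last first.
    by exists l; split=> // y; rewrite setU0 inE.
  exists (take k l ++ v :: drop k l).
  have pm : perm_eq (take k l ++ v :: drop k l) (v :: l).
    by rewrite -cat1s perm_catCA cat_take_drop.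
  split.
  + by rewrite (perm_uniq pm) /= vl.
  + by move=> y; rewrite (perm_mem pm) !inE orbC.
  + apply: kpath_insert; rewrite cat_take_drop //.
    by apply/allP => x /lX0/andP[].
  + by rewrite take_cat st ltnn subnn take0 cats0.
  + by rewrite rev_cat rev_cons cat_rcons take_cat size_rev sd ltnn subnn take0 cats0.
- by apply/subsetP => x; rewrite inE => /lX0/andP[].
- by [].
- by rewrite cardsE (leq_trans (card_size _)) // sl.
move=> X XXs; split.
  by apply: good_take; have := gl2 X XXs _ (leqnn _); rewrite subnn drop0.
rewrite -tl; apply: good_take => i ik.
have ik2 : (i <= 2 * k)%N by rewrite (leq_trans ik) // leq_pmull.
have := gl2 X XXs i ik2 i ik.
by rewrite take_oversize ?size_drop ?sl ?subKn // take_rev sl cn_rev.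
Qed.

End Grow.

(** * Absorbers for squares *)

Section Zigzag.
Variables (R : realType) (V : finType) (G : sgraph V) (p eta : R) (S : nat).
Local Notation N := (#|V|%:R : R).
Local Notation K := (eta * p ^+ S * N ^+ 2).
Hypothesis pG : pseudo G p K.
Local Notation nbs := (nbs G).
Local Notation low := (lowset G p).
Implicit Types (A X Y Z : {set V}) (Zs Xs : seq {set V}) (c : R).

Let p0 : 0 < p. Proof. exact: ps_gt0 pG. Qed.
Let p1 : p <= 1. Proof. exact: ps_le1 pG. Qed.

(** A version of [pick] in which only exponents have to be compared. *)
Lemma pick_sizes c e Y Zs : 0 < c -> 0 < N -> c * p ^+ e * N <= #|Y|%:R ->
  (forall Z, Z \in Zs -> exists2 e', (e + e' <= S)%N & c * p ^+ e' * N <= #|Z|%:R) ->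
  (size Zs)%:R * eta < c * c ->
  exists2 x, x \in Y & forall Z, Z \in Zs -> x \notin low Z.
Proof.
move=> c0 N0 hY hZ hm; apply: (pick pG).
  by rewrite -(ltr0n R); apply: lt_le_trans hY; rewrite !mulr_gt0 ?exprn_gt0.
move=> Z /hZ[e' he hc].
have h1 : (c * p ^+ e * N) * (c * p ^+ e' * N) <= #|Y|%:R * #|Z|%:R.
  by apply: ler_pM => //; rewrite !mulr_ge0 ?exprn_ge0 ?(ltW p0) ?(ltW c0) ?(ltW N0).
apply: lt_le_trans h1.
have -> : c * p ^+ e * N * (c * p ^+ e' * N) = c * c * (p ^+ (e + e') * N ^+ 2).
  by rewrite exprD; ring.
have -> : (size Zs)%:R * K = (size Zs)%:R * eta * (p ^+ S * N ^+ 2) by ring.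
apply: (@lt_le_trans _ _ (c * c * (p ^+ S * N ^+ 2))).
  by rewrite ltr_pM2r // mulr_gt0 ?exprn_gt0.
rewrite ler_wpM2l ?mulr_ge0 ?(ltW c0) // ler_wpM2r ?exprn_ge0 ?(ltW N0) //.
by rewrite ler_wiXn2l // ltW.
Qed.

Lemma low_size c e Z : 0 < c -> 0 < N -> (e <= S)%N -> c * p ^+ e * N <= #|Z|%:R ->
  #|low Z|%:R <= eta / c * p ^+ (S - e) * N.
Proof.
move=> c0 N0 eS hZ; have -> : eta / c * p ^+ (S - e) * N = K / (c * p ^+ e * N).
  rewrite -{2}(subnK eS) exprD; field.
  by rewrite !gt_eqF ?exprn_gt0.
by apply: (low_le pG) hZ; rewrite !mulr_gt0 ?exprn_gt0.
Qed.

Definition avoid A Zs : {set V} := [set x in A | all (fun Z => x \notin low Z) Zs].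

Lemma in_avoid A Zs x :
  (x \in avoid A Zs) = (x \in A) && all (fun Z => x \notin low Z) Zs.
Proof. by rewrite in_set. Qed.

Lemma card_avoid A Zs (y : R) : (forall Z, Z \in Zs -> #|low Z|%:R <= y) ->
  #|A|%:R - (size Zs)%:R * y <= #|avoid A Zs|%:R.
Proof.
elim: Zs => [|Z Zs IH] h.
  by rewrite mul0r subr0 ler_nat subset_leq_card //; apply/subsetP => x; rewrite in_avoid andbT.
have h1 : #|A|%:R - (size Zs)%:R * y <= #|avoid A Zs|%:R.
  by apply: IH => Z' hZ'; apply: h; rewrite inE hZ' orbT.
have h2 := h Z (mem_head _ _).
have := card_minus R (avoid A Zs) (low Z).
have -> : avoid A Zs :\: low Z = avoid A (Z :: Zs).
  by apply/setP => x; rewrite in_setD !in_avoid /= andbCA.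
rewrite -[size (Z :: Zs)]addn1 natrD mulrDl mul1r; lra.
Qed.

End Zigzag.

Section SquareAbsorber.
Variables (R : realType) (V : finType) (G : sgraph V) (p th eta cc : R).
Local Notation N := (#|V|%:R : R).
Local Notation K := (eta * p ^+ 3 * N ^+ 2).
Hypothesis pG : pseudo G p K.
Local Notation nbs := (nbs G).
Local Notation low := (lowset G p).
Variable Xs : seq {set V}.
Let ka : R := cc / 32.
Hypotheses (eta0 : 0 < eta) (c0 : 0 < cc) (hcc : cc <= 1 / 96) (N0 : 0 < N).
Hypotheses (hcth : 96 * cc <= th) (he : eta <= ka ^+ 3).
Hypotheses (hXs : {in Xs, forall X : {set V}, 2 * th * N <= #|X|%:R}) (sXs : (size Xs <= 4)%N).
Implicit Types (A B X Y Z S T : {set V}).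

Definition front_sets (s : V) : seq {set V} := Xs ++ [seq nbs s X | X <- Xs].

(* [t; s] is an end of a path that can be extended in every set of [Xs]. *)
Definition gfront (s t : V) : bool :=
  all (fun X => s \notin low X) Xs && all (fun Z => t \notin low Z) (front_sets s).

Lemma gfront_good s t X : gfront s t -> X \in Xs -> good G p th 2 2 X [:: t; s].
Proof.
have p0 := ps_gt0 pG; move: (N0) (hcth) (c0) => N0' hcth' c0'.
case/andP=> /allP h1 /allP h2 XXs.
have h3 := nlow (h1 X XXs).
have h4 : t \notin low X by apply: h2; rewrite mem_cat XXs.
have h5 : t \notin low (nbs s X) by apply: h2; rewrite mem_cat map_f ?orbT.
have h6 := hXs XXs.
have tN : 0 <= th * N by rewrite mulr_ge0 // ltW //; lra.
move=> [|[|[|]]] //= _; first by rewrite expr0 mulr1.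
  apply: le_trans (nlow h4).
  have : p / 4 * (2 * th * N) <= p / 4 * #|X|%:R by rewrite ler_pM2l // divr_gt0.
  have : 0 <= p * (th * N) by rewrite mulr_ge0 // ltW.
  rewrite expr1; lra.
apply: le_trans (nlow h5).
have : p / 4 * (2 * th * N) <= p / 4 * #|X|%:R by rewrite ler_pM2l // divr_gt0.
have h7 : p / 4 * (p / 4 * #|X|%:R) <= p / 4 * #|nbs s X|%:R by rewrite ler_pM2l // divr_gt0.
move=> h8; have : p / 4 * (p / 4 * (2 * th * N)) <= p / 4 * (p / 4 * #|X|%:R).
  by rewrite ler_pM2l // divr_gt0.
have : 0 <= p * p * (th * N) by apply: mulr_ge0 => //; rewrite mulr_ge0 // ltW.
rewrite expr2; lra.
Qed.

(** The pair z, w can follow u1, u2 as well as q, y, and q, y can also be followed by x. The fronts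
    [w; z] and [q; y] are the ends from which connecting paths will start. *)
Definition zigzag (u1 u2 : V) S1 T1 T2 (y x : V) : bool :=
  [exists z in S1, exists w in T1, exists q in T2,
    [&& adj G z u1, adj G z u2, adj G w u2, adj G w z, adj G w y, adj G y z,
        adj G q z, adj G q y, adj G q x, gfront z w & gfront y q]].

Lemma ka_facts : [/\ 0 < ka, ka <= 1, 20 * eta < ka * ka, eta / ka <= ka ^+ 2 &
  cc = 32 * ka].
Proof.
move: (c0) (hcc) (he) => c0' hcc' he'.
have k0 : 0 < ka by rewrite divr_gt0.
have kc : cc = 32 * ka by rewrite /ka; field.
have k1 : ka <= 1 / 3072 by rewrite /ka; lra.
split=> //; first lra.
  apply: (@le_lt_trans _ _ (20 * ka ^+ 3)); first by rewrite ler_pM2l.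
  rewrite !exprS expr0 mulr1 mulrA -[X in _ < X]mul1r ltr_pM2r ?mulr_gt0 //; lra.
by rewrite ler_pdivrMr // -exprSr.
Qed.

(** If the set [B] of bad [y] had linear size, [z] could be chosen first, with many neighbours in
    [B], and then [y] among these neighbours. In this order the exponents of all pairs compared add
    up to at most 3. *)
Lemma zigzag_few (u1 u2 : V) S1 T1 S2 T2 S3 :
  (cc / 16) * p ^+ 2 * N <= #|cn G [:: u1; u2] S1|%:R ->
  (cc / 4) * p * N <= #|nbs u2 T1|%:R ->
  cc * N <= #|T2|%:R ->
  #|[set y in S2 | ka ^+ 2 * p * N <
       #|[set x in nbs y S3 | ~~ zigzag u1 u2 S1 T1 T2 y x]|%:R]|%:R < cc / 2 * N.
Proof.
move=> hS1 hT1 hT2; set B := [set y in S2 | _].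
have p0 := ps_gt0 pG; have p1 := ps_le1 pG.
have [k0 k1 ke ke2 kc] := ka_facts; clearbody ka.
move: (N0) (hcth) (c0) (eta0) => N0' hcth' c0' eta0'.
have [//|hB] := ltP; exfalso.
have [N0w k0w p0w e0w] : [/\ 0 <= N, 0 <= ka, 0 <= p & 0 <= eta] by split=> //; apply: ltW.
have pe e : 0 <= p ^+ e by rewrite exprn_ge0.
have pk e : 0 <= ka * p ^+ e * N by rewrite !mulr_ge0.
have le_ka (a b : R) e : ka <= a -> a * p ^+ e * N <= b -> ka * p ^+ e * N <= b.
  by move=> h; apply: le_trans; rewrite ler_wpM2r // ler_wpM2r.
have XsZ X : X \in Xs -> ka * p ^+ 0 * N <= #|X|%:R.
  by move=> XXs; apply: (le_ka (2 * th)); [lra|rewrite expr0 mulr1; apply: hXs].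
have nX s X : X \in Xs -> s \notin low X -> ka * p ^+ 1 * N <= #|nbs s X|%:R.
  move=> XXs /nlow; apply: le_trans.
  have : p / 4 * (2 * th * N) <= p / 4 * #|X|%:R by rewrite ler_pM2l ?divr_gt0 // hXs.
  apply: le_trans; have : ka * p * N <= th / 2 * p * N.
    by rewrite ler_pM2r // ler_pM2r //; lra.
  rewrite expr1; lra.
have small m : (m <= 20)%N -> m%:R * eta < ka * ka.
  move=> m20; apply: le_lt_trans ke; by rewrite ler_wpM2r // (ler_nat R m 20).
have [|||||z zA hz] := @pick_sizes R V G p eta 3 pG ka 2 (cn G [:: u1; u2] S1) [:: nbs u2 T1, B, T2 & Xs].
- exact: k0.
- exact: N0.
- by apply: le_ka hS1; lra.
- move=> Z; rewrite !inE => /or4P[/eqP->|/eqP->|/eqP->|/XsZ h].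
  + by exists 1%N => //; apply: (le_ka (cc / 4)); [lra|rewrite expr1].
  + by exists 0%N => //; apply: (le_ka (cc / 2)); [lra|rewrite expr0 mulr1].
  + by exists 0%N => //; apply: (le_ka cc); [lra|rewrite expr0 mulr1].
  + by exists 0%N.
- by apply: small; rewrite /= (leq_trans (_ : _ <= 3 + 4)%N) // !ltnS.
have zT1 := nlow (hz _ (mem_head _ _)).
have zB : p / 4 * #|B|%:R <= #|nbs z B|%:R by apply: nlow; apply: hz; rewrite !inE eqxx orbT.
have zT2 : p / 4 * #|T2|%:R <= #|nbs z T2|%:R by apply: nlow; apply: hz; rewrite !inE eqxx !orbT.
have zX X : X \in Xs -> z \notin low X by move=> h; apply: hz; rewrite !inE h !orbT.
move: zA; rewrite in_cn /= andbT => /and3P[zS1 zu1 zu2].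
have cand s A : (forall X, X \in Xs -> s \notin low X) -> cc / 16 * p ^+ 2 * N <= #|A|%:R ->
    ka * p ^+ 2 * N <= #|avoid G p A (front_sets s)|%:R.
  move=> sX hA; apply: le_trans (card_avoid A (y := eta / ka * p ^+ 2 * N) _); last first.
    move=> Z; rewrite mem_cat => /orP[ZXs|/mapP[X XXs ->]].
      apply: le_trans (low_size pG k0 N0 (e := 0) _ (XsZ _ ZXs)) _ => //.
      rewrite ler_wpM2r // ler_wpM2l ?divr_ge0 // subn0.
      by rewrite ler_wiXn2l.
    exact: (low_size pG k0 N0 (e := 1)) (nX _ _ XXs (sX _ XXs)).
  have s8 : (size (front_sets s))%:R <= 8%:R :> R.
    by rewrite ler_nat size_cat size_map; exact: (leq_add sXs sXs).
  have e0 : 0 <= eta / ka * p ^+ 2 * N by rewrite !mulr_ge0 ?invr_ge0.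
  have h1 := ler_wpM2r e0 s8.
  have h2 : eta / ka * (p ^+ 2 * N) <= ka / 20 * (p ^+ 2 * N).
    rewrite ler_wpM2r ?mulr_ge0 // ler_pdivrMr //; lra.
  have h3 : 0 <= ka * p ^+ 2 * N by apply: pk.
  move: hA; rewrite kc; lra.
have cW : cc / 16 * p ^+ 2 * N <= #|nbs z (nbs u2 T1)|%:R.
  apply: le_trans zT1.
  have : p / 4 * (cc / 4 * p * N) <= p / 4 * #|nbs u2 T1|%:R by rewrite ler_pM2l // divr_gt0.
  rewrite expr2; lra.
set W := avoid G p (nbs z (nbs u2 T1)) (front_sets z).
have hW : ka * p ^+ 2 * N <= #|W|%:R by apply: cand.
have [|||||y yB hy] := @pick_sizes R V G p eta 3 pG ka 1 (nbs z B) [:: W, nbs z T2 & Xs].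
- exact: k0.
- exact: N0.
- apply: le_trans zB.
  have : p / 4 * (cc / 2 * N) <= p / 4 * #|B|%:R by rewrite ler_pM2l // divr_gt0.
  have := pk 1%N; rewrite expr1 kc; lra.
- move=> Z; rewrite !inE => /or3P[/eqP->|/eqP->|/XsZ h].
  + by exists 2.
  + exists 1%N => //; apply: le_trans zT2.
    have : p / 4 * (cc * N) <= p / 4 * #|T2|%:R by rewrite ler_pM2l // divr_gt0.
    have := pk 1%N; rewrite expr1 kc; lra.
  + by exists 0%N.
- by apply: small; rewrite /= (leq_trans (_ : _ <= 2 + 4)%N) // !ltnS.
have yX X : X \in Xs -> y \notin low X by move=> h; apply: hy; rewrite !inE h !orbT.
have yT2 : p / 4 * #|nbs z T2|%:R <= #|nbs y (nbs z T2)|%:R.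
  by apply: nlow; apply: hy; rewrite !inE eqxx orbT.
have [w wW yw] : exists2 w, w \in W & adj G y w.
  have h := nlow (hy _ (mem_head _ _)).
  have : (0 < #|nbs y W|)%N.
    rewrite -(ltr0n R); apply: lt_le_trans h; rewrite mulr_gt0 ?divr_gt0 //.
    by apply: lt_le_trans hW; rewrite !mulr_gt0 ?exprn_gt0.
  by case/card_gt0P => w; rewrite in_nbs => /andP[w1 w2]; exists w.
have cQ : cc / 16 * p ^+ 2 * N <= #|nbs y (nbs z T2)|%:R.
  apply: le_trans yT2.
  have : p / 4 * (p / 4 * (cc * N)) <= p / 4 * #|nbs z T2|%:R.
    rewrite ler_pM2l ?divr_gt0 //; apply: le_trans zT2.
    by rewrite ler_pM2l // divr_gt0.
  rewrite expr2; lra.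
set Q := avoid G p (nbs y (nbs z T2)) (front_sets y).
have hQ : ka * p ^+ 2 * N <= #|Q|%:R by apply: cand.
move: yB; rewrite in_nbs in_set => /andP[/andP[yS2 hbad] zy].
move: hbad; rewrite ltNge => /negP; apply.
apply: (@le_trans _ _ #|low Q|%:R); last first.
  apply: le_trans (low_size pG k0 N0 (e := 2) _ hQ) _ => //.
  by rewrite expr1 ler_pM2r // ler_pM2r.
(* A neighbour [x] of [y] outside [low Q] has a neighbour [q] in [Q], which completes a zigzag; so
   [y] has too few failing neighbours to be bad. *)
rewrite ler_nat subset_leq_card //; apply/subsetP => x; rewrite in_set in_nbs.
case/andP=> /andP[xS3 yx]; apply: contraR => /nlow hx.
have : (0 < #|nbs x Q|)%N.
  rewrite -(ltr0n R); apply: lt_le_trans hx; rewrite mulr_gt0 ?divr_gt0 //.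
  by apply: lt_le_trans hQ; rewrite !mulr_gt0 ?exprn_gt0.
case/card_gt0P => q; rewrite in_nbs in_avoid !in_nbs => /andP[/andP[/andP[/andP[qT2 zq] yq] fq] xq].
move: wW; rewrite in_avoid !in_nbs => /andP[/andP[/andP[wT1 u2w] zw] fw].
apply/existsP; exists z; rewrite zS1; apply/existsP; exists w; rewrite wT1.
apply/existsP; exists q; rewrite qT2 /= zu1 zu2 (adjC G w) u2w (adjC G w) zw (adjC G w) yw.
have az : all (fun X => z \notin low X) Xs by apply/allP.
have ay : all (fun X => y \notin low X) Xs by apply/allP.
by rewrite (adjC G y) zy (adjC G q) zq (adjC G q) yq (adjC G q) xq /gfront fq fw az ay.
Qed.

End SquareAbsorber.

Section CommonEdge.
Variables (R : realType) (V : finType) (G : sgraph V) (p K : R).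
Hypothesis pG : pseudo G p K.
Local Notation N := (#|V|%:R : R).
Local Notation nbs := (nbs G).
Implicit Types (A B X : {set V}).

(** There are at least (c N/2)(p/4)(c N) edges between [A] and [B], and each relation fails for at
    most d p N^2 of them; hence the condition 16 d < c^2. *)
Lemma common_edge A B (rL rR : rel V) (d c : R) : 0 < c -> 0 < N ->
  c * N <= #|A|%:R -> c * N <= #|B|%:R -> 16 * d < c ^+ 2 ->
  2 * K <= c ^+ 2 * N ^+ 2 ->
  {in A, forall y, #|[set x in nbs y B | ~~ rL y x]|%:R <= d * p * N} ->
  {in B, forall x, #|[set y in nbs x A | ~~ rR x y]|%:R <= d * p * N} ->
  exists y x, [/\ y \in A, x \in B, adj G y x, rL y x & rR x y].
Proof.
move=> c0 N0 hA hB hd hK hL hR; have p0 := ps_gt0 pG; have p1 := ps_le1 pG.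
have [/existsP[y /existsP[x /and5P[h1 h2 h3 h4 h5]]]|no] :=
  boolP [exists y, exists x, [&& y \in A, x \in B, adj G y x, rL y x & rR x y]].
  by exists y, x.
exfalso.
have B0 : 0 < #|B|%:R :> R by apply: lt_le_trans hB; rewrite mulr_gt0.
have up : \sum_(y in A) #|nbs y B|%:R <= N * (d * p * N) + N * (d * p * N).
  have dn (X : {set V}) : X = A \/ X = B -> #|X|%:R * (d * p * N) <= N * (d * p * N).
    move=> _; have [d0|d0] := leP 0 (d * p * N); first by rewrite ler_wpM2r // ler_nat max_card.
    exfalso; have [x xB] : exists x, x \in B by apply/card_gt0P; rewrite -(ltr0n R).
    by have := le_lt_trans (hR x xB) d0; rewrite ltrn0.
  apply: (@le_trans _ _ (\sum_(y in A) #|[set x in nbs y B | ~~ rL y x]|%:R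
     + \sum_(y in A) #|[set x in B | adj G y x && ~~ rR x y]|%:R)).
    rewrite -big_split; apply: ler_sum => y yA /=.
    rewrite -natrD ler_nat; apply: leq_trans (leq_card_setU _ _).
    apply: subset_leq_card; apply/subsetP => x; rewrite in_nbs => /andP[xB yx].
    rewrite in_setU !in_set xB yx /=; apply/negPn/negP.
    rewrite negb_or !negbK => /andP[h1 h2].
    by move/existsPn: no => /(_ y)/existsPn/(_ x); rewrite yA xB yx h1 h2.
  apply: lerD.
    apply: le_trans (dn A (or_introl erefl)); rewrite mulr_natl -sumr_const.
    exact: ler_sum.
  rewrite -natr_sum (sum_card_exchange B A (fun x y => adj G y x && ~~ rR x y)).
  rewrite natr_sum; apply: le_trans (dn B (or_intror erefl)).
  rewrite mulr_natl -sumr_const; apply: ler_sum => x xB; apply: le_trans (hR x xB).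
  rewrite ler_nat subset_leq_card //; apply/subsetP => y.
  by rewrite !in_set => /andP[-> /andP[h ->]]; rewrite adjC h.
have lo : (#|A|%:R - #|lowset G p B|%:R) * (p / 4 * #|B|%:R) <= \sum_(y in A) #|nbs y B|%:R.
  apply: (@le_trans _ _ (\sum_(y in A :\: lowset G p B) #|nbs y B|%:R)).
    have pB : 0 <= p / 4 * #|B|%:R by rewrite mulr_ge0 // divr_ge0 // ltW.
    apply: le_trans (ler_wpM2r pB (card_minus R _ _)) _.
    rewrite mulr_natl -sumr_const; apply: ler_sum => y /setDP[_].
    exact: nlow.
  rewrite [X in _ <= X](bigID (mem (lowset G p B))) /= addrC.
  rewrite -[X in X <= _]addr0; apply: lerD; last exact: sumr_ge0.
  rewrite le_eqVlt; apply/orP; left; apply/eqP; apply: eq_bigl => y.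
  by rewrite in_setD andbC.
have hl : #|lowset G p B|%:R <= c * N / 2.
  have h1 := low_le pG _ hB; have {h1} := h1 (mulr_gt0 c0 N0) => h1.
  apply: (le_trans h1); rewrite ler_pdivrMr ?mulr_gt0 //; move: hK; lra.
have h1 : c * N / 2 * (p / 4 * (c * N)) <= (#|A|%:R - #|lowset G p B|%:R) * (p / 4 * #|B|%:R).
  apply: ler_pM.
  - by rewrite divr_ge0 // mulr_ge0 // ltW.
  - by rewrite mulr_ge0 ?divr_ge0 ?mulr_ge0 ?ltW.
  - lra.
  - by rewrite ler_pM2l // divr_gt0.
have h2 : 16 * d * (p * N ^+ 2) < c ^+ 2 * (p * N ^+ 2).
  by rewrite ltr_pM2r // mulr_gt0 ?exprn_gt0.
have := le_trans h1 (le_trans lo up); lra.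
Qed.

End CommonEdge.

(* The orders [s1] and [s2] list the same vertices, apart from the absorbed [r]
   in [s2], and have the same ends [u1 u2] and [x q']; the connecting paths
   [c1] and [c2] are traversed in different order. The edge [yx] where two
   zigzags from the ends [u1 u2] and [u4 u3] meet exists by [common_edge]. *)
Lemma square_absorbing_pieces (R : realType) (V : finType) (G : sgraph V) (p th eta : R) :
  let ka := th / 96 / 32 in
  pseudo G p (eta * p ^+ 3 * #|V|%:R ^+ 2) ->
  0 < th -> th <= 1 -> 0 < eta -> eta <= ka ^+ 3 ->
  40 <= th * (p / 8) ^+ 2 * #|V|%:R -> connects G p th 1 14 ->
  piece_maker G p th 2 40 true.
Proof.
move=> ka pG th0 th1 eta0 he hN conn X0 Xs r X0Xs sXs hXs rX0 hr.
have p0 := ps_gt0 pG; have p1 := ps_le1 pG.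
pose cc := th / 96; have c0 : 0 < cc by rewrite divr_gt0.
have hcc : cc <= 1 / 96 by rewrite ler_pM2r // invr_gt0.
have hcth : 96 * cc <= th by rewrite /cc mulrCA divff ?mulr1 ?gt_eqF //; lra.
set N : R := #|V|%:R in hN pG hXs hr.
have N0 : 0 < N.
  rewrite lt_neqAle ler0n andbT eq_sym; apply/eqP => e; move: hN; rewrite e mulr0; lra.
have [k0 k1 ke ke2 kc] := ka_facts c0 hcc he.
rewrite -/ka in k0 k1 ke ke2 kc.
have gfg s t (X : {set V}) : gfront G p Xs s t -> X \in Xs -> good G p th 2 2 X [:: t; s].
  exact: (gfront_good pG c0 N0 hcth hXs).
(* The first four sets, inside the neighbourhood of [r], are for [u1] to [u4]; the other eight are
   for the two zigzags. *)
pose Y i := if (i < 4)%N then nbs G r X0 else X0.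
have YX i : Y i \subset X0 by rewrite /Y; case: ifP => _ //; apply: nbs_sub.
pose e i := if (i < 4)%N then 1%N else 0%N.
have hY i : 24 * cc * p ^+ e i * N <= #|Y i|%:R.
  rewrite /Y /e /cc; case: ifP => _.
    by apply: le_trans hr; rewrite expr1; lra.
  apply: le_trans (hXs _ X0Xs); rewrite expr0.
  have : 0 <= th * N by rewrite mulr_ge0 // ltW.
  lra.
have pe i : p ^+ 2 <= p ^+ e i.
  by rewrite ler_wiXn2l ?(ltW p0) // /e; case: ifP.
have hY2 i : (i < 12)%N -> (12 <= #|Y i|)%N.
  move=> _; rewrite -(ler_nat R); apply: le_trans (hY i).
  have : th * N * p ^+ 2 <= th * N * p ^+ e i by rewrite ler_wpM2l // mulr_ge0 // ltW.
  rewrite /cc; move: hN; rewrite expr_div_n; lra.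
have [Z [dZ ZY cZ]] := disjoint_subsets hY2.
have hZ i : (i < 12)%N -> cc * p ^+ e i * N <= #|Z i|%:R.
  move=> i12; have -> : cc * p ^+ e i * N = (24 * cc * p ^+ e i * N) / 24%:R by field.
  rewrite ler_pdivrMr //; apply: le_trans (hY i) _.
  by rewrite -natrM ler_nat mulnC; apply: cZ.
have ZX i v : (i < 12)%N -> v \in Z i -> v \in X0.
  by move=> hi h; apply: (subsetP (YX i)); apply: (subsetP (ZY i hi)).
have Zr i v : (i < 4)%N -> v \in Z i -> adj G r v.
  move=> hi vZ; have := subsetP (ZY i (@leq_trans 4 _ 12 hi isT)) v vZ.
  by rewrite /Y hi in_nbs => /andP[].
have small m : (m <= 20)%N -> m%:R * eta < ka * ka.
  move=> m20; apply: le_lt_trans ke; rewrite ler_wpM2r ?(ltW eta0) //.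
  by rewrite (ler_nat R m 20).
have pe0 i : 0 <= p ^+ i by rewrite exprn_ge0 // ltW.
have le_ka (a b : R) i : ka <= a -> a * p ^+ i * N <= b -> ka * p ^+ i * N <= b.
  by move=> h; apply: le_trans; rewrite ler_wpM2r ?(ltW N0) // ler_wpM2r.
have ZK i : (i < 12)%N -> ka * p ^+ e i * N <= #|Z i|%:R.
  by move=> hi; apply: (le_ka cc) (hZ i hi); rewrite kc; lra.
have XsZ (X : {set V}) : X \in Xs -> ka * p ^+ 0 * N <= #|X|%:R.
  move=> XXs; apply: (le_ka (2 * th)); first by rewrite /ka; lra.
  by rewrite expr0 mulr1; apply: hXs.
have nstep (a : R) i (s : V) (A : {set V}) : s \notin lowset G p A -> a * p ^+ i * N <= #|A|%:R ->
    a / 4 * p ^+ i.+1 * N <= #|nbs G s A|%:R.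
  move=> /nlow h1 h2; apply: le_trans h1.
  have -> : a / 4 * p ^+ i.+1 * N = p / 4 * (a * p ^+ i * N) by rewrite exprS; ring.
  by rewrite ler_pM2l // divr_gt0.
(* The inner vertices [u2] and [u3] come before [u1] and [u4]. Around [r] only consecutive vertices
   need to be adjacent, so each new vertex is sought in a single neighbourhood of order p^2 N. *)
have [|||||u2 u2Z hu2] := @pick_sizes R V G p eta 3 pG ka 1 (Z 1%N) [:: Z 0%N, Z 2, Z 4, Z 8 & Xs].
- exact: k0.
- exact: N0.
- exact: (ZK 1%N).
- move=> A; rewrite !inE => /or4P[/eqP->|/eqP->|/eqP->|/orP[/eqP->|/XsZ h]].
  + by exists 1%N => //; apply: (ZK 0%N).
  + by exists 1%N => //; apply: (ZK 2).
  + by exists 0%N => //; apply: (ZK 4).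
  + by exists 0%N => //; apply: (ZK 8).
  + by exists 0%N.
- by apply: small; rewrite /= (leq_trans (_ : _ <= 4 + 4)%N) // !ltnS.
have n20 := nstep _ 1%N _ _ (hu2 (Z 0%N) (mem_head _ _)) (hZ 0%N isT).
have n22 : cc / 4 * p ^+ 2 * N <= #|nbs G u2 (Z 2)|%:R.
  by apply: (nstep _ 1%N); [apply: hu2; rewrite !inE eqxx orbT|apply: (hZ 2)].
have n24 : cc / 4 * p ^+ 1 * N <= #|nbs G u2 (Z 4)|%:R.
  by apply: (nstep _ 0%N); [apply: hu2; rewrite !inE eqxx !orbT|apply: (hZ 4)].
have n28 : cc / 4 * p ^+ 1 * N <= #|nbs G u2 (Z 8)|%:R.
  by apply: (nstep _ 0%N); [apply: hu2; rewrite !inE eqxx !orbT|apply: (hZ 8)].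
have u2X (X : {set V}) : X \in Xs -> u2 \notin lowset G p X by move=> h; apply: hu2; rewrite !inE h !orbT.
have kc4 : ka <= cc / 4 by rewrite kc; lra.
have [|||||u3 u3Z hu3] := @pick_sizes R V G p eta 3 pG ka 2 (nbs G u2 (Z 2)) [:: Z 3, Z 7, Z 11 & Xs].
- exact: k0.
- exact: N0.
- exact: le_ka n22.
- move=> A; rewrite !inE => /or4P[/eqP->|/eqP->|/eqP->|/XsZ h].
  + by exists 1%N => //; apply: (ZK 3).
  + by exists 0%N => //; apply: (ZK 7).
  + by exists 0%N => //; apply: (ZK 11).
  + by exists 0%N.
- by apply: small; rewrite /= (leq_trans (_ : _ <= 3 + 4)%N) // !ltnS.
have n33 : cc / 4 * p ^+ 2 * N <= #|nbs G u3 (Z 3)|%:R.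
  by apply: (nstep _ 1%N); [apply: hu3; rewrite !inE eqxx|apply: (hZ 3)].
have n37 : cc / 4 * p ^+ 1 * N <= #|nbs G u3 (Z 7)|%:R.
  by apply: (nstep _ 0%N); [apply: hu3; rewrite !inE eqxx !orbT|apply: (hZ 7)].
have n311 : cc / 4 * p ^+ 1 * N <= #|nbs G u3 (Z 11)|%:R.
  by apply: (nstep _ 0%N); [apply: hu3; rewrite !inE eqxx !orbT|apply: (hZ 11)].
have u3X (X : {set V}) : X \in Xs -> u3 \notin lowset G p X by move=> h; apply: hu3; rewrite !inE h !orbT.
have outer (s : V) (A B : {set V}) : (forall X : {set V}, X \in Xs -> s \notin lowset G p X) ->
    cc / 4 * p ^+ 2 * N <= #|A|%:R -> cc / 4 * p ^+ 1 * N <= #|B|%:R ->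
    exists t, [/\ t \in A, gfront G p Xs s t & cc / 16 * p ^+ 2 * N <= #|nbs G t B|%:R].
  move=> sX hA hB.
  have [|||||t tA ht] := @pick_sizes R V G p eta 3 pG ka 2 A (B :: front_sets G Xs s).
  - exact: k0.
  - exact: N0.
  - exact: le_ka hA.
  - move=> A'; rewrite inE mem_cat => /or3P[/eqP->|/XsZ h|/mapP[X XXs ->]].
    + by exists 1%N => //; apply: le_ka hB.
    + by exists 0%N.
    + exists 1%N => //; apply: (le_ka (2 * th / 4)); first by rewrite /ka; lra.
      by apply: (nstep _ 0%N); [apply: sX|rewrite expr0 mulr1; apply: hXs].
  - apply: small; rewrite /= size_cat size_map.
    exact: (@leq_trans 9 _ 20 (leq_add (leqnn 1%N) (leq_add sXs sXs)) isT).
  exists t; split=> //.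
    rewrite /gfront; apply/andP; split; apply/allP => // A' hA'.
    by apply: ht; rewrite inE hA' orbT.
  have -> : cc / 16 = cc / 4 / 4 by field.
  by apply: (nstep _ 1%N) => //; apply: ht; rewrite mem_head.
have [u1 [u1A g21 n14]] := outer u2 _ _ u2X n20 n24.
have [u4 [u4A g34 n47]] := outer u3 _ _ u3X n33 n37.
have few1 := @zigzag_few R V G p th eta cc pG Xs eta0 c0 hcc N0 hcth he hXs sXs u1 u2 (Z 4) (Z 8) (Z 5) (Z 9) (Z 6) n14.
have few2 := @zigzag_few R V G p th eta cc pG Xs eta0 c0 hcc N0 hcth he hXs sXs u4 u3 (Z 7) (Z 11) (Z 6) (Z 10) (Z 5) n47.
have {}few1 := few1 (eq_ind _ (fun x => cc / 4 * x * N <= _) n28 _ (expr1 p)).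
have {}few2 := few2 (eq_ind _ (fun x => cc / 4 * x * N <= _) n311 _ (expr1 p)).
have hZ0 i : (4 <= i < 12)%N -> cc * N <= #|Z i|%:R.
  by case/andP=> i4 i12; have := hZ i i12; rewrite /e ltnNge i4 expr0 mulr1.
have {}few1 := few1 (hZ0 9 isT); have {}few2 := few2 (hZ0 10 isT).
set zl := zigzag _ _ _ _ _ _ _ _ in few1; set zr := zigzag _ _ _ _ _ _ _ _ in few2.
set B1 := [set _ in _ | _] in few1; set B2 := [set _ in _ | _] in few2.
have [y [x [yA xA yx]]] : exists y x, [/\ y \in Z 5 :\: B1, x \in Z 6 :\: B2, adj G y x, zl y x & zr x y].
  apply: (@common_edge R V G p _ pG _ _ zl zr (ka ^+ 2) (cc / 2)) => //.
  - by rewrite divr_gt0.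
  - have := card_minus R (Z 5) B1; have := hZ0 5 isT; move: few1; lra.
  - have := card_minus R (Z 6) B2; have := hZ0 6 isT; move: few2; lra.
  - rewrite kc; have : 0 < ka ^+ 2 by rewrite exprn_gt0.
    lra.
  - rewrite mulrA ler_wpM2r ?sqr_ge0 //.
    have : eta * p ^+ 3 <= eta by rewrite ler_piMr ?(ltW eta0) // exprn_ile1 // ltW.
    have : 0 < ka * ka by rewrite mulr_gt0.
    rewrite kc; move: ke eta0; lra.
  - move=> v /setDP[vZ]; rewrite in_set vZ /= -leNgt => h; apply: (le_trans _ h).
    rewrite ler_nat subset_leq_card //; apply/subsetP => z; rewrite !in_set.
    by case/andP=> /andP[/andP[_ ->] ->] ->.
  - move=> v /setDP[vZ]; rewrite in_set vZ /= -leNgt => h; apply: (le_trans _ h).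
    rewrite ler_nat subset_leq_card //; apply/subsetP => z; rewrite !in_set.
    by case/andP=> /andP[/andP[_ ->] ->] ->.
move=> /existsP[z /andP[zZ /existsP[w /andP[wZ /existsP[q /andP[qZ hl]]]]]].
move=> /existsP[z' /andP[zZ' /existsP[w' /andP[wZ' /existsP[q' /andP[qZ' hr']]]]]].
have {yA} yZ : y \in Z 5 by case/setDP: yA.
have {xA} xZ : x \in Z 6 by case/setDP: xA.
move: u3Z u1A u4A; rewrite !in_nbs => /andP[u3Z u23] /andP[u1Z u21] /andP[u4Z u34].
case/and5P: hl => zu1 zu2 wu2 wz /and5P[wy yz qz qy /and3P[qx g1w g1q]].
case/and5P: hr' => zu4 zu3 wu3 wz' /and5P[wx xz qz' qx' /and3P[qy' g2w g2q]].
have r1 := Zr 0%N _ isT u1Z; have r2 := Zr 1%N _ isT u2Z.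
have r3 := Zr 2 _ isT u3Z; have r4 := Zr 3 _ isT u4Z.
pose L := [:: u1; u2; u3; u4; z; y; x; z'; w; q; q'; w'].
have LZ i : (i < 12)%N -> nth r L i \in Z i.
  by case: i => [|[|[|[|[|[|[|[|[|[|[|[|]]]]]]]]]]]].
have uL : uniq L by apply: sets_uniq LZ.
have LX v : v \in L -> v \in X0.
  by case/(nthP r) => i hi <-; apply: ZX (LZ i hi).
(* 40 = 12 + 14 + 14 bounds the whole piece: the two zigzags with their ends and two connecting
   paths. *)
have shrink (D : {set V}) f : (#|D| <= 40)%N -> good G p th 2 2 X0 f -> good G p th 2 1 (X0 :\: D) f.
  move=> hD gf; apply: (good_shrink p0 p1 th0 gf (subsetDl _ _)).
  apply: le_trans hN; rewrite (ler_nat R _ 40); apply: leq_trans hD.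
  by rewrite subset_leq_card // setDDr setDv set0U subsetIr.
have k2 (a b : V) : adj G a b -> kpath G 2 [:: a; b] by rewrite /= => ->.
have cL : (#|[set v in L]| <= 12)%N by rewrite cardsE (leq_trans (card_size _)).
have [|||||| c1 [sc1 uc1 c1X kc1]] := conn (X0 :\: [set v in L]) [:: q; y] [:: u4; u3].
- by [].
- by [].
- exact: k2.
- by apply: k2; rewrite adjC.
- by apply: shrink; [rewrite (leq_trans cL)|apply: gfg].
- by apply: shrink; [rewrite (leq_trans cL)|apply: gfg].
pose D2 := [set v in L] :|: [set v in c1].
have cD2 : (#|D2| <= 40)%N.
  rewrite (leq_trans (leq_card_setU _ _)) // (@leq_trans (12 + 14)) // leq_add //.
  by rewrite cardsE (leq_trans (card_size _)).
have [|||||| c2 [sc2 uc2 c2X kc2]] := conn (X0 :\: D2) [:: w'; z'] [:: w; z].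
- by [].
- by [].
- exact: k2.
- exact: k2.
- by apply: shrink => //; apply: gfg.
- by apply: shrink => //; apply: gfg.
pose M := L ++ c1 ++ c2.
have MX v : v \in M -> v \in X0.
  by rewrite !mem_cat => /or3P[/LX|/c1X|/c2X] //; rewrite in_setD => /andP[].
have c1L v : v \in c1 -> v \notin L by move/c1X; rewrite in_setD inE => /andP[].
have c2L v : v \in c2 -> (v \notin L) && (v \notin c1).
  by move/c2X; rewrite in_setD in_setU negb_or !in_set => /andP[].
have uM : uniq M.
  rewrite /M cat_uniq uL cat_uniq uc1 uc2 has_cat negb_or !andbT !andTb.
  apply/andP; split; last by apply/hasPn => v /c2L/andP[].
  apply/andP; split; apply/hasPn => v; first exact: c1L.
  by case/c2L/andP.
have rM : r \notin M by apply/negP => /MX; rewrite (negbTE rX0).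
pose s1 := [:: u1; u2; z; w] ++ c2 ++ [:: w'; z'; u3; u4] ++ c1 ++ [:: q; y; x; q'].
pose s2 := [:: u1; u2; r; u3; u4] ++ c1 ++ [:: q; y; z; w] ++ c2 ++ [:: w'; z'; x; q'].
have pm1 : perm_eq s1 M.
  apply/permP => P; rewrite /s1 /M /L !(count_cat) /=; clear.
  repeat match goal with |- context [nat_of_bool ?b] => move: (nat_of_bool b) => ? end.
  by move: (count P c1) (count P c2) => ? ?; lia.
have pm2 : perm_eq s2 (r :: M).
  apply/permP => P; rewrite /s2 /M /L /= !(count_cat) /= !(count_cat) /=; clear.
  repeat match goal with |- context [nat_of_bool ?b] => move: (nat_of_bool b) => ? end.
  by move: (count P c1) (count P c2) => ? ?; lia.
have sy (a b : V) : adj G a b -> adj G b a by rewrite adjC.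
have ks1 : kpath G 2 s1.
  have a1 : kpath G 2 ([:: u1; u2] ++ [:: z; w]).
    by rewrite /= (sy _ _ u21) (sy _ _ zu1) (sy _ _ zu2) (sy _ _ wu2) (sy _ _ wz).
  have a2 : kpath G 2 ([:: w'; z'] ++ [:: u3; u4]).
    by rewrite /= wz' wu3 zu3 zu4 u34.
  have a3 : kpath G 2 ([:: q; y] ++ [:: x; q']).
    by rewrite /= qy qx yx (sy _ _ qy') (sy _ _ qx').
  have t3 : kpath G 2 (([:: u3; u4] ++ c1) ++ [:: q; y] ++ [:: x; q']).
    by apply: kpath_glue.
  have t2 : kpath G 2 ([:: w'; z'] ++ [:: u3; u4] ++ (c1 ++ [:: q; y; x; q'])).
    by apply: kpath_glue.
  have t1 : kpath G 2 (([:: z; w] ++ c2) ++ [:: w'; z'] ++ [:: u3; u4] ++ (c1 ++ [:: q; y; x; q'])).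
    by apply: kpath_glue.
  have : kpath G 2 ([:: u1; u2] ++ [:: z; w] ++ (c2 ++ [:: w'; z'; u3; u4] ++ (c1 ++ [:: q; y; x; q']))).
    by apply: kpath_glue.
  by [].
have ks2 : kpath G 2 s2.
  have a1 : kpath G 2 ([:: u1; u2; r] ++ [:: u3; u4]).
    by rewrite /= (sy _ _ u21) (sy _ _ r1) (sy _ _ r2) u23 r3 r4 u34.
  have a2 : kpath G 2 ([:: q; y] ++ [:: z; w]).
    by rewrite /= qy qz yz (sy _ _ wy) (sy _ _ wz).
  have a3 : kpath G 2 ([:: w'; z'] ++ [:: x; q']).
    by rewrite /= wz' wx (sy _ _ xz) (sy _ _ qz') (sy _ _ qx').
  have t3 : kpath G 2 (([:: z; w] ++ c2) ++ [:: w'; z'] ++ [:: x; q']).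
    by apply: kpath_glue.
  have t2 : kpath G 2 ([:: q; y] ++ [:: z; w] ++ (c2 ++ [:: w'; z'; x; q'])).
    by apply: kpath_glue.
  have t1 : kpath G 2 (([:: u3; u4] ++ c1) ++ [:: q; y] ++ [:: z; w] ++ (c2 ++ [:: w'; z'; x; q'])).
    by apply: kpath_glue.
  have : kpath G 2 ([:: u1; u2; r] ++ [:: u3; u4] ++ (c1 ++ [:: q; y; z; w] ++ (c2 ++ [:: w'; z'; x; q']))).
    by apply: kpath_glue.
  by [].
exists [:: u1; u2], [:: q'; x], [set v in M]; split.
- split=> //; first by rewrite disjoint_sym disjoints1 inE.
  move=> W; rewrite subset1 => /orP[]/eqP->.
    exists s2; split=> //.
    + by rewrite (perm_uniq pm2) cons_uniq rM.
    + by move=> v; rewrite (perm_mem pm2) !inE orbC.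
    + by rewrite /s2 !rev_cat.
  exists s1; split=> //.
  + by rewrite (perm_uniq pm1).
  + by move=> v; rewrite (perm_mem pm1) setU0 [RHS]in_set.
  + by rewrite /s1 !rev_cat.
- by apply/subsetP => v; rewrite inE; apply: MX.
- by [].
- rewrite cardsE (leq_trans (card_size _)) // !size_cat.
  exact: (leq_add (leqnn 12) (leq_add sc1 sc2)).
by move=> X XXs; split; apply: gfg.
Qed.

(** * Extending a path with absorbed vertices *)

Section Flexible.
Variables (V : finType) (G : sgraph V) (k : nat).
Implicit Types (A B F X Y : {set V}) (f b c s : seq V).
Local Notation flex := (flex G k).

Lemma flex_sub f b A F F' : flex f b A F -> F' \subset F -> flex f b A F'.
Proof.
move=> [sf sb dAF h] sF; split=> //; last by move=> W /subset_trans/(_ sF)/h.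
by rewrite disjoint_sym; apply: disjointWl sF _; rewrite disjoint_sym.
Qed.

Lemma flex_kpath f b A F : flex f b A F -> [/\ kpath G k f, kpath G k b,
  {subset f <= A} & {subset b <= A}].
Proof.
move=> [sf sb _ /(_ set0 (sub0set _))[s [us sA ks tf tb]]].
have kt l : kpath G k l -> kpath G k (take k l).
  by rewrite -{1}(cat_take_drop k l) => /kpath_cat_l.
have sub l : {subset take k l <= l} by move=> x /mem_take.
split.
- by rewrite -tf kt.
- by rewrite -tb kt // kpath_rev.
- by move=> x; rewrite -tf => /sub; rewrite sA setU0.
- by move=> x; rewrite -tb => /sub; rewrite mem_rev sA setU0.
Qed.

Lemma flex_cons f b A F x : flex f b A F -> x \notin A -> x \notin F ->
  all (adj G x) f -> flex (take k (x :: f)) b (x |: A) F.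
Proof.
move=> [sf sb dAF h] xA xF xf; split=> //.
- by rewrite size_takel //= sf.
- rewrite disjoint_sym disjoint_subset; apply/subsetP => y yF.
  rewrite inE in_setU1 negb_or; apply/andP; split.
    by apply: contraNneq xF => <-.
  by rewrite (disjointFl dAF yF).
move=> W WF; have [s [us sA ks tf tb]] := h W WF; exists (x :: s).
have ss : (k <= size s)%N by rewrite -sf -tf size_take_min geq_minr.
split.
- rewrite /= us andbT sA in_setU (negbTE xA) /=; apply/negP => /(subsetP WF).
  by rewrite (negbTE xF).
- by move=> y; rewrite inE sA -setUA in_setU1.
- by rewrite /= tf xf.
- by rewrite -tf; case: (k) => //= k'; rewrite take_takel.
- by rewrite rev_cons -cats1 takel_cat // size_rev.
Qed.

(** Each part receives its own share of [W]; as neither changes its ends, the same [c] joins them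
    for all [W]. *)
Lemma flex_join f1 b1 A1 F1 f2 b2 A2 F2 c : (0 < k)%N ->
  flex f1 b1 A1 F1 -> flex f2 b2 A2 F2 ->
  uniq c -> kpath G k (rev b1 ++ c ++ f2) ->
  [disjoint A1 :|: F1 & A2 :|: F2] ->
  {in c, forall x, (x \notin A1 :|: F1) && (x \notin A2 :|: F2)} ->
  flex f1 b2 (A1 :|: A2 :|: [set x in c]) (F1 :|: F2).
Proof.
move=> k0 [sf1 sb1 d1 h1] [sf2 sb2 d2 h2] uc kc d12 cd; split=> //.
  rewrite disjoint_subset; apply/subsetP => x; rewrite !inE negb_or.
  case/orP=> [/orP[xA|xA]|xc].
  - rewrite (disjointFr d1 xA) /=; apply/negP => xF.
    by have := disjointFr d12 (x := x); rewrite !inE xA xF orbT => /(_ isT).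
  - rewrite (disjointFr d2 xA) andbT; apply/negP => xF.
    by have := disjointFr d12 (x := x); rewrite !inE xA xF orbT => /(_ isT).
  by have /andP[] := cd x xc; rewrite !inE !negb_or => /andP[_ ->] /andP[_ ->].
move=> W WF; have [s1 [u1 e1 k1 t1 r1]] := h1 (W :&: F1) (subsetIr _ _).
have [s2 [u2 e2 k2 t2 r2]] := h2 (W :&: F2) (subsetIr _ _).
have ss1 : (k <= size s1)%N by rewrite -sf1 -t1 size_take_min geq_minr.
have ss2 : (k <= size s2)%N by rewrite -sf2 -t2 size_take_min geq_minr.
have in1 x : x \in s1 -> x \in A1 :|: F1.
  by rewrite e1 !inE => /orP[->|/andP[_ ->]]; rewrite ?orbT.
have in2 x : x \in s2 -> x \in A2 :|: F2.
  by rewrite e2 !inE => /orP[->|/andP[_ ->]]; rewrite ?orbT.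
exists (s1 ++ c ++ s2); split.
- rewrite !cat_uniq u1 u2 uc has_cat negb_or !andbT !andTb.
  apply/andP; split; last first.
    apply/hasPn => x /in2 xs; apply/negP => /cd/andP[_].
    by rewrite xs.
  apply/andP; split; apply/hasPn => x.
    by move=> /cd/andP[h _]; apply: contra h; apply: in1.
  by move=> /in2 xs; apply/negP => /in1 /(disjointFr d12); rewrite xs.
- move=> x; rewrite !mem_cat e1 e2 !inE.
  have : x \in W -> (x \in F1) || (x \in F2) by move/(subsetP WF); rewrite inE.
  case: (x \in W) => [/(_ isT)|_]; last first.
    by rewrite !orbF; case: (x \in A1); case: (x \in A2); case: (x \in c).
  by case: (x \in A1); case: (x \in A2); case: (x \in c); case: (x \in F1); case: (x \in F2).
- have e1' : s1 = rev (drop k (rev s1)) ++ rev b1.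
    by rewrite -r1 -rev_cat cat_take_drop revK.
  have e2' : s2 = f2 ++ drop k s2 by rewrite -t2 cat_take_drop.
  have : kpath G k ((rev b1 ++ c) ++ f2 ++ drop k s2).
    by apply: kpath_glue; rewrite ?sf2 // -?catA // -e2'.
  rewrite -e2' -catA => h3; rewrite e1' -catA; apply: kpath_glue => //.
    by rewrite size_rev sb1.
  by rewrite -e1'.
- by rewrite takel_cat.
- by rewrite !rev_cat -catA takel_cat // size_rev.
Qed.

End Flexible.

(** * Adding pieces to a flexible path, one vertex or one set at a time *)

Section Rounds.
Variables (R : realType) (V : finType) (G : sgraph V) (p th K : R) (n Tc Tp : nat).
Variable absorb : bool.
Hypothesis pG : pseudo G p K.
Local Notation N := (#|V|%:R : R).
Local Notation k := n.+1.
Local Notation nbs := (nbs G).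
Local Notation flex := (flex G k).
Local Notation good := (good G p th k).
Local Notation mu := (th * (p / 8) ^+ k * N).
Local Notation T := (1 + Tp + Tc)%N.
Hypotheses (th0 : 0 < th) (hc : connects G p th n Tc) (hP : piece_maker G p th k Tp absorb).
Hypotheses (hT : 2 * T%:R < mu)
  (hK : 2 * (5 * k)%:R * K <= mu * (th * (p / 8) ^+ n * N)).
Implicit Types (A B F X Y : {set V}) (Xs : seq {set V}) (f b c s : seq V).

Let p0 : 0 < p. Proof. exact: ps_gt0 pG. Qed.
Let p1 : p <= 1. Proof. exact: ps_le1 pG. Qed.

(** Extendability is recorded for the growing front only. The back end [b] never changes, and its
    extendability is carried separately. *)
Definition state Xs A F f b : Prop :=
  flex f b A F /\ {in Xs, forall X, good 1 (X :\: A) f}.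

Lemma extend_state Xs A F f b X0 : state Xs A F f b -> X0 \in Xs ->
  (size Xs <= 4)%N -> {in Xs, forall X, 2 * th * N <= #|X :\: A|%:R} ->
  exists x, [/\ x \in X0 :\: A, flex (take k (x :: f)) b (x |: A) (F :\ x) &
    {in Xs, forall X, good 2 (X :\: A) (take k (x :: f))}].
Proof.
move=> [fl gf] X0Xs sXs hX; have [sf _ _ _] := fl.
pose Y := cn G (take k f) (X0 :\: A).
have hY : mu <= #|Y|%:R by have := gf X0 X0Xs k (leqnn _); rewrite mul1r.
have mu0 : 0 < mu by apply: le_lt_trans hT; rewrite mulr_ge0.
have N0 : 0 < N.
  rewrite lt_neqAle ler0n andbT eq_sym; apply/eqP => e.
  by move: mu0; rewrite e mulr0 ltxx.
have t0 : 0 < th * (p / 8) ^+ n * N by rewrite !mulr_gt0 ?exprn_gt0 ?divr_gt0.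
pose Fs := [seq (th, X :\: A, f) | X <- Xs].
have [||x xY hx] := @extend R V G p K k pG isT Y Fs.
- by rewrite -(ltr0n R); apply: lt_le_trans hY.
- move=> t X f' /mapP[X' X'Xs [-> -> ->]]; split=> //; [exact: gf|exact: hX|].
  rewrite size_map /=; apply: (@lt_le_trans _ _ (mu * (th * (p / 8) ^+ n * N))); last first.
    by rewrite ler_pM2r.
  have K0 := pseudo_K_ge0 pG.
  have h1 : (size Xs * k)%:R * K <= (5 * k)%:R * K.
    by apply: ler_wpM2r => //; rewrite ler_nat leq_mul // (leq_trans sXs).
  have h2 : 0 < mu * (th * (p / 8) ^+ n * N) by rewrite mulr_gt0.
  move: hK h1 h2; lra.
move: xY; rewrite in_cn take_oversize ?sf // => /andP[xX xf].
exists x; split=> //.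
  apply: flex_cons => //.
  - by apply: flex_sub fl _; apply: subD1set.
  - by move: xX; rewrite in_setD => /andP[].
  - by rewrite !inE eqxx.
move=> X XXs; apply: good_take; apply: hx.
by apply/mapP; exists X.
Qed.

Lemma good_minus X A B f : good 2 X f -> X :\: A \subset B -> B \subset X -> #|A|%:R <= mu ->
  good 1 B f.
Proof.
move=> gf sB BX hA; apply: (good_shrink p0 p1 th0 gf BX); apply: le_trans hA.
rewrite ler_nat; apply: subset_leq_card; apply/subsetP => x; rewrite in_setD => /andP[xB xX].
apply: contraR xB => xA; apply: (subsetP sB); by rewrite in_setD xA.
Qed.

(** One vertex [x] is prepended first: it restores the constant 2 of the front, so the piece can be
    removed from the sets before the connection is made. The terms of [T] count [x], the piece and
    the connection. *)
Lemma round Xs A F f b X0 v : state Xs A F f b -> X0 \in Xs -> (size Xs <= 4)%N ->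
  {in Xs, forall X, 2 * th * N + 1 <= #|X :\: A|%:R} ->
  v \notin X0 -> v \notin A -> v \notin F ->
  2 * th * (p / 8) * N + 1 <= #|nbs v (X0 :\: A)|%:R ->
  exists A' F' f', [/\ state Xs A' F' f' b,
    A \subset A', A' \subset A :|: X0 :|: (if absorb then set0 else [set v]),
    (#|A'| <= #|A| + T)%N &
    F' = (F :\: A') :|: (if absorb then [set v] else set0) /\
    (v \in (if absorb then F' else A'))].
Proof.
move=> st X0Xs sXs hX vX0 vA vF hv.
have [|x [xX0 fl1 g1]] := extend_state st X0Xs sXs.
  by move=> X XXs; have := hX X XXs; lra.
set f1 := take k (x :: f) in fl1 g1; set A1 := x |: A.
have {xX0} [xX0 xA] := setDP xX0.
have less1 (Y : {set V}) : #|Y :\: A|%:R - 1 <= #|Y :\: A1|%:R :> R.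
  have := card_minus R (Y :\: A) [set x]; rewrite cards1 setDDl setUC; lra.
pose Xs' := [seq X :\: A1 | X <- Xs].
have [||||| fM [bM [AM [flM AMs vM cM gM]]]] := @hP (X0 :\: A1) Xs' v.
- exact: map_f.
- by rewrite size_map.
- by move=> X' /mapP[X XXs ->]; have := less1 X; have := hX X XXs; lra.
- by rewrite in_setD (negbTE vX0) andbF.
- have : nbs v (X0 :\: A1) = nbs v (X0 :\: A) :\ x.
    by apply/setP => y; rewrite !inE negb_or; case: (y == x); case: (y \in A); case: (y \in X0).
  move=> ->; have := card_minus R (nbs v (X0 :\: A)) [set x]; rewrite cards1.
  move: hv; lra.
have vx : v != x by apply: contraNneq vX0 => ->.
have vA1 : v \notin A1 by rewrite in_setU1 negb_or vx.
have AMX y : y \in AM -> (y \notin A1) && ((y \in X0) || (~~ absorb && (y == v))).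
  move/(subsetP AMs); case: (absorb); rewrite /= ?orbF.
    by rewrite in_setD andbC => /andP[-> ->].
  rewrite in_setU1 => /orP[/eqP->|]; first by rewrite eqxx vA1 orbT.
  by rewrite in_setD => /andP[-> ->].
have [sfM sbM dM _] := flM.
have [kfM kbM _ _] := flex_kpath flM; have [kf1 _ _ _] := flex_kpath fl1.
have [sf1 _ _ _] := fl1.
have cT m : (m <= T)%N -> m%:R <= mu.
  by rewrite -(ler_nat R) => h; move: hT (ler0n R T); lra.
have gb : good 1 (X0 :\: (A1 :|: AM)) bM.
  have [_ h] := gM _ (map_f (fun X => X :\: A1) X0Xs).
  apply: (good_minus (A := AM) h); rewrite ?setDDl //; first by apply: setDS; apply: subsetUl.
  by apply: cT; rewrite (leq_trans cM) // -addnA addnCA leq_addr.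
have gf1 : good 1 (X0 :\: (A1 :|: AM)) f1.
  apply: (good_minus (A := x |: AM) (g1 _ X0Xs)).
  - by rewrite setDDl; apply/subsetP => y; rewrite !inE !negb_or => /andP[/andP[-> /andP[-> ->]] ->].
  - by apply: setDS; rewrite (subset_trans (subsetUr [set x] A)) // subsetUl.
  - apply: cT; rewrite (leq_trans (leq_card_setU _ _)) // cards1 -addnA leq_add2l.
    by rewrite (leq_trans cM) // leq_addr.
have [c [sc uc cX kc]] := hc sf1 sbM kf1 kbM gf1 gb.
have cX' y : y \in c -> [&& y \notin A1, y \notin AM & y \in X0].
  by move/cX; rewrite in_setD in_setU negb_or -andbA.
pose FM := if absorb then [set v] else set0.
have FMv y : y \in FM -> y = v by rewrite /FM; case: (absorb); rewrite inE // => /eqP.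
pose A' := AM :|: A1 :|: [set y in c].
have fl1' : flex f1 b A1 (F :\ x :\: (AM :|: [set y in c])).
  by apply: flex_sub fl1 _; apply: subsetDl.
have fl' : flex fM b A' (FM :|: (F :\ x :\: (AM :|: [set y in c]))).
  apply: flex_join flM fl1' uc kc _ _ => //.
    rewrite disjoint_subset; apply/subsetP => y; rewrite [y \in AM :|: _]in_setU inE.
    case/orP=> [yAM|/FMv->].
      have /andP[y1 _] := AMX y yAM.
      by rewrite in_setU (negbTE y1) /= in_setD in_setU yAM.
    by rewrite in_setU (negbTE vA1) /= in_setD in_setD1 (negbTE vF) !andbF.
  move=> y yc; have /and3P[h1 h2 h3] := cX' y yc; apply/andP; split.
    by rewrite in_setU negb_or h2 /=; apply/negP => /FMv e; move: h3; rewrite e (negbTE vX0).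
  by rewrite in_setU negb_or h1 /= in_setD in_setU inE yc orbT.
exists A', (FM :|: (F :\ x :\: (AM :|: [set y in c]))), fM; split.
- split=> // X XXs; have [h _] := gM _ (map_f (fun X => X :\: A1) XXs).
  apply: (good_minus (A := AM :|: [set y in c]) h).
  + rewrite setDDl; apply: setDS; apply/subsetP => y; rewrite !inE.
    by case: (y \in AM); case: (y \in A); case: (y \in c); case: (y == x).
  + by apply: setDS; rewrite /A' -setUA setUCA subsetUl.
  + apply: cT; rewrite (leq_trans (leq_card_setU _ _)) // -addnA addnC.
    rewrite addnA addnC leq_add ?(leq_trans cM) ?leq_addl // cardsE.
    by rewrite (leq_trans (card_size _)) // (leq_trans sc) // leq_addl.
- by apply/subsetP => y yA; rewrite !inE yA !orbT.
- apply/subsetP => y; rewrite /A' in_setU inE in_setU => /orP[/orP[/AMX/andP[_]|]|/cX'/and3P[_ _ yX]].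
  + case/orP=> [yX|/andP[ab yv]]; first by rewrite !in_setU yX orbT.
    by rewrite (negbTE ab) in_setU in_set1 yv orbT.
  + by rewrite in_setU1 => /orP[/eqP->|yA]; rewrite !in_setU ?xX0 ?yA ?orbT.
  + by rewrite !in_setU yX orbT.
- rewrite (leq_trans (leq_card_setU _ _)) //.
  have h1 : (#|A1| <= 1 + #|A|)%N by rewrite (leq_trans (leq_card_setU _ _)) // cards1.
  have h2 : (#|[set y in c]| <= Tc)%N.
    by rewrite cardsE (leq_trans (card_size _)).
  apply: leq_trans (leq_add (leq_trans (leq_card_setU _ _) (leq_add cM h1)) h2) _.
  by rewrite addnA (addnC Tp) addnAC addnC.
split.
  rewrite setUC; congr (_ :|: _); apply/setP => y; rewrite !inE !negb_or.
  case yF : (y \in F); rewrite ?andbF ?andbT //.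
  have -> : y \in A = false.
    by have [_ _ d _] := st.1; rewrite (disjointFl d yF).
  by case: (y \in AM); case: (y == x); case: (y \in c).
move: vM; rewrite /FM; case: (absorb) => /=; first by rewrite !inE eqxx.
by move=> h; rewrite /A' !inE h.
Qed.

End Rounds.

Section Loops.
Variables (R : realType) (V : finType) (G : sgraph V) (p th K : R) (n Tc Tp : nat).
Variable absorb : bool.
Hypothesis pG : pseudo G p K.
Local Notation N := (#|V|%:R : R).
Local Notation k := n.+1.
Local Notation nbs := (nbs G).
Local Notation flex := (flex G k).
Local Notation good := (good G p th k).
Local Notation state := (state G p th n).
Local Notation mu := (th * (p / 8) ^+ k * N).
Local Notation T := (1 + Tp + Tc)%N.
Hypotheses (th0 : 0 < th) (hc : connects G p th n Tc) (hP : piece_maker G p th k Tp absorb).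
Hypotheses (hT : 2 * T%:R < mu)
  (hK : 2 * (5 * k)%:R * K <= mu * (th * (p / 8) ^+ n * N)).
Implicit Types (A B F X Y : {set V}) (Xs : seq {set V}) (f b c s : seq V).

Let p0 : 0 < p. Proof. exact: ps_gt0 pG. Qed.
Let p1 : p <= 1. Proof. exact: ps_le1 pG. Qed.

Lemma mu_gt1 : 1 < mu.
Proof. by move: (hT) => h; move: h; rewrite -addnA natrD; have := ler0n R (Tp + Tc); lra. Qed.

(** A single prepended vertex gives the front constant 2, which pays for replacing every tracked set
    by a slightly smaller one. *)
Lemma switch Xs Xs' A F f b X0 : state Xs A F f b -> X0 \in Xs ->
  (size Xs <= 4)%N -> {in Xs, forall X, 2 * th * N <= #|X :\: A|%:R} ->
  {in Xs', forall X', exists X, [/\ X \in Xs, X' \subset X & #|X :\: X'|%:R + 1 <= mu]} ->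
  exists x f', x \in X0 :\: A /\ state Xs' (x |: A) (F :\ x) f' b.
Proof.
move=> st X0Xs sXs hX hX'; have [x [xX fl g]] := extend_state pG th0 hT hK st X0Xs sXs hX.
exists x, (take k (x :: f)); split=> //; split=> // X' /hX'[X [XXs sX cX]].
apply: (good_minus pG th0 (A := x |: (X :\: X')) (g X XXs)).
- rewrite setDDl; apply/subsetP => y; rewrite !inE !negb_or !negb_and !negbK.
  by case: (y == x); case: (y \in A); case: (y \in X'); case: (y \in X).
- apply/subsetP => y; rewrite !inE negb_or => /andP[/andP[_ ->]] /(subsetP sX) ->.
  by [].
- apply: le_trans cX; rewrite natr1 -add1n ler_nat.
  by rewrite (leq_trans (leq_card_setU _ _)) // cards1.
Qed.

(** This iterates [switch] with unchanged sets. The other tracked sets are disjoint from [X0], so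
    only [X0] is consumed. *)
Lemma greedy Xs A F f b X0 : state Xs A F f b -> X0 \in Xs -> (size Xs <= 4)%N ->
  2 * th * N <= #|X0 :\: A|%:R ->
  {in Xs, forall X, X = X0 \/ [disjoint X & X0] /\ 2 * th * N <= #|X :\: A|%:R} ->
  exists A1 f1, [/\ state Xs A1 (F :\: A1) f1 b, A \subset A1, A1 \subset A :|: X0,
    2 * th * N <= #|X0 :\: A1|%:R & #|X0 :\: A1|%:R < 2 * th * N + 1].
Proof.
move=> + X0Xs sXs; move: {2}#|X0 :\: A| (leqnn #|X0 :\: A|) => m.
elim: m A F f => [|m IH] A F f hm st hX0 hX.
all: have [h|h] := ltP (#|X0 :\: A|%:R : R) (2 * th * N + 1).
1,3: have dF : F :\: A = F by apply/setDidPl; rewrite disjoint_sym; have [_ _ d _] := st.1.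
1,2: by exists A, f; rewrite dF subsetUl.
- move: h; rewrite (eqP (_ : #|X0 :\: A| == 0)%N) -?leqn0 // => h.
  by have := mulr_ge0 (ltW th0) (ler0n R #|V|); move: h; lra.
have hXA : {in Xs, forall X, 2 * th * N <= #|X :\: A|%:R}.
  by move=> X XXs; have [->|[]] := hX X XXs.
have [|x [f' [xX st']]] := switch (Xs' := Xs) st X0Xs sXs hXA.
  by move=> X XXs; exists X; rewrite setDv cards0 add0r subxx ltW // mu_gt1.
have [xX0 xA] := setDP xX.
have c1 : #|X0 :\: (x |: A)|.+1 = #|X0 :\: A|.
  have -> : X0 :\: (x |: A) = (X0 :\: A) :\ x by rewrite setDDl setUC.
  by rewrite [RHS](cardsD1 x) xX.
have [|||A1 [f1 [st1 sA1 A1s h1 h2]]] := IH (x |: A) (F :\ x) f' _ st'.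
- by rewrite -ltnS c1.
- by move: h; rewrite -c1 -[X in _ <= X -> _]natr1 lerD2r.
- move=> X XXs; have [->|[d hd]] := hX X XXs; [by left|right; split=> //].
  apply: le_trans hd _; rewrite ler_nat; apply: subset_leq_card; apply/subsetP => y.
  rewrite !inE negb_or => /andP[-> yX]; rewrite yX !andbT.
  by apply/eqP => e; move: yX; rewrite e (disjointFl d xX0).
exists A1, f1; split=> //.
- have -> : F :\: A1 = F :\ x :\: A1; last by [].
  rewrite setDDl; congr (_ :\: _); apply/esym/setUidPr.
  by rewrite sub1set (subsetP sA1) // setU11.
- exact: subset_trans (subsetUr _ _) sA1.
- apply: (subset_trans A1s); rewrite -setUA subUset sub1set in_setU xX0 orbT /=.
  exact: subxx.
Qed.

Lemma loop Y Xs A F f b X0 : state Xs A F f b -> X0 \in Xs -> (size Xs <= 4)%N ->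
  [disjoint Y & X0] -> [disjoint Y & A] -> [disjoint Y & F] ->
  {in Xs, forall X (B : {set V}), B \subset X0 :|: (if absorb then set0 else Y) ->
     (#|B| <= T * #|Y|)%N -> 2 * th * N + 1 <= #|X :\: A :\: B|%:R} ->
  exists A1 F1 f1 Y1, [/\ Y1 \subset Y, state Xs A1 F1 f1 b, A \subset A1 &
    A1 \subset A :|: X0 :|: (if absorb then set0 else Y1)] /\
   [/\ (#|A1| <= #|A| + T * #|Y1|)%N, F1 = (F :\: A1) :|: (if absorb then Y1 else set0),
     absorb || (Y1 \subset A1) &
     forall v, v \in Y :\: Y1 -> #|nbs v (X0 :\: A1)|%:R < 2 * th * (p / 8) * N + 1].
Proof.
move=> + X0Xs sXs; move: {2}#|Y| (leqnn #|Y|) => m.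
have base A' F' f' : state Xs A' F' f' b -> exists A1 F1 f1 Y1,
   [/\ Y1 \subset set0, state Xs A1 F1 f1 b, A' \subset A1 &
    A1 \subset A' :|: X0 :|: (if absorb then set0 else Y1)] /\
   [/\ (#|A1| <= #|A'| + T * #|Y1|)%N, F1 = (F' :\: A1) :|: (if absorb then Y1 else set0),
     absorb || (Y1 \subset A1) &
     forall v, v \in set0 :\: Y1 -> #|nbs v (X0 :\: A1)|%:R < 2 * th * (p / 8) * N + 1].
  move=> st; exists A', F', f', set0; split; split=> //.
  - by rewrite -setUA subsetUl.
  - by rewrite cards0 muln0 addn0.
  - rewrite if_same setU0; apply/esym/setDidPl; rewrite disjoint_sym.
    by have [_ _ ?] := st.1.
  - by rewrite sub0set orbT.
  - by move=> v; rewrite !inE andbF.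
elim: m Y A F f => [|m IH] Y A F f hm st dX dA dF H.
  move: hm; rewrite leqn0 cards_eq0 => /eqP ->. exact: base st.
have [->|[v vY]] := set_0Vmem Y; first exact: base st.
have cY : #|Y| = #|Y :\ v|.+1 by rewrite (cardsD1 v) vY.
have sYv : Y :\ v \subset Y by apply: subsetDl.
have [h|h] := ltP (#|nbs v (X0 :\: A)|%:R : R) (2 * th * (p / 8) * N + 1).
  have [|||||A1 [F1 [f1 [Y1 [[Y1s st1 sA1 A1s] [cA1 eF1 Y1A1 hlow]]]]]] := IH (Y :\ v) A F f _ st.
  - by rewrite -ltnS -cY.
  - exact: disjointWl sYv dX.
  - exact: disjointWl sYv dA.
  - exact: disjointWl sYv dF.
  - move=> X XXs B Bs cB; apply: H => //.
      by apply: (subset_trans Bs); apply: setUS; case: (absorb).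
    by rewrite (leq_trans cB) // leq_mul // subset_leq_card.
  exists A1, F1, f1, Y1; split; split=> //; first exact: subset_trans Y1s sYv.
  move=> w; rewrite in_setD => /andP[wY1 wY]; have [->|wv] := eqVneq w v.
    apply: le_lt_trans h; rewrite ler_nat subset_leq_card //; apply: nbsS.
    by apply: setDS.
  by apply: hlow; rewrite !inE wY1 wv.
have [||||A' [F' [f' [st' sA' A's cA' [eF' vin]]]]] :=
    round pG th0 hc hP hT hK (v := v) st X0Xs sXs _ _ _ _ h.
- move=> X XXs; have := H X XXs set0; rewrite setD0 cards0; apply; by rewrite ?sub0set.
- by rewrite (disjointFr dX vY).
- by rewrite (disjointFr dA vY).
- by rewrite (disjointFr dF vY).
have [_ _ dAF' _] := st'.1.
have A'v y : y \in A' -> [|| y \in A, y \in X0 | ~~ absorb && (y == v)].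
  by move/(subsetP A's); rewrite !in_setU -orbA; case: (absorb); rewrite inE.
have YA' y : y \in Y :\ v -> y \notin A'.
  rewrite in_setD1 => /andP[yv yY]; apply/negP => /A'v.
  by rewrite (disjointFr dX yY) (disjointFr dA yY) (negbTE yv) andbF.
have YF' y : y \in Y :\ v -> y \notin F'.
  rewrite in_setD1 => /andP[yv yY]; rewrite eF' in_setU in_setD (disjointFr dF yY) andbF /=.
  by case: (absorb); rewrite inE.
have cD : (#|A' :\: A| <= T)%N.
  by rewrite cardsD (setIidPr sA') leq_subLR.
have [|||||A1 [F1 [f1 [Y1 [[Y1s st1 sA1 A1s] [cA1 eF1 Y1A1 hlow]]]]]] := IH (Y :\ v) A' F' f' _ st'.
- by rewrite -ltnS -cY.
- exact: disjointWl sYv dX.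
- by rewrite disjoint_subset; apply/subsetP => y /YA'.
- by rewrite disjoint_subset; apply/subsetP => y /YF'.
- move=> X XXs B Bs cB; have -> : X :\: A' :\: B = X :\: A :\: ((A' :\: A) :|: B).
    rewrite !setDDl; congr (_ :\: _); rewrite setUA -{1}(setUidPr sA'); congr (_ :|: _).
    by apply/setP => y; rewrite !inE; case: (y \in A).
  apply: H => //; last first.
    by rewrite (leq_trans (leq_card_setU _ _)) // cY mulnS leq_add.
  rewrite subUset; apply/andP; split; last first.
    by apply: (subset_trans Bs); apply: setUS; case: (absorb).
  apply/subsetP => y; rewrite in_setD => /andP[yA /A'v]; rewrite (negbTE yA) /= in_setU.
  by case/orP=> [->//|/andP[/negbTE-> /eqP->]]; rewrite vY orbT.
have A1v y : y \in A1 -> [|| y \in A', y \in X0 | ~~ absorb && (y \in Y1)].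
  by move/(subsetP A1s); rewrite !in_setU -orbA; case: (absorb) => //; rewrite inE.
have vY1 : v \notin Y1 by apply/negP => /(subsetP Y1s); rewrite !inE eqxx.
exists A1, F1, f1, (v |: Y1); split; split=> //.
- by rewrite subUset sub1set vY (subset_trans Y1s).
- exact: subset_trans sA' sA1.
- apply/subsetP => y /A1v; rewrite !in_setU => /or3P[/A'v/or3P[->//|->|/andP[/negbTE-> /eqP->]]|->|/andP[/negbTE->]];
    rewrite ?orbT //; first by rewrite setU11 orbT.
  by move=> yY; rewrite in_setU1 yY !orbT.
- rewrite (leq_trans cA1) // (leq_trans (leq_add cA' (leqnn _))) // cardsU1 vY1 /=.
  by rewrite add1n mulnS -[X in (X <= _)%N]addnA.
- rewrite eF1 eF'; case ab: (absorb) => /=.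
    rewrite ab in A1v vin; rewrite setDUl setUAC -setUA; congr (_ :|: _).
      by rewrite setDDl (setUidPr sA1).
    rewrite setUC; congr (_ :|: _); apply/setDidPl.
    rewrite disjoints1; apply/negP => /A1v.
    rewrite (disjointFl dAF' vin) orbF; have := disjointFr dX vY; by case: (v \in X0).
  by rewrite !setU0 setDDl (setUidPr sA1).
- case ab: (absorb) => //=; rewrite ab /= in Y1A1 vin.
  by rewrite subUset sub1set (subsetP sA1).
- move=> w; rewrite in_setD in_setU1 negb_or => /andP[/andP[wv wY1] wY].
  by apply: hlow; rewrite !inE wY1 wv.
Qed.

End Loops.
Lemma setD_chain (V : finType) (X A B : {set V}) : A \subset B ->
  X :\: B = X :\: A :\: (B :\: A).
Proof.
move=> /subsetP sAB; apply/setP => x; rewrite !inE; have := sAB x.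
by case: (x \in A); case: (x \in B); case: (x \in X) => // /(_ isT).
Qed.

(** * A spanning cyclic order *)

Section Assembly.
Variables (R : realType) (V : finType) (G : sgraph V) (p th K : R) (n Tc Tp Ta T : nat).
Hypothesis pG : pseudo G p K.
Local Notation N := (#|V|%:R : R).
Local Notation k := n.+1.
Local Notation nbs := (nbs G).
Local Notation flex := (flex G k).
Local Notation good := (good G p th k).
Local Notation state := (state G p th n).
Local Notation mu := (th * (p / 8) ^+ k * N).
Local Notation t := (th * N).
Local Notation q := (K / t).
Hypotheses (th0 : 0 < th) (hc : connects G p th n Tc)
  (hP : piece_maker G p th k Tp false) (hA : piece_maker G p th k Ta true)
  (TP : (1 + Tp + Tc <= T)%N) (TA : (1 + Ta + Tc <= T)%N) (kT : (k <= T)%N)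
  (hT : 8 * T%:R * (q + 2) <= mu) (hth : 256 * T%:R ^+ 2 * th <= 1)
  (hK : 2 * (5 * k)%:R * K <= mu * (th * (p / 8) ^+ n * N)).
Hypothesis hdeg : forall v, t * p <= #|nbs v setT|%:R.
Implicit Types (A B F X Y : {set V}) (Xs : seq {set V}) (f b c s : seq V).

Let p0 : 0 < p. Proof. exact: ps_gt0 pG. Qed.
Let p1 : p <= 1. Proof. exact: ps_le1 pG. Qed.
Let K0 : 0 <= K. Proof. exact: pseudo_K_ge0 pG. Qed.
Let t0 : 0 <= t. Proof. by rewrite mulr_ge0 // ltW. Qed.
Let q0 : 0 <= q. Proof. by rewrite divr_ge0. Qed.
Let T1 : 1 <= T%:R :> R. Proof. by rewrite ler1n (leq_trans _ kT). Qed.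

Let mut : mu <= t * p / 8.
Proof.
have -> : mu = t * (p / 8) * (p / 8) ^+ n by rewrite exprS; ring.
rewrite -[X in _ <= X]mulrA ler_piMr //.
  by rewrite mulr_ge0 // divr_ge0 // ltW.
by apply: exprn_ile1; move: p0 p1; lra.
Qed.

(** The number 128 comes from 16 <= 16 T <= mu <= t p / 8. *)
Let sizes : [/\ t * p <= t, 16 * T%:R + 8 * (T%:R * q) <= mu, q <= T%:R * q, 128 <= t
  & t <= T%:R * t].
Proof.
have h1 : t * p <= t by rewrite ler_piMr.
have h2 : 16 * T%:R + 8 * (T%:R * q) <= mu by move: hT; rewrite mulrDr; lra.
have h3 : q <= T%:R * q by rewrite ler_peMl.
have h4 : t <= T%:R * t by rewrite ler_peMl.
split=> //; move: (mut) (T1) (q0) h1 h2 h3; lra.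
Qed.

Let low_q X : t <= #|X|%:R -> #|lowset G p X|%:R <= q.
Proof. by apply: (low_le pG); have [_ _ _ h _] := sizes; move: h; lra. Qed.

Let T_mul (T' m y : nat) (z : R) : (T' <= T)%N -> (m <= T' * y)%N -> y%:R <= z ->
  m%:R <= T%:R * z.
Proof.
move=> h1 h2 h3; apply: le_trans (_ : (T * y)%:R <= _).
  by rewrite ler_nat (leq_trans h2) // leq_mul.
by rewrite natrM ler_wpM2l.
Qed.

(** The upper bound lets both sets be absorbed, at [T] vertices for each of their elements, with at
    most N/8 vertices. The lower bound leaves room to cover about 3t left-over vertices at the same
    price. *)
Lemma reservoirs : exists R1 R2 : {set V}, [/\ [disjoint R1 & R2], #|R1| = #|R2|,
  15 * (T%:R * t) <= #|R1|%:R & 16 * (T%:R * #|R1|%:R) <= N].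
Proof.
have [h1 h2 h3 h4 h5] := sizes.
have T0 : (0 < T)%N by rewrite (leq_trans _ kT).
pose r := (#|V| %/ (16 * T))%N.
have rV : (r * (16 * T) <= #|V|)%N := leq_divM _ _.
have r2 : (r + r <= #|V|)%N.
  apply: leq_trans rV; rewrite addnn -mul2n mulnC leq_mul2l; apply/orP; right.
  by rewrite (leq_trans (_ : 2 <= 16 * 1)%N) // leq_mul2l.
have [R1 _ c1] := subset_card (leq_trans (leq_addr r r) (eq_ind_r (fun m => (r + r <= m)%N) r2 (cardsT V))).
have cC : (r <= #|~: R1|)%N by rewrite cardsCs setCK c1 -(leq_add2r r) subnK // (leq_trans _ r2) ?leq_addr.
have [R2 sR2 c2] := subset_card cC.
exists R1, R2; split=> //.
- by rewrite disjoint_sym disjoints_subset.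
- by rewrite c1 c2.
- rewrite c1.
  have : N < (r.+1 * (16 * T))%:R by rewrite ltr_nat ltn_ceil // muln_gt0.
  rewrite !natrM -natr1 => h.
  have hN : 256 * T%:R * (T%:R * t) <= N.
    have -> : 256 * T%:R * (T%:R * t) = (256 * T%:R ^+ 2 * th) * N by rewrite expr2; ring.
    by rewrite ler_piMl.
  have : 16 * T%:R * (16 * (T%:R * t)) < 16 * T%:R * (r%:R + 1).
    by move: h hN; rewrite [r%:R + 1]addrC; move: (T%:R * t) => y; lra.
  rewrite ltr_pM2l; last by move: T1; lra.
  move: h4 h5; lra.
rewrite c1; move: rV; rewrite -(ler_nat R) !natrM; lra.
Qed.

Section Reservoirs.
Variables S1 S2 : {set V}.
Hypotheses (dS : [disjoint S1 & S2]) (cS : #|S1| = #|S2|)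
  (S1l : 15 * (T%:R * t) <= #|S1|%:R) (S1u : 16 * (T%:R * #|S1|%:R) <= N).
Local Notation Q := (lowset G p S2).
Local Notation U := (~: (S1 :|: S2 :|: Q)).
Local Notation R1 := (S1 :\: Q).
Local Notation R2 := (S2 :\: Q).

Let cQ : #|Q|%:R <= q.
Proof. by have [_ _ _ h1 h2] := sizes; apply: low_q; rewrite -cS; move: (S1l) h1 h2; lra. Qed.

Let cR1 : 15 * (T%:R * t) - q <= #|R1|%:R.
Proof. by have := card_minus R S1 Q; move: (S1l) cQ; lra. Qed.

Let cR2 : 15 * (T%:R * t) - q <= #|R2|%:R.
Proof. by have := card_minus R S2 Q; rewrite -cS; move: (S1l) cQ; lra. Qed.

Let hT2 Tx : (1 + Tx + Tc <= T)%N -> 2 * (1 + Tx + Tc)%:R < mu.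
Proof.
rewrite -(ler_nat R) => h; have [_ h1 _ h2 _] := sizes.
by have := mulr_ge0 (ler0n R T) q0; move: h h1 h2 (T1); lra.
Qed.

Let smallS : T%:R * #|S1|%:R <= N / 16 /\ #|S1|%:R <= N / 16.
Proof.
have h : #|S1|%:R <= T%:R * #|S1|%:R :> R by rewrite ler_peMl.
by move: (S1u) h; lra.
Qed.

Let bigN : 240 * (T%:R * t) <= N.
Proof. by have [_ h] := smallS; move: (S1l) h; lra. Qed.

Let cU : 7 / 8 * N - q <= #|U|%:R.
Proof.
have h : #|S1 :|: S2 :|: Q|%:R <= #|S1|%:R + #|S1|%:R + #|Q|%:R :> R.
  rewrite -!natrD ler_nat (leq_trans (leq_card_setU _ _)) // leq_add2r.
  by rewrite (leq_trans (leq_card_setU _ _)) // cS.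
have := card_minus R setT (S1 :|: S2 :|: Q); rewrite setTD cardsT.
have [_] := smallS; move: h cQ; lra.
Qed.

(** [Q] is covered at the start, with the help of all other vertices, because its vertices may have
    no neighbours in [S2]. The back end is made extendable in [R2], where the path will be
    closed. *)
Lemma initial : exists A f b, [/\ state [:: U; R1; R2] A set0 f b, Q \subset A,
  #|A|%:R <= k%:R + T%:R * q & good 2 R2 b].
Proof.
have [h1 h2 h3 h4 h5] := sizes.
have kTR : k%:R <= T%:R :> R by rewrite ler_nat.
have Tq0 := mulr_ge0 (ler0n R T) q0.
have cP : 7 / 8 * N - q <= #|~: Q|%:R.
  apply: (le_trans cU); rewrite ler_nat; apply: subset_leq_card.
  by rewrite setCS subsetUr.
pose Xs := [:: ~: Q; U; R1; R2].
have big : {in Xs, forall X, 14 * (T%:R * t) <= #|X|%:R}.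
  move=> X; rewrite !inE => /or4P[]/eqP->; move: (T1) (bigN) (cP) (cU) (cR1) (cR2) (mut) h1 h2 h3 h4 h5; lra.
have hK' : 2 * ((size Xs).+1 * k)%:R * K <= mu * (th * (p / 8) ^+ k.-1 * N) := hK.
have [||||l [sl ul lX kl [gl1 gl2]]] := @grow R V G p th K k pG isT th0 (~: Q) set0 th [::] Xs k th0 isT _ _ _ _ hK' hK'.
- apply: (good_nil pG) => //; rewrite mul1r.
  by apply: le_trans (big _ (mem_head _ _)); move: t0 h5; lra.
- by apply: le_trans (big _ (mem_head _ _)); move: t0 h5; lra.
- by move=> X /big h; move: h t0 h5; lra.
- by rewrite cards0 add0n; move: kTR (T1) h2 Tq0; lra.
rewrite cats0 in kl.
have gl X : X \in Xs -> good 2 X l.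
  by move=> XXs; have := gl2 X XXs k (leqnn _); rewrite subnn drop0.
have gr X : X \in Xs -> good 2 X (rev l).
  move=> XXs i ik; have := gl2 X XXs i ik i ik.
  by rewrite take_oversize ?size_drop ?sl ?subKn // take_rev sl cn_rev.
have tk : take k l = l by rewrite take_oversize // sl.
have st : state Xs [set x in l] set0 l (rev l).
  split.
    split; rewrite ?size_rev // ?sl //; first by rewrite disjoint_sym -setI_eq0 set0I.
    move=> W; rewrite subset0 => /eqP->; exists l; split=> //.
      by move=> y; rewrite setU0 inE.
    by rewrite take_oversize // size_rev sl.
  move=> X XXs; apply: (good_minus pG th0 (A := [set x in l]) (gl X XXs)) => //.
    exact: subsetDl.
  apply: le_trans (_ : k%:R <= _); last by move: kTR (T1) h2 Tq0; lra.
  by rewrite ler_nat cardsE -sl card_size.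
have cl : #|[set x in l]|%:R <= k%:R :> R by rewrite ler_nat cardsE -sl card_size.
have TQ : T%:R * #|Q|%:R <= T%:R * q by rewrite ler_wpM2l.
have [||||A1 [F1 [f1 [Y1 [[Y1s st1 sA1 A1s] [cA1 eF1 Y1A1 hlow]]]]]] :=
  loop pG th0 hc hP (hT2 TP) hK (Y := Q) st (mem_head _ _) isT.
- by rewrite -setI_eq0 setICr.
- by rewrite disjoint_subset; apply/subsetP => x xQ; rewrite !inE; apply: contraL xQ => /lX; rewrite !inE.
- by rewrite disjoint_sym -setI_eq0 set0I.
- move=> X XXs B Bs cB.
  have hB : #|B|%:R <= T%:R * q := T_mul TP cB cQ.
  have e1 := card_minus R X [set x in l]; have e2 := card_minus R (X :\: [set x in l]) B.
  have := big X XXs; move: e1 e2 hB cl kTR h1 h2 h3 h4 h5 (mut) (T1); lra.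
rewrite /= in Y1A1.
have cA1' : #|A1|%:R <= k%:R + T%:R * q.
  have cY1 : #|Y1|%:R <= q by apply: le_trans cQ; rewrite ler_nat subset_leq_card.
  have e1 : #|A1|%:R <= (#|[set x in l]| + (1 + Tp + Tc) * #|Y1|)%:R :> R by rewrite ler_nat.
  apply: (le_trans e1); rewrite natrD lerD //.
  exact: T_mul TP (leqnn _) cY1.
(* No vertex of [Q] is skipped: its degree is at least t p, and [Q] and [A1] are too small to reduce
   this below about t p / 4. This is the use of the minimum degree. *)
have eY1 : Y1 = Q.
  apply/eqP; rewrite eqEsubset Y1s /=; apply/subsetP => v vQ; apply: contraT => vY.
  have := hlow v; rewrite in_setD vY vQ => /(_ isT) h.
  have e : nbs v (~: Q :\: A1) = nbs v setT :\: Q :\: A1.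
    by apply/setP => x; rewrite !inE; case: (x \in A1); case: (adj _ _ _); rewrite ?andbF ?andbT.
  have e1 := card_minus R (nbs v setT) Q; have e2 := card_minus R (nbs v setT :\: Q) A1.
  rewrite -e in e2; have := hdeg v.
  have e3 : 2 * th * (p / 8) * N = t * p / 4 by field.
  rewrite e3 in h; move: h e1 e2 cA1' (cQ) kTR h2 h3 (mut) (T1); lra.
exists A1, f1, (rev l); split=> //.
- have -> : set0 = F1 by rewrite eF1 setU0 set0D.
  by split; [exact: st1.1|move=> X XXs; apply: st1.2; rewrite inE XXs orbT].
- by rewrite -{1}eY1.
- by apply: gr; rewrite !inE eqxx !orbT.
Qed.

Let numbers : [/\ 1 <= T%:R :> R, k%:R <= T%:R :> R, 0 <= T%:R * q, t * p <= t &
  [/\ 16 * T%:R + 8 * (T%:R * q) <= mu, q <= T%:R * q, 128 <= t, t <= T%:R * t & mu <= t * p / 8]].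
Proof. by have [h1 h2 h3 h4 h5] := sizes; split; rewrite ?ler_nat // mulr_ge0. Qed.

(** [E] consists of the reservoir vertices that were skipped and are not absorbed. They have to be
    covered later like the remainder of [U], so they leave the reservoirs. *)
Lemma fill A1 f1 b : state [:: U; R1; R2] A1 set0 f1 b -> Q \subset A1 ->
  #|A1|%:R <= k%:R + T%:R * q ->
  exists A F f E, [/\ state [:: R1 :\: E; R2 :\: E] A F f b, A1 \subset A, A \subset A1 :|: U &
    [/\ #|E|%:R <= q, ~: (A :|: F) \subset U :|: E & #|~: (A :|: F)|%:R <= 2 * t + 1 + q]].
Proof.
move=> st QA1 cA1; have [n1 n2 n3 n4 [n5 n6 n7 n8 n9]] := numbers.
have UR x : x \in U -> (x \notin R1) && (x \notin R2).
  rewrite in_setC !in_setU !negb_or !in_setD => /andP[/andP[x1 x2] x3].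
  by rewrite (negbTE x1) (negbTE x2) !andbF.
pose Y := (R1 :|: R2) :\: A1.
have dYU : [disjoint Y & U].
  rewrite disjoint_sym disjoint_subset; apply/subsetP => x /UR/andP[x1 x2].
  by rewrite inE in_setD in_setU (negbTE x1) (negbTE x2) andbF.
have cY : #|Y|%:R <= #|S1|%:R + #|S1|%:R :> R.
  rewrite -natrD ler_nat {2}cS.
  rewrite (leq_trans (subset_leq_card (subsetDl _ _))) // (leq_trans (leq_card_setU _ _)) //.
  by rewrite leq_add // subset_leq_card // subsetDl.
have dUR X : X \in [:: R1; R2] -> [disjoint X & U].
  move=> XR; rewrite disjoint_sym disjoint_subset; apply/subsetP => x /UR/andP[x1 x2].
  by move: XR; rewrite !inE => /orP[]/eqP->; [exact: x1|exact: x2].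
have RA X : X \in [:: R1; R2] -> 14 * (T%:R * t) <= #|X :\: A1|%:R.
  move=> XR; have e1 := card_minus R X A1.
  have : 15 * (T%:R * t) - q <= #|X|%:R.
    by move: XR; rewrite inE => /orP[/eqP->|]; last rewrite inE => /eqP->.
  by move: e1 cA1 n1 n2 n3 n4 n5 n6 n7 n8 n9; lra.
have RAU X B : X \in [:: R1; R2] -> B \subset U -> X :\: A1 :\: B = X :\: A1.
  move=> XR BU; apply/setDidPl; apply: disjointWl (subsetDl X A1) _.
  exact: disjointWr BU (dUR X XR).
have cUA : 7 / 8 * N - q - (k%:R + T%:R * q) <= #|U :\: A1|%:R.
  by have := card_minus R U A1; move: (cU) cA1; lra.
have [sS1 sS2] := smallS; have bN := bigN.
have [|||A2 [F2 [f2 [Y2 [[Y2s st2 sA2 A2s] [cA2 eF2 _ hlow]]]]]] :=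
  loop pG th0 hc hA (hT2 TA) hK (Y := Y) st (mem_head _ _) isT dYU.
- by rewrite disjoint_subset; apply/subsetP => x; rewrite in_setD => /andP[].
- by rewrite disjoint_sym -setI_eq0 set0I.
- move=> X XXs B Bs cB; rewrite /= setU0 in Bs; move: XXs; rewrite inE => /orP[/eqP->|XR]; last first.
    by rewrite RAU // ; have := RA X XR; move: n1 n7 n8; lra.
  have e1 := card_minus R (U :\: A1) B; have := T_mul TA cB cY; rewrite mulrDr.
  by move: e1 cUA sS1 bN n1 n2 n3 n4 n5 n6 n7 n8 n9; lra.
rewrite /= setU0 in A2s; rewrite /= set0D set0U in eF2; subst F2.
have cY2 : #|Y2|%:R <= #|S1|%:R + #|S1|%:R :> R.
  by apply: le_trans cY; rewrite ler_nat subset_leq_card.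
have cA2' : #|A2|%:R <= k%:R + T%:R * q + (T%:R * #|S1|%:R + T%:R * #|S1|%:R).
  have e : #|A2|%:R <= (#|A1| + (1 + Ta + Tc) * #|Y2|)%:R :> R by rewrite ler_nat.
  apply: (le_trans e); rewrite natrD lerD // -mulrDr; exact: T_mul TA (leqnn _) cY2.
have cUA2 : 1 / 2 * N <= #|U :\: A2|%:R.
  have := card_minus R U A2; move: (cU) cA2' sS1 bN n1 n2 n3 n4 n5 n6 n7 n8 n9; lra.
pose E := Y :\: Y2.
have cE : #|E|%:R <= q.
  apply: le_trans (low_q (X := U :\: A2) _); last by move: cUA2 bN n8 t0; lra.
  rewrite ler_nat subset_leq_card //; apply/subsetP => v vE; rewrite inE.
  apply: lt_le_trans (hlow v vE) _.
  have e3 : 2 * th * (p / 8) * N = t * p / 4 by field.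
  have h : p / 4 * (1 / 2 * N) <= p / 4 * #|U :\: A2|%:R.
    by rewrite ler_wpM2l // divr_ge0 // ltW.
  have h' : p * (240 * t) <= p * N.
    by rewrite ler_wpM2l ?(ltW p0) //; move: bN n8; lra.
  by rewrite e3; move: h h' n1 n3 n5 n9 n7; lra.
have [|X XXs|A3 [f3 [st3 sA3 A3s A3l A3u]]] :=
    greedy pG th0 (hT2 TP) hK st2 (mem_head _ _) isT.
- by move: cUA2 bN n8 t0; lra.
- move: XXs; rewrite inE => /orP[/eqP->|XR]; [by left|right; split; first exact: dUR].
  apply: (@le_trans _ _ (#|X :\: A1|%:R)); first by have := RA X XR; move: n1 n7 n8 t0; lra.
  rewrite ler_nat subset_leq_card //; apply/subsetP => x; rewrite !in_setD => /andP[xA1 xX].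
  rewrite xX andbT; apply/negP => /(subsetP A2s); rewrite in_setU (negbTE xA1) /=.
  by rewrite (disjointFr (dUR X XR) xX).
have A3s' : A3 \subset A1 :|: U.
  by apply: (subset_trans A3s); rewrite subUset A2s subsetUr.
have Y2A x : x \in Y2 -> (x \notin A1) && (x \notin U).
  move/(subsetP Y2s) => xY; rewrite (disjointFr dYU xY) andbT.
  by move: xY; rewrite in_setD => /andP[].
have eF : Y2 :\: A3 = Y2.
  apply/setDidPl; rewrite disjoint_subset; apply/subsetP => x /Y2A/andP[x1 x2].
  by rewrite inE; apply: contra x1 => /(subsetP A3s'); rewrite in_setU (negbTE x2) orbF.
rewrite eF in st3.
have RA3 X : X \in [:: R1; R2] -> 2 * th * N <= #|X :\: A3|%:R.
  move=> XR; apply: (@le_trans _ _ (#|X :\: A1|%:R)); first by have := RA X XR; move: n1 n7 n8 t0; lra.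
  rewrite ler_nat subset_leq_card //; apply/subsetP => x; rewrite !in_setD => /andP[xA1 xX].
  rewrite xX andbT; apply/negP => /(subsetP A3s'); rewrite in_setU (negbTE xA1) /=.
  by rewrite (disjointFr (dUR X XR) xX).
(* [U] is exhausted and no longer tracked; the last vertex is taken from it, and the reservoirs lose
   [E]. *)
have [||x [f4 [xU st4]]] := switch pG th0 (hT2 TP) hK (Xs' := [:: R1 :\: E; R2 :\: E]) st3 (mem_head _ _) isT.
- by move=> X; rewrite inE => /orP[/eqP->//|]; exact: RA3.
- move=> X' h; have [X [XR eX]] : exists X, X \in [:: R1; R2] /\ X' = X :\: E.
    by move: h; rewrite !inE => /orP[]/eqP->; [exists R1|exists R2]; rewrite !inE eqxx ?orbT.
  exists X; rewrite eX subsetDl inE XR orbT; split=> //.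
  have : #|X :\: (X :\: E)|%:R <= #|E|%:R :> R.
    rewrite ler_nat subset_leq_card //; apply/subsetP => y; rewrite !in_setD negb_and negbK.
    by case: (y \in X); rewrite ?andbT ?andbF ?orbF.
  by move: cE n1 n3 n5 n6; lra.
have [xU0 xA3] := setDP xU.
have xY2 : x \notin Y2 by apply: contraL xU0 => /Y2A/andP[].
have eY2 : Y2 :\ x = Y2 by apply/setDidPl; rewrite disjoint_sym disjoints1.
rewrite eY2 in st4.
have sL : ~: ((x |: A3) :|: Y2) \subset (U :\: A3) :|: E.
  apply/subsetP => y; rewrite !(inE, negb_or) -/E => /andP[/andP[_ yA3] yY2].
  have yA1 : y \notin A1 by apply: contra yA3; apply/subsetP; exact: subset_trans sA2 sA3.
  have yQ : y \notin Q by apply: contra yA1; apply/subsetP.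
  move: yQ; rewrite inE => yQ; rewrite yA3 yQ yA1 yY2 /=.
  by case: (y \in S1); case: (y \in S2).
exists (x |: A3), Y2, f4, E; split=> //.
- by rewrite (subset_trans _ (subsetUr _ _)) // (subset_trans sA2).
- by rewrite subUset sub1set in_setU xU0 orbT.
split=> //.
  apply: (subset_trans sL); apply: setSU; exact: subsetDl.
apply: (@le_trans _ _ (#|U :\: A3| + #|E|)%:R).
  by rewrite ler_nat (leq_trans (subset_leq_card sL)) // leq_card_setU.
by rewrite natrD; move: A3u cE; lra.
Qed.

(** After the rounds in [R1] at most [q] vertices are uncovered. Apart from [E], nothing of [R2] has
    been used since [initial], so these vertices, being outside [Q], have enough neighbours there
    and none is skipped again. *)
Lemma reservoir_cycle : exists z, [/\ uniq z, z =i setT & kpath G k (z ++ take k z)].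
Proof.
have [n1 n2 n3 n4 [n5 n6 n7 n8 n9]] := numbers.
have e3 : 2 * th * (p / 8) * N = t * p / 4 by field.
have [A1 [f1 [b [st1 QA1 cA1 gb]]]] := initial.
have [A4 [F2 [f4 [E [st4 A14 A4s [cE Ls cL]]]]]] := fill st1 QA1 cA1.
set L := ~: (A4 :|: F2) in Ls cL.
have UR x : x \in U -> (x \notin R1) && (x \notin R2).
  rewrite in_setC !in_setU !negb_or !in_setD => /andP[/andP[x1 x2] x3].
  by rewrite (negbTE x1) (negbTE x2) !andbF.
have RE X x : X \in [:: R1; R2] -> x \in X :\: E -> (x \notin U) && (x \notin L).
  move=> XR; rewrite in_setD => /andP[xE xX].
  have xU : x \notin U.
    apply/negP => /UR/andP[x1 x2]; move: XR; rewrite !inE => /orP[]/eqP e; move: xX; rewrite e.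
      by rewrite (negbTE x1).
    by rewrite (negbTE x2).
  by rewrite xU; apply: contra xE => /(subsetP Ls); rewrite in_setU (negbTE xU).
have i1 : R1 \in [:: R1; R2] by rewrite inE eqxx.
have i2 : R2 \in [:: R1; R2] by rewrite !inE eqxx orbT.
have R12 x : x \in R1 -> x \in R2 -> False.
  by rewrite !in_setD => /andP[_ xS] /andP[_]; rewrite (disjointFr dS xS).
have dLR X : X \in [:: R1; R2] -> [disjoint L & X :\: E].
  move=> XR; rewrite disjoint_sym disjoint_subset; apply/subsetP => x /(RE X x XR)/andP[_ h].
  exact: h.
have RA4 X : X \in [:: R1; R2] -> 14 * (T%:R * t) <= #|(X :\: E) :\: A4|%:R.
  move=> XR; have e1 := card_minus R X E; have e2 := card_minus R (X :\: E) A1.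
  have e4 : (X :\: E) :\: A4 = (X :\: E) :\: A1.
    apply/setP => x; rewrite [LHS]in_setD [RHS]in_setD.
    have [xX|] := boolP (x \in X :\: E); rewrite ?andbF // !andbT; congr (~~ _).
    apply/idP/idP => [/(subsetP A4s)|/(subsetP A14)//].
    by rewrite in_setU; case/andP: (RE X x XR xX) => /negbTE-> _; rewrite orbF.
  have : 15 * (T%:R * t) - q <= #|X|%:R.
    by move: XR; rewrite inE => /orP[/eqP->|]; last rewrite inE => /eqP->.
  by rewrite e4; move: e1 e2 cE cA1 n1 n2 n3 n4 n5 n6 n7 n8 n9; lra.
have cL3 : #|L|%:R <= 3 * t by move: cL n1 n3 n4 n5 n6 n7 n9; lra.
have TL (m y : nat) : (m <= (1 + Tp + Tc) * y)%N -> (y <= #|L|)%N -> m%:R <= 3 * (T%:R * t).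
  move=> h1 h2; have -> : 3 * (T%:R * t) = T%:R * (3 * t) by ring.
  by apply: T_mul TP h1 _; apply: le_trans cL3; rewrite ler_nat.
have [|||A5 [F5 [f5 [Y5 [[Y5s st5 sA5 A5s] [cA5 eF5 Y5A5 hlow5]]]]]] :=
  loop pG th0 hc hP (hT2 TP) hK (Y := L) st4 (mem_head _ _) isT (dLR _ i1).
- rewrite disjoint_sym disjoint_subset; apply/subsetP => x xA.
  by rewrite !inE xA.
- rewrite disjoint_sym disjoint_subset; apply/subsetP => x xA.
  by rewrite !inE xA orbT.
- move=> X XXs B _ cB.
  have [X' [X'R ->]] : exists X', X' \in [:: R1; R2] /\ X = X' :\: E.
    by move: XXs; rewrite !inE => /orP[]/eqP->; [exists R1|exists R2]; rewrite !inE eqxx ?orbT.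
  have := TL _ _ cB (leqnn _); have := RA4 X' X'R.
  have := card_minus R ((X' :\: E) :\: A4) B; move: n7 n8; lra.
rewrite /= in A5s Y5A5; rewrite /= setU0 in eF5; subst F5.
have cA54 : #|A5 :\: A4|%:R <= 3 * (T%:R * t).
  apply: (TL _ #|Y5|); last exact: subset_leq_card.
  by rewrite cardsD (setIidPr sA5) leq_subLR.
pose L2 := L :\: Y5.
have cL2 : #|L2|%:R <= q.
  apply: le_trans (low_q (X := (R1 :\: E) :\: A5) _); last first.
    have := RA4 R1 i1; have := card_minus R (R1 :\: E :\: A4) (A5 :\: A4).
    by rewrite -(setD_chain _ sA5); move: cA54 n8 t0; lra.
  rewrite ler_nat subset_leq_card //; apply/subsetP => v vL; rewrite inE.
  apply: lt_le_trans (hlow5 v vL) _; rewrite e3.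
  have h : p / 4 * (11 * (T%:R * t)) <= p / 4 * #|R1 :\: E :\: A5|%:R.
    rewrite ler_wpM2l ?divr_ge0 ?(ltW p0) //.
    have := RA4 R1 i1; have := card_minus R (R1 :\: E :\: A4) (A5 :\: A4).
    by rewrite -(setD_chain _ sA5); move: cA54 n8 t0; lra.
  have h' : p * t <= p * (T%:R * t) by rewrite ler_wpM2l ?(ltW p0).
  by move: h h' n1 n3 n5 n9 n7; lra.
have sL2 : L2 \subset L by apply: subsetDl.
have LA4 x : x \in L -> (x \notin A4) && (x \notin F2) by rewrite !inE negb_or.
have R2A5 x : x \in R2 :\: E -> x \in A5 -> x \in A1.
  move=> xR /(subsetP A5s); have /andP[xU xL] := RE R2 x i2 xR.
  rewrite !in_setU => /orP[/orP[/(subsetP A4s)|]|/(subsetP Y5s)]; last by rewrite (negbTE xL).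
    by rewrite in_setU (negbTE xU) orbF.
  rewrite in_setD => /andP[_ x1]; move: xR; rewrite in_setD => /andP[_ x2].
  by case: (R12 x).
have cRA5 : 14 * (T%:R * t) <= #|R2 :\: E :\: A5|%:R.
  apply: (le_trans (RA4 R2 i2)); rewrite ler_nat subset_leq_card //.
  apply/subsetP => x; rewrite in_setD => /andP[xA4 xR]; rewrite in_setD xR andbT.
  by apply: contra xA4 => /(R2A5 x xR); apply/subsetP.
have st5' : state [:: R2 :\: E] A5 (F2 :\: A5) f5 b.
  by split; [exact: st5.1|move=> X XXs; apply: st5.2; rewrite inE XXs orbT].
have [||||A6 [F6 [f6 [Y6 [[Y6s st6 sA6 A6s] [cA6 eF6 Y6A6 hlow6]]]]]] :=
  loop pG th0 hc hP (hT2 TP) hK (Y := L2) st5' (mem_head _ _) isT.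
- exact: disjointWl sL2 (dLR _ i2).
- rewrite disjoint_subset; apply/subsetP => x; rewrite in_setD => /andP[xY xL].
  have /andP[xA _] := LA4 x xL; rewrite inE; apply/negP => /(subsetP A5s).
  rewrite !in_setU (negbTE xA) (negbTE xY) orbF /=; apply/negP.
  by rewrite (disjointFr (dLR _ i1) xL).
- rewrite disjoint_subset; apply/subsetP => x /(subsetP sL2)/LA4/andP[_ xF].
  by rewrite inE in_setD (negbTE xF) andbF.
- move=> X; rewrite inE => /eqP-> B _ cB; have := T_mul TP cB cL2.
  have := card_minus R ((R2 :\: E) :\: A5) B.
  by move: cRA5 n1 n2 n3 n4 n5 n6 n7 n8 n9; lra.
rewrite /= in A6s Y6A6; rewrite /= setU0 in eF6; subst F6.
have cY6 : #|Y6|%:R <= q.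
  by apply: le_trans cL2; rewrite ler_nat subset_leq_card.
have cA65 : #|A6 :\: A5|%:R <= T%:R * q.
  apply: T_mul TP _ cY6.
  by rewrite cardsD (setIidPr sA6) leq_subLR.
(* The three terms come from [E], from the initial path and from the last loop. They are below mu,
   so the back end is still extendable. *)
have lossR : #|R2 :\: (R2 :\: E :\: A6)|%:R <= q + (k%:R + T%:R * q) + T%:R * q.
  apply: (@le_trans _ _ (#|E| + #|A1| + #|A6 :\: A5|)%:R).
    rewrite ler_nat -(leq_add2l 0) (leq_trans _ (leq_add (leq_card_setU E A1) (leqnn _))) //.
    rewrite (leq_trans _ (leq_card_setU _ _)) // subset_leq_card //; apply/subsetP => x.
    move=> /setDP[xR h]; rewrite !in_setU.
    have [//|xE /=] := boolP (x \in E).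
    have xRE : x \in R2 :\: E by rewrite in_setD xE.
    have xA6 : x \in A6 by move: h; rewrite in_setD xRE andbT negbK.
    have [/(R2A5 x xRE)->//|xA5] := boolP (x \in A5).
    by rewrite in_setD xA5 xA6 orbT.
  by rewrite !natrD !lerD.
have eY6 : Y6 = L2.
  apply/eqP; rewrite eqEsubset Y6s /=; apply/subsetP => v vL; apply: contraT => vY.
  have := hlow6 v; rewrite in_setD vL vY => /(_ isT); rewrite e3 => h.
  have vQ : v \notin Q.
    have /andP[vA _] := LA4 v (subsetP sL2 _ vL); apply: contra vA => vQ.
    by apply: (subsetP A14); apply: (subsetP QA1).
  have h1 := nlow vQ.
  have e1 := card_minus R (nbs v S2) Q.
  have e2 := card_minus R (nbs v S2 :\: Q) (R2 :\: (R2 :\: E :\: A6)).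
  have e4 : nbs v S2 :\: Q :\: (R2 :\: (R2 :\: E :\: A6)) = nbs v (R2 :\: E :\: A6).
    apply/setP => x; rewrite !(in_nbs, in_setD).
    by case: (x \in S2); case: (x \in Q); case: (x \in E); case: (x \in A6); case: (adj _ _ _).
  rewrite e4 in e2.
  have h2 : p / 4 * (15 * (T%:R * t)) <= p / 4 * #|S2|%:R.
    by rewrite ler_wpM2l ?divr_ge0 ?(ltW p0) // -cS.
  have h' : p * t <= p * (T%:R * t) by rewrite ler_wpM2l ?(ltW p0).
  by move: h h1 h2 h' e1 e2 lossR (cQ) n1 n2 n3 n4 n5 n6 n7 n9; lra.
have cover x : (x \in A6) || (x \in F2).
  apply/norP => -[xA xF]; case/negP: (xA).
  have xA5 : x \notin A5 by apply: contra xA => /(subsetP sA6).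
  have xL : x \in L.
    by rewrite in_setC in_setU negb_or xF andbT; apply: contra xA5 => /(subsetP sA5).
  apply: (subsetP Y6A6); rewrite eY6 in_setD xL andbT.
  by apply: contra xA5 => /(subsetP Y5A5).
have [kf6 kb6 fA6 _] := flex_kpath st6.1.
have [sf6 sb6 dAF6 hfl] := st6.1.
have gb6 : good 1 (R2 :\: E :\: A6) b.
  apply: (good_shrink p0 p1 th0 gb); first by apply: (subset_trans (subsetDl _ _)); apply: subsetDl.
  by apply: (le_trans lossR); move: n1 n2 n3 n5 n6; lra.
have gf6 : good 1 (R2 :\: E :\: A6) f6 by apply: st6.2; rewrite inE.
have [c [_ uc cX kc]] := hc sf6 sb6 kf6 kb6 gf6 gb6.
have cA x : x \in c -> x \notin A6 by move/cX; rewrite in_setD => /andP[].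
(* Only now is [W] chosen: all absorbable vertices that neither the later rounds nor the closing
   path have used. *)
have [|s [us sE ks tf tb]] := hfl (F2 :\: A5 :\: A6 :\: [set x in c]).
  exact: subsetDl.
have ss : (k <= size s)%N by rewrite -sf6 -tf size_take_min geq_minr.
exists (s ++ c); split.
- rewrite cat_uniq us uc andbT; apply/hasPn => x xc; rewrite /= sE in_setU (negbTE (cA x xc)) /=.
  by rewrite in_setD inE xc.
- move=> x; rewrite mem_cat sE in_setT !(in_setU, in_setD) inE.
  have := cover x; case xc: (x \in c); rewrite ?orbT //=.
  case xA: (x \in A6) => //= xF; rewrite xF /= !andbT orbF.
  by apply/negP => /(subsetP sA6); rewrite xA.
- rewrite takel_cat // tf -catA.
  have e1 : s = rev (drop k (rev s)) ++ rev b.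
    by rewrite -tb -rev_cat cat_take_drop revK.
  rewrite e1 -catA; apply: kpath_glue; rewrite ?size_rev ?sb6 //.
  by rewrite -e1.
Qed.

End Reservoirs.

End Assembly.

(** * From cyclic orders to powers of Hamilton cycles *)

Section CyclicOrder.
Variables (V : finType) (G : sgraph V).
Implicit Types (x y v : V) (z w : seq V).

Lemma index_next z x : uniq z -> x \in z ->
  index (next z x) z = ((index x z).+1 %% size z)%N.
Proof.
case: z => // y s us xz; rewrite next_nth xz.
have : (index x (y :: s) < (size s).+1)%N by rewrite index_mem.
set i := index x _; rewrite ltnS leq_eqVlt => /orP[/eqP->|h].
  by rewrite nth_default // [RHS]modnn /= eqxx.
by rewrite -[nth y s i]/(nth y (y :: s) i.+1) index_uniq // modn_small.
Qed.

Definition cycle_rel z : rel V := fun x y => (next z x == y) || (next z y == x).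

Lemma cycle_rel_sym z : symmetric (cycle_rel z).
Proof. by move=> x y; rewrite /cycle_rel orbC. Qed.

Lemma cycle_rel_irr z : uniq z -> (forall x, x \in z) -> (2 <= size z)%N ->
  irreflexive (cycle_rel z).
Proof.
move=> uz az sz x; rewrite /cycle_rel orbb; apply/negbTE/eqP => /(congr1 (index^~ z)).
rewrite index_next //; have : (index x z < size z)%N by rewrite index_mem.
set i := index x z; rewrite leq_eqVlt => /orP[/eqP e|h]; last by rewrite modn_small //; lia.
rewrite e modnn; lia.
Qed.

(** [a] counts the forward steps of the walk and [b] the backward ones. *)
Lemma cycle_walk (C : sgraph V) z x w : uniq z -> (forall x, x \in z) ->
  adj C =2 cycle_rel z -> path (adj C) x w ->
  exists a b, (a + b <= size w)%N /\
    (index x z + a = index (last x w) z + b %[mod size z])%N.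
Proof.
move=> uz az eC; elim: w x => [|x' w IH] x /=; first by exists 0, 0.
case/andP; rewrite eC => xx' /IH[a [b [ab e]]].
case/orP: xx' => /eqP exx'.
  exists a.+1, b; split; first by rewrite addSn ltnS.
  by rewrite -e addnS -addSn -modnDml -index_next // exx'.
exists a, b.+1; split; first by rewrite addnS ltnS.
apply/eqP; rewrite -exx' index_next // modnDml addSn addnS.
by rewrite -(add1n (_ + a)) -(add1n (_ + b)) eqn_modDl; apply/eqP.
Qed.

(** Connectedness supplies a walk with fewer than |V| steps, so [dist] does not take its default
    value. *)
Lemma power_adj_walk (C : sgraph V) k x y : power_adj C k x y ->
  x != y /\ exists w, [/\ path (adj C) x w, last x w = y & (size w <= k)%N].
Proof.
case/and3P=> xy cxy dk; split=> //.
have hw : has (has_walk C x y) (iota 0 #|V|).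
  have [w pw ey] := connectP cxy; case: (shortenP pw) ey => w' pw' uw' _ ey.
  apply/hasP; exists (size w').
    rewrite mem_iota add0n; have := max_card (mem (x :: w')).
    by rewrite (card_uniqP uw').
  by apply/existsP; exists (in_tuple w'); rewrite pw' /= -ey.
have := nth_find 0 hw; rewrite nth_iota; last by rewrite -[X in (_ < X)%N](size_iota 0) -has_find.
rewrite add0n => /existsP[w /andP[pw /eqP ey]]; exists w; split=> //.
by rewrite size_tuple.
Qed.

Lemma hamilton_power_of z k (C : sgraph V) : (3 <= #|V|)%N -> uniq z ->
  (forall x, x \in z) -> adj C =2 cycle_rel z ->
  subrel (power_adj C k) (adj G) -> has_hamilton_cycle_power G k.
Proof.
move=> V3 uz az eC sub; exists C; split=> //; exists z; split=> //.
rewrite -(card_uniqP uz); apply: leq_trans V3 _; apply: subset_leq_card.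
by apply/subsetP => x _.
Qed.

(** The first k vertices are repeated to turn cyclic distances up to k into linear ones. This
    condition cannot hold if k >= |V|, even in a complete graph, which is why that case is a
    separate alternative. *)
Lemma cyclic_kpath z k : (3 <= #|V|)%N -> uniq z -> (forall x, x \in z) ->
  (kpath G k (z ++ take k z) \/ forall x y, x != y -> adj G x y) ->
  has_hamilton_cycle_power G k.
Proof.
move=> V3 uz az hz.
have sz : (3 <= size z)%N.
  rewrite -(card_uniqP uz); apply: leq_trans V3 _; apply: subset_leq_card.
  by apply/subsetP => x _.
pose C := SGraph (cycle_rel_sym z) (cycle_rel_irr uz az (ltnW sz)).
apply: (hamilton_power_of (C := C) V3 uz az) => // x y /power_adj_walk[xy [w [pw ew sw]]].
case: hz => [kz|/(_ x y xy)//].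
have [a [b [ab e]]] := cycle_walk uz az (C := C) (fun _ _ => erefl) pw.
rewrite ew in e; have {ab} ab := leq_trans ab sw.
(* Otherwise the first vertex and its copy in [z ++ z] would have to be adjacent. *)
have km : (k < size z)%N.
  rewrite ltnNge; apply/negP => mk; move: kz; rewrite take_oversize // => /(kpathP _ _ _ x) h.
  have := h 0%N (size z); rewrite size_cat nth_cat nth_cat ltnn subnn (ltnW (ltnW sz)) adj_irr.
  by move=> h'; case: (notF (h' _ _ _)) => //; rewrite -[X in (X < _)%N]addn0 ltn_add2l (ltnW (ltnW sz)).
have steps u v d : u != v -> (d <= k)%N -> (index u z + d = index v z %[mod size z])%N -> adj G u v.
  move=> uv dk ed; have iu : (index u z < size z)%N by rewrite index_mem.
  have iv : (index v z < size z)%N by rewrite index_mem.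
  have d0 : (0 < d)%N.
    rewrite lt0n; apply: contraNneq uv => d0; move: ed; rewrite d0 addn0 !modn_small // => e'.
    by rewrite -(nth_index u (az u)) e' nth_index.
  move: kz => /(kpathP _ _ _ u)/(_ (index u z) (index u z + d)%N).
  rewrite size_cat size_takel ?(ltnW km) // nth_cat iu nth_index // nth_cat.
  rewrite -[X in (X < _ + d)%N]addn0 ltn_add2l d0 leq_add2l dk.
  have -> : (index u z + d < size z + k)%N by apply: leq_trans (_ : size z + d <= _)%N; rewrite ?ltn_add2r ?leq_add2l.
  case: ltnP => h; move=> /(_ isT isT isT).
    by move: ed; rewrite !modn_small // => ->; rewrite nth_index.
  have h1 : (index u z + d - size z < k)%N by clear -h iu dk; lia.
  rewrite nth_take //; move: ed; rewrite -(subnK h) modnDr !modn_small //; last exact: ltn_trans h1 km.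
  by rewrite subnK // => ->; rewrite nth_index.
have [ba|/ltnW ab'] := leqP b a.
  apply: (steps x y (a - b)%N) => //; first by clear -ab; lia.
  by apply/eqP; rewrite -(eqn_modDr b) -addnA subnK //; apply/eqP.
rewrite adjC; apply: (steps y x (b - a)%N); rewrite 1?eq_sym //; first by clear -ab; lia.
by apply/eqP; rewrite -(eqn_modDr a) -addnA subnK // eq_sym; apply/eqP.
Qed.

End CyclicOrder.

(** * Choice of the constants *)

Section Constants.
Variables (R : realType) (V : finType) (G : sgraph V).
Implicit Types (p eta K L th : R).
Local Notation N := (#|V|%:R : R).

(* With high degrees, sparse density contradicts [ps_dense] for a set of
   about [#|V| / 8] vertices and its complement. *)
Lemma pseudo_order p eta S L : pseudo G p (eta * p ^+ S * N ^+ 2) -> (0 < #|V|)%N ->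
  0 < eta -> 0 < L -> 2 * eta * L <= 1 -> 256 * eta <= 1 ->
  L ^+ 2 * eta <= (3 / 16) ^+ (2 * S) -> L <= p ^+ S * N.
Proof.
move=> pG V0 eta0 L0 h1 h2 h3; have p0 := ps_gt0 pG; have p1 := ps_le1 pG.
have N0 : 0 < N by rewrite ltr0n.
have pS0 : 0 < p ^+ S by rewrite exprn_gt0.
have pS1 : p ^+ S <= 1 by rewrite exprn_ile1 // ltW.
have nonadj (x : V) : N - #|nbs G x setT|%:R <= eta * p ^+ S * N ^+ 2.
  apply: le_trans (ps_low pG [set x]); rewrite cards1 mulr1.
  have := card_minus R [set: V] (nbs G x setT); rewrite cardsT => h; apply: (le_trans h).
  rewrite ler_nat subset_leq_card //; apply/subsetP => y; rewrite !inE andbT /= => xy.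
  have -> : nbs G y [set x] = set0.
    by apply/setP => u; rewrite !inE; case: eqP => //= ->; rewrite adjC (negbTE xy).
  by rewrite cards0 cards1 mulr1 divr_gt0.
(* A vertex of degree at most N/2 turns [nonadj] into N/2 <= K, and p^S N >= 1/(2 eta) follows at
   once. *)
have [/existsP[x hx]|] := boolP [exists x, #|nbs G x setT|%:R <= N / 2].
  have h : 1 / 2 * N <= eta * (p ^+ S * N) * N.
    by have := nonadj x; rewrite expr2; move: hx; lra.
  rewrite ler_pM2r // in h.
  rewrite -(ler_pM2l eta0); move: h h1; lra.
rewrite negb_exists => /forallP hd.
have {}hd x : N / 2 < #|nbs G x setT|%:R by rewrite ltNge.
(* No vertex is adjacent to itself, so [nonadj] yields 1 <= K even in a complete graph. *)
have N1 : 1 <= eta * p ^+ S * N ^+ 2.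
  have /card_gt0P[x _] : (0 < #|{: V}|)%N by [].
  apply: le_trans (nonadj x); rewrite lerBrDr nat1r ler_nat.
  have : nbs G x setT \subset [set~ x].
    by apply/subsetP => y; rewrite !inE /= => /adj_neq; rewrite eq_sym.
  move/subset_leq_card; rewrite cardsC1; move: V0; case: #|V| => //.
have N2 : 1 <= eta * N ^+ 2.
  apply: (le_trans N1); rewrite ler_wpM2r ?sqr_ge0 // ler_piMr //; exact: ltW.
have N16 : 16 <= N.
  rewrite leNgt; apply/negP => hN; have : N ^+ 2 < 256.
    have -> : 256 = 16 ^+ 2 :> R by rewrite -natrX.
    by rewrite ltrXn2r // nnegrE.
  rewrite -(ltr_pM2l eta0); move: N2 h2; lra.
have [A _ cA] : exists2 A : {set V}, A \subset [set: V] & #|A| = (#|V| %/ 8)%N.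
  by apply: subset_card; rewrite cardsT leq_div.
have A1 : #|A|%:R <= N / 8.
  have : ((#|V| %/ 8) * 8)%:R <= N by rewrite ler_nat leq_divM.
  by rewrite cA natrM; lra.
have A2 : N / 16 <= #|A|%:R.
  have : N < ((#|V| %/ 8).+1 * 8)%:R by rewrite ltr_nat ltn_ceil.
  by rewrite cA natrM -natr1; move: N16; lra.
have p3 : 3 / 16 < p.
  rewrite ltNge; apply/negP => p3.
  have TN : #|~: A|%:R <= N by rewrite ler_nat max_card.
  (* Each vertex has at least N/2 - N/8 = 3N/8 neighbours outside [A]; for p <= 3/16 this is at
     least 2p times the size of the complement, as [ps_dense] requires. *)
  suff : ~ #|A|%:R * (3 / 8 * N) ^+ 2 <= eta * p ^+ S * N ^+ 2 * p ^+ 2 * #|~: A|%:R.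
    apply; apply: (ps_dense pG).
  - by rewrite -setI_eq0 setICr.
  - move=> v _; have := card_minus R (nbs G v setT) A.
    have -> : nbs G v setT :\: A = nbs G v (~: A) by apply/setP => y; rewrite !inE.
    by move: (hd v) A1; lra.
  - apply: le_trans (_ : 2 * p * N <= _); first by rewrite ler_pM2l // mulr_gt0.
    by apply: ler_wpM2r => //; move: p3; lra.
  apply/negP; rewrite -ltNge.
  apply: (@le_lt_trans _ _ (eta * N ^+ 2 * N)).
    apply: ler_pM => //; rewrite ?mulr_ge0 ?sqr_ge0 ?exprn_ge0 ?(ltW eta0) ?(ltW p0) //.
    have -> : eta * p ^+ S * N ^+ 2 * p ^+ 2 = p ^+ (S + 2) * (eta * N ^+ 2) by rewrite exprD; ring.
    rewrite ler_piMl ?mulr_ge0 ?sqr_ge0 ?(ltW eta0) //.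
    by rewrite exprn_ile1 // ltW.
  apply: (@lt_le_trans _ _ (N / 16 * (3 / 8 * N) ^+ 2)); last first.
    by rewrite ler_wpM2r ?sqr_ge0.
  have -> : N / 16 * (3 / 8 * N) ^+ 2 = 9 / 1024 * N ^+ 2 * N by field.
  rewrite ltr_pM2r // ltr_pM2r ?exprn_gt0 //; move: h2; lra.
have pN0 : 0 <= p ^+ S * N by rewrite mulr_ge0 // ltW.
rewrite -(ler_pXn2r (n := 2)) ?nnegrE //; last exact: ltW.
rewrite -(ler_pM2r eta0); apply: (le_trans h3).
apply: le_trans (_ : p ^+ (2 * S) <= _).
  by rewrite lerXn2r ?nnegrE ?(ltW p0) ?(ltW p3) //; lra.
have -> : (p ^+ S * N) ^+ 2 * eta = p ^+ (2 * S) * (eta * N ^+ 2).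
  by rewrite exprMn -exprM mulnC; ring.
by rewrite ler_peMr // exprn_ge0 // ltW.
Qed.

End Constants.

Section Threshold.
Variable R : realType.

Lemma pos_lower_bound (s : seq R) : all (fun x => 0 < x) s ->
  exists2 e : R, 0 < e & all (fun x => e <= x) s.
Proof.
elim: s => [_|x s IH /= /andP[x0 /IH[e e0 /allP h]]]; first by exists 1.
exists (Num.min e x); first by rewrite lt_min e0.
rewrite ge_min lexx orbT /=; apply/allP => y /h; apply: le_trans.
by rewrite ge_min lexx.
Qed.

Section Fixed.
Variables (V : finType) (G : sgraph V) (p th eta : R) (n T S : nat).
Local Notation N := (#|V|%:R : R).
Local Notation k := n.+1.
Local Notation w := (th / 8 ^+ n.+2).
Hypothesis pG : pseudo G p (eta * p ^+ S * N ^+ 2).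
Hypotheses (th0 : 0 < th) (eta0 : 0 < eta) (n0 : (0 < n)%N)
  (hS : (2 * n + 1 <= S)%N) (hT : (3 * k <= T)%N)
  (hN : 64 * T%:R <= w * (p ^+ S * N))
  (e1 : 16 * T%:R * eta <= w * th) (e2 : 2 * (5 * k)%:R * eta <= w * w).

Let p0 : 0 < p. Proof. exact: ps_gt0 pG. Qed.
Let p1 : p <= 1. Proof. exact: ps_le1 pG. Qed.
Let T1 : 1 <= T%:R :> R. Proof. by rewrite ler1n (leq_trans _ hT). Qed.
Let w0 : 0 < w. Proof. by rewrite divr_gt0 // exprn_gt0. Qed.

Let N0 : 0 < N.
Proof.
rewrite lt_neqAle ler0n andbT eq_sym; apply/eqP => e.
by move: hN; rewrite e !mulr0 => h; move: h T1; lra.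
Qed.

Let pow_le i : (i <= S)%N -> p ^+ S <= p ^+ i.
Proof. by move=> iS; apply: ler_wiXn2l => //; exact: ltW. Qed.

Let pow8 i : (i <= n.+2)%N -> (i <= S)%N -> w * (p ^+ S * N) <= th * (p / 8) ^+ i * N.
Proof.
move=> in2 iS; rewrite expr_div_n.
have -> : th * (p ^+ i / 8 ^+ i) * N = th / 8 ^+ i * (p ^+ i * N) by ring.
apply: ler_pM.
- exact: ltW.
- by rewrite mulr_ge0 // exprn_ge0 // ltW.
- rewrite ler_pM2l // lef_pV2 ?posrE ?exprn_gt0 //.
  by rewrite ler_eXn2l // ltr1n.
- by rewrite ler_pM2r // pow_le.
Qed.

Lemma many_vertices i : (i <= n.+2)%N -> (i <= S)%N ->
  64 * T%:R <= th * (p / 8) ^+ i * N.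
Proof. by move=> h1 h2; apply: le_trans (pow8 h1 h2). Qed.

(** [w] takes up all powers of 8, so that only the exponents of p remain to be compared. *)
Lemma small_defect i j : (i <= n.+2)%N -> (j <= n.+2)%N -> (i + j <= S)%N ->
  2 * (5 * k)%:R * (eta * p ^+ S * N ^+ 2)
    <= th * (p / 8) ^+ i * N * (th * (p / 8) ^+ j * N).
Proof.
move=> hi hj ij; apply: le_trans (_ : w * w * p ^+ S * N ^+ 2 <= _).
  have -> : 2 * (5 * k)%:R * (eta * p ^+ S * N ^+ 2)
    = 2 * (5 * k)%:R * eta * (p ^+ S * N ^+ 2) by ring.
  by rewrite -[X in _ <= X]mulrA ler_pM2r // mulr_gt0 ?exprn_gt0.
have -> : th * (p / 8) ^+ i * N * (th * (p / 8) ^+ j * N)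
   = th / 8 ^+ i * (th / 8 ^+ j) * p ^+ (i + j) * N ^+ 2.
  by rewrite !expr_div_n exprD; ring.
have h8 m : (m <= n.+2)%N -> w <= th / 8 ^+ m.
  move=> hm; rewrite ler_pM2l // lef_pV2 ?posrE ?exprn_gt0 //.
  by rewrite ler_eXn2l // ltr1n.
rewrite ler_pM2r ?exprn_gt0 //; apply: ler_pM.
- by rewrite mulr_ge0 // ltW.
- by rewrite exprn_ge0 // ltW.
- by apply: ler_pM; rewrite ?h8 // ltW.
- exact: pow_le.
Qed.

Let nS : (n.+1 <= S)%N.
Proof. by apply: leq_trans hS; rewrite addn1 ltnS mul2n -addnn leq_addr. Qed.

Lemma many_vertices_connect m : (m <= T)%N -> m%:R <= th / 8 ^+ k * p ^+ k * N.
Proof.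
move=> mT; have -> : th / 8 ^+ k * p ^+ k * N = th * (p / 8) ^+ k * N.
  by rewrite expr_div_n; ring.
apply: le_trans (many_vertices (leqnSn _) nS).
have : m%:R <= T%:R :> R by rewrite ler_nat.
by move: T1; lra.
Qed.

Lemma cycle_of_pieces Tc Ta : connects G p th n Tc -> piece_maker G p th k Ta true ->
  (1 + (2 * k + 1) + Tc <= T)%N -> (1 + Ta + Tc <= T)%N ->
  256 * T%:R ^+ 2 * th <= 1 -> (forall v, th * N * p <= #|nbs G v setT|%:R) ->
  exists z, [/\ uniq z, z =i setT & kpath G k (z ++ take k z)].
Proof.
move=> hc hA hTp hTa hth hdeg.
have mT m : (m <= T)%N -> 2 * m%:R < th * (p / 8) ^+ k * N.
  move=> mT; have := many_vertices (leqnSn _) nS; have : m%:R <= T%:R :> R by rewrite ler_nat.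
  by move: T1; lra.
have kk : (n.+1 + n <= S)%N by apply: leq_trans hS; rewrite mul2n -addnn addn1.
have hK := small_defect (leqnSn _) (leq_trans (leqnSn n) (leqnSn _)) kk.
have hP : piece_maker G p th k (2 * k + 1) false.
  by apply: (plain_pieces pG) => //; exact: mT.
have hq : 8 * T%:R * (eta * p ^+ S * N ^+ 2 / (th * N) + 2) <= th * (p / 8) ^+ k * N.
  have -> : eta * p ^+ S * N ^+ 2 / (th * N) = eta / th * (p ^+ S * N).
    by field; rewrite ?gt_eqF.
  have h : 16 * T%:R * (eta / th) <= w by rewrite mulrA ler_pdivrMr.
  have h2 : 16 * T%:R * (eta / th) * (p ^+ S * N) <= w * (p ^+ S * N).
    by rewrite ler_pM2r // mulr_gt0 ?exprn_gt0.
  have := pow8 (leqnSn _) nS; move: hN h2; rewrite mulrDr -!mulrA.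
  move: (T%:R * (_ * _)) => y; move: T1; lra.
have kT : (n < T)%N by apply: leq_trans hT; rewrite leq_pmull.
have [S1 [S2 [dS cS S1l S1u]]] := reservoirs pG th0 kT hq hth.
exact: (reservoir_cycle pG th0 hc hP hA hTp hTa kT hq hK hdeg dS cS S1l S1u).
Qed.

End Fixed.

(** As K is of order gamma^2/p^2, the exponents 5/2 and 3k/2 of gamma become 5 - 2 and 3k - 2, where
    k = n + 1. *)
Definition exponent (n : nat) : nat := if n == 1%N then 3 else (3 * n + 1)%N.

Lemma exponent_le n : (0 < n)%N -> (2 * n + 1 <= exponent n)%N.
Proof. by rewrite /exponent; case: eqP => [->//|_] _; rewrite leq_add2r leq_mul2r orbT. Qed.

Lemma hamilton_pseudo (n : nat) (beta : R) : (0 < n)%N -> 0 < beta ->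
  exists2 e, 0 < e & forall (eta p : R) (V : finType) (G : sgraph V),
    0 < eta -> eta <= e -> (0 < #|V|)%N ->
    pseudo G p (eta * p ^+ exponent n * #|V|%:R ^+ 2) ->
    (forall v, beta * p * #|V|%:R <= #|nbs G v setT|%:R) ->
    exists z, [/\ uniq z, z =i setT & kpath G n.+1 (z ++ take n.+1 z)].
Proof.
move=> n0 beta0; set S := exponent n.
(* The largest cost of a round: 1 + 40 + 14 for squares, and 1 + (2k + 1) + 3k otherwise. *)
pose T : nat := if n == 1%N then 55 else (5 * n.+1 + 2)%N.
have T0 : (0 < T)%N by rewrite /T; case: ifP.
have TR : 1 <= T%:R :> R by rewrite ler1n.
pose th : R := Num.min beta 1 / (256 * T%:R ^+ 2).
have T2 : 1 <= T%:R ^+ 2 :> R by rewrite exprn_ege1.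
have th0 : 0 < th.
  by rewrite divr_gt0 ?lt_min ?beta0 //; move: T2; lra.
have hth : 256 * T%:R ^+ 2 * th <= 1.
  rewrite /th mulrC divfK ?ge_min ?lexx ?orbT //; apply/eqP; move: T2; lra.
have thb : th <= beta.
  apply: le_trans (_ : Num.min beta 1 <= _); last by rewrite ge_min lexx.
  rewrite /th ler_pdivrMr; last by move: T2; lra.
  rewrite ler_peMr ?le_min ?(ltW beta0) //; move: T2; lra.
have th1 : th <= 1.
  have : th <= 256 * T%:R ^+ 2 * th by rewrite ler_peMl ?(ltW th0) //; move: T2; lra.
  by move/le_trans; apply.
pose w := th / 8 ^+ n.+2; have w0 : 0 < w by rewrite divr_gt0 // exprn_gt0.
pose L := 64 * T%:R / w; have L0 : 0 < L by rewrite divr_gt0 // mulr_gt0 // ltr0n.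
pose b := th / 8 ^+ n.+1 / (6 * n.+1)%:R.
have b0 : 0 < b by do 2 apply: divr_gt0 => //; rewrite ?exprn_gt0 ?ltr0n.
have [dB0 _ _ _] := dB_prop R n; have [dB1 _ _ _] := dB_prop R 1.
pose c := th / 8 ^+ 2 / 56; have c0 : 0 < c by do 2 apply: divr_gt0 => //; rewrite exprn_gt0.
pose ka := th / 96 / 32; have ka0 : 0 < ka by do 2 apply: divr_gt0 => //.
(* The bounds on eta serve, in order, [e1] and [e2] (two), [pseudo_order] (three), [connects_large]
   (one), [connects_square] (two) and the absorbers for squares (one). *)
have [|e e0] := @pos_lower_bound [:: w * th / (16 * T%:R); w * w / (2 * (5 * n.+1)%:R);
    1 / 256; 1 / (2 * L); (3 / 16) ^+ (2 * S) / L ^+ 2; dB R n * (b * b); c ^+ 3 / 256;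
    dB R 1 * ((c / 32) * (c / 32)); ka ^+ 3].
  have T0' : 0 < T%:R :> R by rewrite ltr0n.
  have k0' : 0 < (5 * n.+1)%:R :> R by rewrite ltr0n.
  have L2 : 0 < L ^+ 2 by rewrite exprn_gt0.
  by rewrite /= !(dB0, dB1, w0, th0, L0, L2, c0, ka0, b0, mulr_gt0, invr_gt0, exprn_gt0) ?ltr0n.
rewrite /= => /and5P[h1 h2 h3 h4 /and5P[h5 h6 h7 h8 h9]].
exists e => // eta p V G eta0 etae V0 pG hdeg.
have {h9} /andP[h9 _] := h9.
have p0 := ps_gt0 pG; have p1 := ps_le1 pG.
have le_e x : e <= x -> eta <= x by apply: le_trans.
have hS := exponent_le n0; rewrite -/S in hS.
have hT : (3 * n.+1 <= T)%N.
  rewrite /T; case: eqP => [->//|_]; apply: leq_trans (leq_addr _ _).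
  by rewrite leq_mul2r orbT.
have e1 : 16 * T%:R * eta <= w * th.
  by rewrite mulrC -ler_pdivlMr ?le_e // mulr_gt0 // ltr0n.
have e2 : 2 * (5 * n.+1)%:R * eta <= w * w.
  by rewrite mulrC -ler_pdivlMr ?le_e // mulr_gt0 // ltr0n.
have hN : 64 * T%:R <= w * (p ^+ S * #|V|%:R).
  rewrite [X in _ <= X]mulrC -ler_pdivrMr // -/L; apply: (pseudo_order pG) => //.
  - by rewrite mulrAC mulrC -ler_pdivlMr ?mul1r; [apply: le_e; rewrite -[(_)^-1]mul1r|rewrite mulr_gt0].
  - by rewrite mulrC -ler_pdivlMr ?le_e.
  - by rewrite mulrC -ler_pdivlMr ?le_e // exprn_gt0.
have mv := many_vertices pG th0 hT hN.
have sd := small_defect pG th0 hT hN e2.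
have mvc := many_vertices_connect pG th0 hS hT hN.
have hdeg' v : th * #|V|%:R * p <= #|nbs G v setT|%:R.
  by apply: le_trans (hdeg v); rewrite mulrAC ler_wpM2r // ler_wpM2r // ltW.
have TT m : (m <= T)%N -> m%:R <= T%:R :> R by rewrite ler_nat.
case: (eqVneq n 1%N) => [n1|n1].
  subst n; have hc : connects G p th 1 14.
    by apply: (connects_square th0 th1 eta0 pG); [exact: le_e|exact: le_e|exact: (mvc 14)].
  apply: (cycle_of_pieces pG th0 hS hT hN e1 e2 hc (Ta := 40)) => //.
  apply: (square_absorbing_pieces pG th0 th1 eta0) => //; first exact: le_e.
  by apply: le_trans (mv 2 isT isT); rewrite -natrM ler_nat.
have n2 : (2 <= n)%N by rewrite ltn_neqAle eq_sym n1.
have eT : T = (5 * n.+1 + 2)%N by rewrite /T (negbTE n1).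
have eS : S = (3 * n + 1)%N by rewrite /S /exponent (negbTE n1).
(* The exponent of the simple absorbing pieces; here n >= 2 is essential. *)
have kS : (n.+2 + n.+1 <= S)%N by rewrite eS; clear -n2; lia.
have hc : connects G p th n (3 * n.+1).
  rewrite eS in pG; apply: (connects_large th0 (ltW eta0) pG); first exact: le_e.
  exact: mvc.
apply: (cycle_of_pieces pG th0 hS hT hN e1 e2 hc (Ta := (2 * n.+1)%N)) => //.
- apply: (absorbing_pieces pG) => //; last exact: sd.
  apply: lt_le_trans (mv n.+2 (leqnn _) (leq_trans (leq_addr _ _) kS)).
  have : n.+1%:R <= T%:R :> R by apply: TT; apply: leq_trans hT; rewrite leq_pmull.
  by move: TR; lra.
- by rewrite eT; clear; lia.
- by rewrite eT; clear; lia.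
Qed.

End Threshold.

(** * Deduction for jumbled graphs *)

Section JumbledPower.
Variable R : realType.

Lemma min_degree_le (V : finType) (G : sgraph V) v : (min_degree G <= degree G v)%N.
Proof.
rewrite /min_degree; have := mem_index_enum v; elim: (index_enum V) => // x s IH.
rewrite in_cons big_cons => /orP[/eqP->|/IH]; first exact: geq_minl.
by apply: leq_trans; apply: geq_minr.
Qed.

Lemma jumbled_le (V : finType) (G : sgraph V) (p g g' : R) : g <= g' ->
  jumbled G p g -> jumbled G p g'.
Proof.
move=> gg jG A B dAB; apply: le_trans (jG A B dAB) _.
by rewrite ler_wpM2r // sqrtr_ge0.
Qed.

(** Jumbledness is tested on two singletons. This provides the hypothesis [p <= g] of
    [jumbled_pseudo] for every graph that is not complete. *)
Lemma jumbled_nonadjacent (V : finType) (G : sgraph V) (p g : R) x y : 0 <= p ->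
  jumbled G p g -> x != y -> ~~ adj G x y -> p <= g.
Proof.
move=> p0 jG xy nxy; have := jG [set x] [set y].
rewrite disjoints1 in_set1 => /(_ xy); rewrite !cards1 !mulr1 sqrtr1 mulr1.
have -> : num_edges G [set x] [set y] = 0%N.
  apply/eqP; rewrite cards_eq0; apply/eqP/setP => e; rewrite in_set0; apply/negP.
  by case/imset2P=> u v /set1P-> ; rewrite inE => /andP[/set1P->]; rewrite (negbTE nxy).
by rewrite sub0r normrN ger0_norm.
Qed.

(** [g] stands for a power of p with a possibly half-integral exponent; only its square enters, so
    real exponents are confined to the last proof. *)
Lemma hamilton_jumbled (n : nat) (beta : R) : (0 < n)%N -> 0 < beta ->
  exists2 e : R, 0 < e & forall (eps p g : R) (V : finType) (G : sgraph V),
    0 < eps -> eps <= e -> 0 < p -> p < 1 -> (3 <= #|V|)%N ->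
    beta * p * #|V|%:R <= (min_degree G)%:R ->
    g ^+ 2 = p ^+ (exponent n + 2) ->
    jumbled G p (eps * g * #|V|%:R) -> has_hamilton_cycle_power G n.+1.
Proof.
move=> n0 beta0; have [e e0 he] := hamilton_pseudo n0 beta0.
have m0 : 0 < Num.min 1 e by rewrite lt_min ltr01.
(* Here eta = 64 eps^2 = (8 eps)^2, which is at most e because 8 eps is at most both 1 and e. *)
exists (Num.min 1 e / 8) => [|eps p g V G eps0 epse p0 p1 V3 hdeg hg jG].
  by rewrite divr_gt0.
have uV : uniq (enum V) := enum_uniq V.
have aV (x : V) : x \in enum V by rewrite mem_enum.
have [cG|] := boolP [forall x, forall y, (x != y) ==> adj G x y].
  apply: (cyclic_kpath V3 uV aV); right=> x y xy.
  by have /forallP/(_ x)/forallP/(_ y)/implyP := cG; apply.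
rewrite negb_forall => /existsP[x]; rewrite negb_forall => /existsP[y].
rewrite negb_imply => /andP[xy nxy].
have pg := jumbled_nonadjacent (ltW p0) jG xy nxy.
have := jumbled_pseudo p0 (ltW p1) pg jG.
have -> : 64 * (eps * g * #|V|%:R) ^+ 2 / p ^+ 2
    = (64 * eps ^+ 2) * p ^+ exponent n * #|V|%:R ^+ 2 :> R.
  by rewrite !exprMn hg exprD; field; rewrite gt_eqF.
move=> pG; have [||||z [uz zT kz]] := he _ _ _ _ _ _ _ pG.
- by rewrite mulr_gt0 // exprn_gt0.
- have h1 : Num.min 1 e <= 1 by rewrite ge_min lexx.
  have h2 : Num.min 1 e <= e by rewrite ge_min lexx orbT.
  have h3 : (8 * eps) * (8 * eps) <= Num.min 1 e * 1.
    by apply: ler_pM; rewrite ?mulr_ge0 ?(ltW eps0) //; move: epse h1; lra.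
  rewrite expr2; move: h3 h2; lra.
- exact: leq_trans V3.
- move=> v; apply: (le_trans hdeg); rewrite ler_nat.
  have -> : nbs G v setT = [set u | adj G v u] by apply/setP => u; rewrite !inE.
  exact: min_degree_le.
by apply: (cyclic_kpath V3 uz) => [u|]; [rewrite zT inE|left].
Qed.

End JumbledPower.

Theorem corollary3 (R : realType) (k : nat) (hk : (2 <= k)%N)
    (beta : R) (hbeta : 0 < beta) :
  exists2 eps : R, 0 < eps &
    forall p : R, 0 < p -> p < 1 ->
    forall (V : finType) (G : sgraph V),
      (3 <= #|V|)%N ->
      beta * p * #|V|%:R <= (min_degree G)%:R ->
      (jumbled G p (eps * p `^ (5 / 2) * #|V|%:R) ->
         has_hamilton_cycle_power G 2) /\
      (jumbled G p (eps * p `^ (3 * k%:R / 2) * #|V|%:R) ->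
         has_hamilton_cycle_power G k).
Proof.
case: k hk => // n; rewrite ltnS => n0.
have [e1 e10 h1] := @hamilton_jumbled R 1 beta isT hbeta.
have [e2 e20 h2] := hamilton_jumbled n0 hbeta.
exists (Num.min e1 e2) => [|p p0 p1 V G V3 hdeg]; first by rewrite lt_min e10.
have m0 : 0 < Num.min e1 e2 by rewrite lt_min e10.
have powR_half (m : nat) : (p `^ (m%:R / 2)) ^+ 2 = p ^+ m.
  rewrite -[LHS]powR_mulrn ?powR_ge0 // -powRrM -[RHS]powR_mulrn ?(ltW p0) //.
  by congr (_ `^ _); field.
have square : jumbled G p (Num.min e1 e2 * p `^ (5 / 2) * #|V|%:R) ->
    has_hamilton_cycle_power G 2.
  by apply: (h1 _ _ _ V G m0) => //; rewrite ge_min lexx.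
split=> //; have [n1|n1] := eqVneq n 1%N.
  (* For k = 2 the exponent 3k/2 = 3 exceeds 5/2, so (b) follows from (a). *)
  rewrite n1 => jG; apply: square; apply: jumbled_le jG.
  rewrite ler_wpM2r // ler_wpM2l ?(ltW m0) //.
  by apply: ger_powR; [rewrite p0 ltW|lra].
apply: (h2 _ _ _ V G m0) => //; first by rewrite ge_min lexx orbT.
rewrite -natrM powR_half /exponent (negbTE n1); congr (_ ^+ _).
by clear; lia.
Qed.
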